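(* Let $q$ be a positive integer, let $\mathbf f\in\frac1q\mathbb{Z}^2$, and let $\pi$ be a minimal valid function for $R_{\mathbf f}(\mathbb{R}^2,\mathbb{Z}^2)$ that is continuous piecewise linear over $\mathcal{P}_q$ and diagonally constrained. Then $\pi$ is extreme for $R_{\mathbf f}(\mathbb{R}^2,\mathbb{Z}^2)$ if and only if the restriction $\pi|_{\frac{1}{4q}\mathbb{Z}^2}$ is extreme for $R_{\mathbf f}(\frac{1}{4q}\mathbb{Z}^2,\mathbb{Z}^2)$.
   Context: Group problem. For an abelian group $G$, a subgroup $S$ and $\mathbf f\in G$, $R_{\mathbf f}(G,S)$ is the convex hull of the finitely supported functions $s\colon G\to\mathbb{Z}_{+}$ with $\sum_{\mathbf r\in G}\mathbf r\,s(\mathbf r)\in \mathbf f+S$. A function $\pi\colon G\to\mathbb{R}$ with $\pi\ge 0$ is valid for $R_{\mathbf f}(G,S)$ if $\sum_{\mathbf r\in G}\pi(\mathbf r)s(\mathbf r)\ge 1$ for all $s\in R_{\mathbf f}(G,S)$. A valid function $\pi$ is minimal if there is no valid function $\pi'\ne\pi$ with $\pi'\le\pi$ pointwise. A valid function $\pi$ is extreme if $\pi=\frac12\pi^1+\frac12\pi^2$ with $\pi^1,\pi^2$ valid implies $\pi=\pi^1=\pi^2$. Minimal functions for $R_{\mathbf f}(\mathbb{R}^2,\mathbb{Z}^2)$ are $\mathbb{Z}^2$-periodic. Complex $\mathcal{P}_q$. For a positive integer $q$, let $\mathcal{P}_q$ be the polyhedral complex triangulating $\mathbb{R}^2$ whose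 maximal faces are the translates by elements of $\frac1q\mathbb{Z}^2$ of the triangles $\frac1q\operatorname{conv}\{(0,0),(1,0),(0,1)\}$ and $\frac1q\operatorname{conv}\{(1,0),(0,1),(1,1)\}$, together with their edges and vertices. By quotienting by $\mathbb{Z}^2$ one obtains a finite complex triangulating $\mathbb{R}^2/\mathbb{Z}^2$, still denoted $\mathcal{P}_q$. Let $\mathcal{P}_{q,0}$, $\mathcal{P}_{q,1}$, $\mathcal{P}_{q,2}$ be the sets of vertices, edges, triangles, and let $\mathcal{P}_{q,\mathrm{diag}}\subset\mathcal{P}_{q,1}$ be the set of diagonal edges (those parallel to $(-1,1)$). A function $\pi\colon\mathbb{R}^2\to\mathbb{R}$ is continuous piecewise linear over $\mathcal{P}_q$ if it is affine on each triangle of $\mathcal{P}_q$. The symbols $\oplus,\ominus$ denote vector addition and subtraction modulo $1$ (also pointwise for sets); membership in faces is understood modulo $\mathbb{Z}^2$. Additivity. For nonempty faces $I,J,K\in\mathcal{P}_q$ let $F(I,J,K)=\{(\mathbf x,\mathbf y): \mathbf x\in I,\ \mathbf y\in J,\ \mathbf x\oplus\mathbf y\in K\}$. The triple $(I,J,K)$ is valid if $K\subseteq I\oplus J$; for all $\mathbf u\in I$ there is $\mathbf v\in J$ with $\mathbf u\oplus\mathbf v\in K$; and for all $\mathbf v\in J$ there is $\mathbf u\in I$ with $\mathbf u\oplus\mathbf v\in K$. $E(\pi,\mathcal{P}_q)$ is the set of valid triples $(I,J,K)$ with $\pi(\mathbf x)+\pi(\mathbf y)=\pi(\mathbf x\oplus\mathbf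 y)$ for all $(\mathbf x,\mathbf y)\in F(I,J,K)$, partially ordered by componentwise inclusion, and $E_{\max}(\pi,\mathcal{P}_q)$ is the set of its maximal elements. A continuous piecewise linear function $\pi$ on $\mathcal{P}_q$ is diagonally constrained if $(I,J,K)\in E_{\max}(\pi,\mathcal{P}_q)$ implies $I,J,K\in\mathcal{P}_{q,0}\cup\mathcal{P}_{q,\mathrm{diag}}\cup\mathcal{P}_{q,2}$. *)

(* Defs.v *)
From HB Require Import structures.
From mathcomp Require Import all_boot all_order all_algebra.
From mathcomp Require Import all_classical all_reals.

Set Implicit Arguments.
Unset Strict Implicit.
Unset Printing Implicit Defensive.
Import Order.TTheory GRing.Theory Num.Theory.
Local Open Scope classical_set_scope.
Local Open Scope ring_scope.

Definition conv_hull (R : numDomainType) (V : lmodType R) (A : set V) : set V :=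
  [set x | exists n (lam : 'I_n -> R) (v : 'I_n -> V),
     [/\ forall i, 0 <= lam i, \sum_(i < n) lam i = 1, forall i, A (v i)
       & x = \sum_(i < n) lam i *: v i]].

Section GroupProblem.
Variables (R : realType) (G : zmodType) (S : zmodClosed G) (f : G).

(* A sum over [\in [set: G]] is a sum over the support of the summand, and is
   meaningful only when that support is finite; this is the case for all the
   sums below, since s is finitely supported. *)
Definition feasible (s : G -> nat) : Prop :=
  finite_set [set r | s r != 0%N] /\
  exists2 z, z \in S & \sum_(r \in [set: G]) r *+ s r = f + z.

Definition group_relaxation : set (G -> R^o) :=
  conv_hull [set (fun r => (s r)%:R : R^o) | s in feasible].

Definition valid_function (pi : G -> R) : Prop :=
  (forall r, 0 <= pi r) /\
  (forall s, group_relaxation s -> 1 <= \sum_(r \in [set: G]) pi r * s r).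

Definition minimal_function (pi : G -> R) : Prop :=
  valid_function pi /\
  ~ exists pi' : G -> R,
      [/\ valid_function pi', pi' <> pi & forall r, pi' r <= pi r].

Definition extreme_function (pi : G -> R) : Prop :=
  valid_function pi /\
  forall pi1 pi2 : G -> R, valid_function pi1 -> valid_function pi2 ->
    pi = (fun r => 2^-1 * pi1 r + 2^-1 * pi2 r) -> pi = pi1 /\ pi = pi2.

End GroupProblem.
Arguments group_relaxation R {G} S f.

(* [grid R n] is the subgroup (1/n) Z^2 of R^2, for n > 0. *)
Definition grid (R : realType) (n : nat) : {pred 'rV[R]_2} :=
  fun x => n%:R *: x \is a mxOver Num.int.
Arguments grid : clear implicits.

Fact grid_zmod_closed (R : realType) (n : nat) : zmod_closed (grid R n).
Proof.
split=> [|x y]; rewrite -!topredE /= /grid.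
  by rewrite scaler0; apply/mxOverP => i j; rewrite mxE rpred0.
move=> /mxOverP xn /mxOverP yn; rewrite scalerBr.
apply/mxOverP => i j; rewrite mxE [X in _ + X]mxE.
by apply: rpredB; [exact: xn | exact: yn].
Qed.
HB.instance Definition _ (R : realType) (n : nat) :=
  GRing.isZmodClosed.Build 'rV[R]_2 (grid R n) (grid_zmod_closed R n).

Lemma grid_mulr (R : realType) (m n : nat) :
  {subset grid R n <= grid R (m * n)}.
Proof.
move=> x; rewrite -!topredE /= /grid => /mxOverP xn; apply/mxOverP => i j.
by rewrite natrM -scalerA mxE rpredM ?rpred_nat.
Qed.

Record grid_group (R : realType) (n : nat) :=
  GridGroup { grid_val :> 'rV[R]_2; _ : grid_val \in grid R n }.
HB.instance Definition _ (R : realType) (n : nat) :=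
  [isSub for @grid_val R n].
HB.instance Definition _ (R : realType) (n : nat) :=
  [Choice of grid_group R n by <:].
HB.instance Definition _ (R : realType) (n : nat) :=
  [SubChoice_isSubZmodule of grid_group R n by <:].

Definition Z2 (R : realType) : {pred 'rV[R]_2} := grid R 1.
Arguments Z2 : clear implicits.
HB.instance Definition _ (R : realType) := GRing.ZmodClosed.on (Z2 R).

Definition Z2_in_grid (R : realType) (n : nat) : {pred grid_group R n} :=
  fun x => val x \in Z2 R.
Arguments Z2_in_grid : clear implicits.

Fact Z2_in_grid_zmod_closed (R : realType) (n : nat) :
  zmod_closed (Z2_in_grid R n).
Proof.
split=> [|x y]; rewrite -!topredE /= /Z2_in_grid; first exact: rpred0.
exact: rpredB.
Qed.
HB.instance Definition _ (R : realType) (n : nat) :=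
  GRing.isZmodClosed.Build (grid_group R n) (Z2_in_grid R n)
    (Z2_in_grid_zmod_closed R n).

Section Complex.
Variable R : realType.
Local Notation plane := 'rV[R]_2.

Definition pt (a b : R) : plane := \row_j (if j == ord0 then a else b).

Definition lower_triangle : seq plane := [:: pt 0 0; pt 1 0; pt 0 1].
Definition upper_triangle : seq plane := [:: pt 1 0; pt 0 1; pt 1 1].

(* The k-dimensional faces of a triangle are the convex hulls of its sets of
   k + 1 vertices. *)
Definition plane_faces (q k : nat) : set (set plane) :=
  [set I | exists t T W,
     [/\ t \in grid R q, T = lower_triangle \/ T = upper_triangle,
         subseq W T, size W = k.+1
       & I = [set t + q%:R^-1 *: x | x in conv_hull [set` W]]]].

Definition parallel_to (d : plane) (I : set plane) : Prop :=
  forall x y, I x -> I y -> exists c : R, x - y = c *: d.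

Definition plane_diag (q : nat) : set (set plane) :=
  plane_faces q 1 `&` parallel_to (pt (-1) 1).

Definition affine_on (A : set plane) (pi : plane -> R) : Prop :=
  exists (l : {scalar plane}) (b : R), forall x, A x -> pi x = l x + b.

(* Affine pieces on closed triangles that cover the plane agree on the common
   faces, so that continuity is automatic. *)
Definition piecewise_linear (q : nat) (pi : plane -> R) : Prop :=
  forall T, plane_faces q 2 T -> affine_on T pi.

(* The torus R^2/Z^2 is represented by its fundamental domain [0,1)^2, onto
   which [mod1] is the projection. *)
Definition mod1 (x : plane) : plane :=
  \row_j (x ord0 j - (Num.floor (x ord0 j))%:~R).
Definition oplus (x y : plane) : plane := mod1 (x + y).
Definition set_oplus (A B : set plane) : set plane :=
  [set oplus x y | x in A & y in B].

Definition torus_faces (q k : nat) : set (set plane) :=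
  [set mod1 @` I | I in plane_faces q k].
Definition torus_diag (q : nat) : set (set plane) :=
  [set mod1 @` I | I in plane_diag q].
Definition torus_complex (q : nat) : set (set plane) :=
  torus_faces q 0 `|` torus_faces q 1 `|` torus_faces q 2.

Definition additivity_domain (I J K : set plane) : set (plane * plane) :=
  [set xy | [/\ I xy.1, J xy.2 & K (oplus xy.1 xy.2)]].

Definition valid_triple (I J K : set plane) : Prop :=
  [/\ K `<=` set_oplus I J,
      forall u, I u -> exists2 v, J v & K (oplus u v)
    & forall v, J v -> exists2 u, I u & K (oplus u v)].

Definition additive_triple (q : nat) (pi : plane -> R) (I J K : set plane) :
    Prop :=
  [/\ torus_complex q I, torus_complex q J, torus_complex q K,
      valid_triple I J K
    & forall x y, additivity_domain I J K (x, y) ->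
        pi x + pi y = pi (oplus x y)].

Definition max_additive_triple (q : nat) (pi : plane -> R)
    (I J K : set plane) : Prop :=
  additive_triple q pi I J K /\
  forall I' J' K', additive_triple q pi I' J' K' ->
    I `<=` I' -> J `<=` J' -> K `<=` K' -> [/\ I' = I, J' = J & K' = K].

Definition diagonally_constrained (q : nat) (pi : plane -> R) : Prop :=
  forall I J K, max_additive_triple q pi I J K ->
    let D := torus_faces q 0 `|` torus_diag q `|` torus_faces q 2 in
    [/\ D I, D J & D K].

End Complex.

(* Main.v *)
(* If the restriction to the grid is not extreme, interpolating a decomposition over the
   triangulation of mesh 1/(4q) gives one of pi.  The interpolation is subadditive because the bounds
   that define a domain F(I, J, K) form the constraints of a 3 x 3 transportation problem: a pair
   (x, y) is a convex combination of pairs in which more of the coordinates of x, y and x + y are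
   integral.

   Conversely let the restriction be extreme, pi = (p1 + p2) / 2 and g = p1 - pi.  Then g is
   Lipschitz, satisfies every additivity relation of pi, and vanishes on the grid.  For a point p of
   the plane there is a map Phi from the grid to the plane that takes the value p, maps every face
   to itself, commutes with the translations and point reflections of the complex, and maps points
   of the same level x1 + x2 to points of the same level.  Now g o Phi is additive wherever pi is:
   by the diagonal constraint only triples made of vertices, diagonal edges and triangles matter; if
   one member is a vertex then the relation is a translation or a point reflection; if all three
   have the same dimension then g is affine, hence zero, on them; and a diagonal edge together with
   two triangles forces g to vanish on the edge and to depend on the level only on the triangles.
   So pi +- e (g o Phi) is valid on the grid for small e, whence g o Phi = 0 and g(p) = 0.

   For q = 2 the faces wrap around the torus, and a triple that is additive in the plane need not be
   additive on the torus.  Then pi is a convex combination of the three tent functions of x1, x2 and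
   x1 + x2, it is a single tent by extremality of the restriction, and tents are extreme.  For q = 1
   there are no valid functions because f is integral. *)
Require Import Defs.
From mathcomp Require Import all_boot all_order all_algebra.
From mathcomp Require Import all_classical all_reals.
From mathcomp Require Import ring lra zify.
Set Implicit Arguments.
Unset Strict Implicit.
Unset Printing Implicit Defensive.
Import Order.TTheory GRing.Theory Num.Theory.
Local Open Scope ring_scope.

(** * Valid and minimal functions *)

(** The deviation [g] of a summand from [pi] is merely Lipschitz. It is not known to be piecewise
    linear over any refinement of the complex, so its values on a grid do not determine it
    elsewhere. The sampling map turns this around: it carries an arbitrary value of [g] to a grid
    point, where extremality of the restriction can be used.

    The grid is finite modulo Z^2, which supplies the small factor e: wherever the additivity defect
    of [pi] vanishes, so does that of the perturbation, and only finitely many positive defects have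
    to dominate.

    The obstacle on the torus is that a relation between faces holds only modulo Z^2. In units of
    1/q, points of the three faces leave an offset smaller than 3 in each coordinate, and for q > 2
    such an offset in Z^2 is zero; the relations can then be lifted to the plane, where convexity is
    available. *)

Section GroupRelaxation.
Variables (R : realType) (G : zmodType) (S : zmodClosed G) (f : G).
Implicit Types (pi : G -> R) (L : seq G).

Lemma feasible_count_mem L :
  \sum_(r <- L) r - f \in S -> feasible S f (fun r => count_mem r L).
Proof.
move=> LS; split.
  apply: (@sub_finite_set _ _ [set` L]) => // r /=.
  by rewrite -lt0n -has_count => /hasP[y yL /eqP <-].
exists (\sum_(r <- L) r - f) => //.
rewrite addrC subrK (fsbigE (undup L)) ?undup_uniq //; last first.
  by move=> i _; rewrite mem_undup => /count_memPn ->.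
rewrite -[RHS](@big_undup_iterop_count _ 0 +%R _ L xpredT id).
by apply: eq_bigl => i; rewrite in_setT.
Qed.

Lemma sum_count_mem pi L :
  \sum_(r \in [set: G]) pi r * (count_mem r L)%:R = \sum_(r <- L) pi r.
Proof.
rewrite (fsbigE (undup L)) ?undup_uniq //; last first.
  by move=> i _; rewrite mem_undup => /count_memPn ->; rewrite mulr0.
rewrite -[RHS](@big_undup_iterop_count _ 0 +%R _ L xpredT pi).
apply: eq_big => [i|i _]; first by rewrite in_setT.
by rewrite mulr_natr.
Qed.

Lemma feasible_seq (s : G -> nat) : feasible S f s ->
  exists2 L, \sum_(r <- L) r - f \in S & forall r, s r = count_mem r L.
Proof.
case=> /finite_seqP[D0 D0E] [z zS sE].
pose D := undup D0.
have memD r : (r \in D) = (s r != 0%N).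
  have /propeqP : (s r != 0%N : Prop) = (r \in D0) by have := congr1 (@^~ r) D0E.
  by rewrite mem_undup => E; apply/idP/idP => /E.
pose L := flatten [seq nseq (s r) r | r <- D].
have cnt r : s r = count_mem r L.
  rewrite count_flatten -map_comp.
  have -> : [seq (count_mem r \o (fun t => nseq (s t) t)) t | t <- D]
      = [seq (if t == r then s r else 0%N) | t <- D].
    apply: eq_map => t /=; rewrite count_nseq /=.
    by case: eqP => [->|_]; rewrite ?mul1n ?mul0n.
  rewrite sumnE big_map -big_mkcond /= big_const_seq iter_addn_0.
  rewrite count_uniq_mem ?undup_uniq //.
  by rewrite memD; case: eqP => [->|_]; rewrite ?mul0n ?muln1.
exists L => //.
suff -> : \sum_(r <- L) r = \sum_(r \in [set: G]) r *+ s r.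
  by rewrite sE addrC addKr.
rewrite (fsbigE (undup L)) ?undup_uniq //; last first.
  by move=> i _; rewrite mem_undup cnt => /count_memPn ->.
rewrite -[LHS](@big_undup_iterop_count _ 0 +%R _ L xpredT id).
by apply: eq_big => [i|i _]; rewrite ?in_setT // cnt.
Qed.

Definition seq_valid pi :=
  (forall r, 0 <= pi r) /\
  forall L, \sum_(r <- L) r - f \in S -> 1 <= \sum_(r <- L) pi r.

(** The inequality is linear in [s], so on a convex hull it suffices to test the generators, and
    these are the multiplicity functions of lists. *)
Lemma valid_functionP pi : valid_function S f pi <-> seq_valid pi.
Proof.
split=> -[pi_ge0 pi_ge1]; split=> //.
  move=> L LS; rewrite -sum_count_mem; apply: pi_ge1.
  exists 1%N, (fun=> 1), (fun=> (fun r => (count_mem r L)%:R) : G -> R^o); split=> //.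
  - by rewrite big_ord1.
  - by move=> _; exists (fun r => count_mem r L) => //; apply: feasible_count_mem.
  - by rewrite big_ord1 scale1r.
move=> x [n [lam [v [lam_ge0 lam1 vs ->]]]].
have {}vs i : exists2 L, \sum_(r <- L) r - f \in S &
    v i = (fun r => (count_mem r L)%:R).
  have [s /feasible_seq[L LS sL] <-] := vs i.
  by exists L => //; apply/funext => r; rewrite sL.
have [F Fp] := choice (fun i => let: ex_intro2 L P Q := vs i in ex_intro _ L (conj P Q)).
(* A common finite support of all the generators, over which the two sums can be exchanged. *)
pose D := undup (flatten [seq F i | i <- index_enum 'I_n]).
have vE r : (\sum_(i < n) lam i *: v i) r = \sum_(i < n) lam i * (count_mem r (F i))%:R.
  rewrite fct_sumE; apply: eq_bigr => i _.
  by have [_ ->] := Fp i.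
have FD i r : r \in F i -> r \in D.
  move=> rF; rewrite mem_undup; apply/flattenP; exists (F i) => //.
  by apply/mapP; exists i => //; rewrite mem_index_enum.
under eq_fsbigr do rewrite vE.
have -> : \sum_(r \in [set: G]) pi r * (\sum_(i < n) lam i * (count_mem r (F i))%:R)
   = \sum_(r <- D) \sum_(i < n) lam i * (pi r * (count_mem r (F i))%:R).
  rewrite (fsbigE (D)) ?undup_uniq //; last first.
    move=> r _ rD; rewrite big1 ?mulr0 // => i _.
    suff /count_memPn -> : r \notin F i by rewrite mulr0.
    by apply: contra rD; apply: FD.
  under eq_bigl do rewrite in_setT.
  apply: eq_bigr => r _; rewrite mulr_sumr; apply: eq_bigr => i _; exact: mulrCA.
rewrite exchange_big /= -[leLHS]lam1; apply: ler_sum => i _.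
rewrite -mulr_sumr ler_peMr //.
have [/pi_ge1 + _] := Fp i; rewrite -sum_count_mem.
rewrite (fsbigE (D)) ?undup_uniq //.
  by under eq_bigl do rewrite in_setT.
move=> r _ rD; suff /count_memPn -> : r \notin F i by rewrite mulr0.
by apply: contra rD; apply: FD.
Qed.

(* Gomory and Johnson's characterization of minimality. *)
Definition gomory_johnson pi :=
  [/\ forall r, 0 <= pi r, pi 0 = 0,
      forall a b, pi (a + b) <= pi a + pi b,
      forall r z, z \in S -> pi (r + z) = pi r
    & forall r, pi r + pi (f - r) = 1].

Lemma subadditive_sum_le pi L : pi 0 = 0 ->
  (forall a b, pi (a + b) <= pi a + pi b) ->
  pi (\sum_(r <- L) r) <= \sum_(r <- L) pi r.
Proof.
move=> pi0 sub; elim: L => [|a L IH]; first by rewrite !big_nil pi0.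
by rewrite !big_cons (le_trans (sub _ _)) // lerD2l.
Qed.

(** Asking for [1 <= pi f] instead of symmetry makes this applicable to interpolations and
    perturbations, whose symmetry would need a proof of its own. *)
Lemma subadditive_valid pi : (forall r, 0 <= pi r) -> pi 0 = 0 ->
  (forall a b, pi (a + b) <= pi a + pi b) ->
  (forall r z, z \in S -> pi (r + z) = pi r) -> 1 <= pi f ->
  valid_function S f pi.
Proof.
move=> ge0 pi0 sub per pif; apply/valid_functionP; split=> // L LS.
apply: le_trans (subadditive_sum_le L pi0 sub).
by rewrite (le_trans pif) // -(per f _ LS) addrC subrK.
Qed.

Lemma gomory_johnson_valid pi : gomory_johnson pi -> valid_function S f pi.
Proof.
case=> ge0 pi0 sub per sym; apply: subadditive_valid => //.
by rewrite -(sym f) subrr pi0 addr0.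
Qed.

(** A smaller valid function would violate the inequality of the solution made of [r] and [f - r],
    whose cost is exactly 1 by symmetry. *)
Lemma gomory_johnson_minimal pi : gomory_johnson pi -> minimal_function S f pi.
Proof.
move=> gj; split; first exact: gomory_johnson_valid.
case: gj => ge0 pi0 sub per sym.
move=> [pi' [/valid_functionP[ge0' val'] ne le]]; apply: ne.
apply/funext => r; apply/eqP; rewrite eq_le le /= leNgt; apply/negP => lt.
have := val' [:: r; f - r]; rewrite !big_cons !big_nil !addr0.
rewrite (addrC r) subrK subrr => /(_ (rpred0 _)).
by have := sym r; have := le (f - r); lra.
Qed.

(** Otherwise the value at [r0] could be lowered to the cost of [L]: in any solution each occurrence
    of [r0] can be replaced by [L], so validity survives. *)
Lemma minimal_dominated pi r0 L : minimal_function S f pi ->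
  \sum_(r <- L) r - r0 \in S -> pi r0 <= \sum_(r <- L) pi r.
Proof.
move=> [/valid_functionP[ge0 val] mini] LS; rewrite leNgt; apply/negP => lt.
apply: mini; exists (fun r => if r == r0 then \sum_(r <- L) pi r else pi r).
split; last by move=> r; case: eqP => // ->; apply: ltW.
  apply/valid_functionP; split=> [r|M MS].
    by case: eqP => // _; apply: sumr_ge0.
  pose rep r := if r == r0 then L else [:: r].
  suff /val : \sum_(r <- flatten [seq rep r | r <- M]) r - f \in S.
    rewrite big_flatten big_map; congr (_ <= _); apply: eq_bigr => r _.
    by rewrite /rep; case: eqP => // _; rewrite big_seq1.
  rewrite big_flatten big_map.
  have -> : \sum_(r <- M) \sum_(i <- rep r) i - f =
     (\sum_(r <- M) r - f) + \sum_(r <- M) (\sum_(i <- rep r) i - r).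
    by rewrite big_split sumrN [RHS]addrC addrA subrK.
  rewrite rpredD // rpred_sum // => r _; rewrite /rep; case: eqP => [->//|_].
  by rewrite big_seq1 subrr rpred0.
by move=> /(congr1 (@^~ r0)); rewrite eqxx => /eqP; rewrite lt_eqF.
Qed.

Lemma minimal_gomory_johnson pi : minimal_function S f pi -> gomory_johnson pi.
Proof.
move=> pim; have [/valid_functionP[ge0 val] mini] := pim.
have dom := minimal_dominated pim.
have pi0 : pi 0 = 0.
  apply/eqP; rewrite eq_le ge0 andbT -[leRHS](big_nil 0 +%R xpredT pi).
  by apply: dom; rewrite big_nil subr0 rpred0.
have sub a b : pi (a + b) <= pi a + pi b.
  have := dom (a + b) [:: a; b]; rewrite !big_cons !big_nil !addr0 subrr.
  by apply; rewrite rpred0.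
have per_le r z : z \in S -> pi (r + z) <= pi r.
  move=> zS; have := dom (r + z) [:: r]; rewrite !big_seq1; apply.
  by rewrite opprD addNKr rpredN.
have per r z : z \in S -> pi (r + z) = pi r.
  move=> zS; apply/eqP; rewrite eq_le per_le //=.
  by rewrite -{1}(addrK z r) per_le ?rpredN.
split=> // r.
have sym_ge r' : 1 <= pi r' + pi (f - r').
  have := val [:: r'; f - r']; rewrite !big_cons !big_nil !addr0; apply.
  by rewrite (addrC r') subrK subrr rpred0.
have sym_le r' : 0 < pi r' -> pi r' + pi (f - r') <= 1.
  move=> pos; rewrite leNgt; apply/negP => lt.
  set d := pi r' + pi (f - r') in lt.
  have d_gt0 : 0 < d by lra.
  (* A solution that contains [r'] costs at least [d], because its remaining elements cost at least
     [pi (f - r')]; it would still cost 1 if all values were divided by [d]. *)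
  apply: mini; exists (fun x => if x == r' then pi x / d else pi x); split.
  - apply/valid_functionP; split=> [x|L LS].
      by case: eqP => // _; rewrite divr_ge0 // ltW.
    have [r'L|r'L] := boolP (r' \in L); last first.
      rewrite (le_trans (val L LS)) // le_eqVlt; apply/orP; left; apply/eqP.
      rewrite [LHS]big_seq [RHS]big_seq; apply: eq_bigr => x xL.
      by case: eqP xL => // ->; rewrite (negPf r'L).
    have big_ge : d <= \sum_(x <- L) pi x.
      rewrite (perm_big _ (perm_to_rem r'L)) big_cons /= lerD2l.
      apply: dom; move: LS; rewrite (perm_big _ (perm_to_rem r'L)) big_cons /=.
      by rewrite opprB addrA (addrC r').
    have : 1 <= (\sum_(x <- L) pi x) / d by rewrite ler_pdivlMr // mul1r.
    move/le_trans; apply; rewrite mulr_suml; apply: ler_sum => x _.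
    case: eqP => // _; rewrite ler_pdivrMr // ler_peMr //; exact: ltW.
  - move=> /(congr1 (@^~ r')); rewrite eqxx => /eqP.
    by rewrite -subr_eq0 -{2}[pi r']mulr1 -mulrBr mulf_eq0 gt_eqF //=
      subr_eq0 invr_eq1 gt_eqF.
  - move=> x; case: eqP => // _; rewrite ler_pdivrMr // ler_peMr //; exact: ltW.
apply/eqP; rewrite eq_le sym_ge andbT.
have [pos|] := ltP 0 (pi r); first exact: sym_le.
(* Rescaling has no effect at a zero of [pi], but then [pi (f - r)] is at least 1 and the argument
   applies to [f - r]. *)
move=> npos; have pr0 : pi r = 0 by apply/eqP; rewrite eq_le npos ge0.
have := sym_ge r; have := sym_le (f - r).
rewrite opprB addrCA subrr addr0 pr0 add0r addr0 => H1 H2.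
by apply: H1; lra.
Qed.

(** A smaller valid function in place of [pi1] would make the average valid and smaller than
    [pi]. *)
Lemma minimal_average pi pi1 pi2 : minimal_function S f pi ->
  valid_function S f pi1 -> valid_function S f pi2 ->
  pi = (fun r => 2^-1 * pi1 r + 2^-1 * pi2 r) -> minimal_function S f pi1.
Proof.
move=> [_ mini] v1 /valid_functionP[ge2 v2] piE; split=> //.
move=> [pi' [/valid_functionP[ge' v'] ne le]]; apply: mini.
exists (fun r => 2^-1 * pi' r + 2^-1 * pi2 r); split.
- apply/valid_functionP; split=> [r|L LS].
    by have := ge2 r; have := ge' r; lra.
  rewrite big_split /= -!mulr_sumr.
  by have := v2 L LS; have := v' L LS; lra.
- move=> E; apply: ne; apply/funext => r.
  by move/(congr1 (@^~ r)): E; rewrite piE /=; lra.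
- by move=> r; rewrite piE; have := le r; lra.
Qed.

End GroupRelaxation.

(** * Faces of the triangulation *)

Section Coordinates.
Variables (R : realType) (n : nat).
Local Notation plane := 'rV[R]_2.
Implicit Types (x y u v : plane) (a b : int).

(* Coordinates in units of 1/n: the vertices of the complex are the integer points. *)
Definition cX x : R := n%:R * x ord0 ord0.
Definition cY x : R := n%:R * x ord0 ord_max.

Lemma cX0 : cX 0 = 0. Proof. by rewrite /cX mxE mulr0. Qed.
Lemma cY0 : cY 0 = 0. Proof. by rewrite /cY mxE mulr0. Qed.
Lemma cXD x y : cX (x + y) = cX x + cX y. Proof. by rewrite /cX mxE mulrDr. Qed.
Lemma cYD x y : cY (x + y) = cY x + cY y. Proof. by rewrite /cY mxE mulrDr. Qed.
Lemma cXN x : cX (- x) = - cX x. Proof. by rewrite /cX mxE mulrN. Qed.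
Lemma cYN x : cY (- x) = - cY x. Proof. by rewrite /cY mxE mulrN. Qed.
Lemma cXZ k x : cX (k *: x) = k * cX x. Proof. by rewrite /cX mxE mulrCA. Qed.
Lemma cYZ k x : cY (k *: x) = k * cY x. Proof. by rewrite /cY mxE mulrCA. Qed.
Definition coordE := (cXD, cYD, cXN, cYN, cXZ, cYZ, cX0, cY0).

Definition mk (s t : R) : plane := pt (s / n%:R) (t / n%:R).

Hypothesis n_gt0 : (0 < n)%N.
Let n_neq0 : n%:R != 0 :> R. Proof. by rewrite pnatr_eq0 -lt0n. Qed.

Lemma cX_mk s t : cX (mk s t) = s.
Proof. by rewrite /cX mxE eqxx mulrCA divff ?mulr1. Qed.
Lemma cY_mk s t : cY (mk s t) = t.
Proof. by rewrite /cY mxE /= mulrCA divff ?mulr1. Qed.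

Lemma plane_eq x y : cX x = cX y -> cY x = cY y -> x = y.
Proof.
move=> /(mulfI n_neq0) E0 /(mulfI n_neq0) E1; apply/rowP => j.
have [->|->] : j = ord0 \/ j = ord_max.
  by case: j => [[|[|//]] jlt]; [left|right]; apply: val_inj.
all: by [].
Qed.

Lemma mkE x : mk (cX x) (cY x) = x.
Proof. by apply: plane_eq; rewrite ?cX_mk ?cY_mk. Qed.

Lemma gridP x :
  reflect (exists a b, cX x = a%:~R /\ cY x = b%:~R) (x \in grid R n).
Proof.
rewrite -topredE /= /grid; apply: (iffP mxOverP) => [xn|[a [b [xa yb]]] i j].
  have [/intrP[a aE] /intrP[b bE]] := (xn ord0 ord0, xn ord0 ord_max).
  by exists a, b; rewrite /cX /cY -aE -bE !mxE.
rewrite ord1 mxE; have [->|->] : j = ord0 \/ j = ord_max.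
    by case: j => [[|[|//]] jlt]; [left|right]; apply: val_inj.
by rewrite -[_ * _]/(cX x) xa intr_int.
by rewrite -[_ * _]/(cY x) yb intr_int.
Qed.

Lemma mk_grid a b : mk a%:~R b%:~R \in grid R n.
Proof. by apply/gridP; exists a, b; rewrite cX_mk cY_mk. Qed.

End Coordinates.

Lemma cX_mulr (R : realType) (m n : nat) (x : 'rV[R]_2) :
  cX (m * n) x = m%:R * cX n x.
Proof. by rewrite /cX natrM mulrA. Qed.
Lemma cY_mulr (R : realType) (m n : nat) (x : 'rV[R]_2) :
  cY (m * n) x = m%:R * cY n x.
Proof. by rewrite /cY natrM mulrA. Qed.

Section ConvexHull.
Variables (R : realType).
Local Notation plane := 'rV[R]_2.
Implicit Types (A : set plane).

Lemma conv_hull_le A (r s c : R) x :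
  (forall v, A v -> r * v ord0 ord0 + s * v ord0 ord_max <= c) ->
  conv_hull A x -> r * x ord0 ord0 + s * x ord0 ord_max <= c.
Proof.
move=> Ac [m [lam [v [lam_ge0 lam1 Av ->]]]].
rewrite !summxE !mulr_sumr -big_split /= -[c]mul1r -lam1 mulr_suml.
apply: ler_sum => i _; rewrite !mxE.
by have := ler_wpM2l (lam_ge0 i) (Ac _ (Av i)); lra.
Qed.

Lemma conv_hull3 A p1 p2 p3 (c1 c2 c3 : R) :
  A p1 -> A p2 -> A p3 -> 0 <= c1 -> 0 <= c2 -> 0 <= c3 -> c1 + c2 + c3 = 1 ->
  conv_hull A (c1 *: p1 + c2 *: p2 + c3 *: p3).
Proof.
move=> A1 A2 A3 c1_ge0 c2_ge0 c3_ge0 sum1.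
exists 3%N, (fun i => nth 0 [:: c1; c2; c3] i), (fun i => nth 0 [:: p1; p2; p3] i).
split=> [[[|[|[|]]]] //||[[|[|[|]]]] //|].
- by rewrite !big_ord_recl big_ord0 /= addr0 addrA.
- by rewrite !big_ord_recl big_ord0 /= addr0 addrA.
Qed.

End ConvexHull.

Section Faces.
Variables (R : realType) (n : nat).
Hypothesis n_gt0 : (0 < n)%N.
Local Notation plane := 'rV[R]_2.
Implicit Types (x y u v : plane) (a b : int).

Definition face (t : plane) (W : seq plane) : set plane :=
  [set t + n%:R^-1 *: x | x in conv_hull [set` W]]%classic.

Let n_neq0 : n%:R != 0 :> R. Proof. by rewrite pnatr_eq0 -lt0n. Qed.

Lemma face_le t W (r s c : R) :
  (forall v, v \in W -> r * v ord0 ord0 + s * v ord0 ord_max <= c) ->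
  forall x, face t W x ->
    r * (cX n x - cX n t) + s * (cY n x - cY n t) <= c.
Proof.
move=> Wc _ [x /(conv_hull_le Wc) xc <-].
by rewrite !coordE /cX /cY !mulKf //; move: xc; lra.
Qed.

Lemma face3 t (W : seq plane) (p1 p2 p3 x : plane) (c1 c2 c3 : R) :
  p1 \in W -> p2 \in W -> p3 \in W -> 0 <= c1 -> 0 <= c2 -> 0 <= c3 ->
  c1 + c2 + c3 = 1 ->
  cX n x - cX n t = c1 * p1 ord0 ord0 + c2 * p2 ord0 ord0 + c3 * p3 ord0 ord0 ->
  cY n x - cY n t =
    c1 * p1 ord0 ord_max + c2 * p2 ord0 ord_max + c3 * p3 ord0 ord_max ->
  face t W x.
Proof.
move=> W1 W2 W3 h1 h2 h3 sum1 xE yE.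
exists (c1 *: p1 + c2 *: p2 + c3 *: p3); first exact: conv_hull3.
have XE y : n%:R^-1 * cX n y = y ord0 ord0 by rewrite /cX mulKf.
have YE y : n%:R^-1 * cY n y = y ord0 ord_max by rewrite /cY mulKf.
apply: (plane_eq n_gt0); rewrite !(cXD n t, cYD n t, cXZ, cYZ) ?XE ?YE !mxE.
  by rewrite -xE addrC subrK.
by rewrite -yE addrC subrK.
Qed.

(** The faces of positive dimension that the diagonal constraint admits; horizontal and vertical
    edges have no kind. *)
Variant kind := Lower | Upper | Diag.

Definition fcell (k : kind) a b : set plane :=
  [set x | [/\ a%:~R <= cX n x <= a%:~R + 1, b%:~R <= cY n x <= b%:~R + 1 &
    match k with
    | Lower => cX n x + cY n x <= a%:~R + b%:~R + 1
    | Upper => a%:~R + b%:~R + 1 <= cX n x + cY n x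
    | Diag => cX n x + cY n x = a%:~R + b%:~R + 1
    end]]%classic.

Lemma pt0 (a b : R) : pt a b ord0 ord0 = a. Proof. by rewrite mxE. Qed.
Lemma pt1 (a b : R) : pt a b ord0 ord_max = b. Proof. by rewrite mxE. Qed.

Lemma face_lower a b :
  face (mk n a%:~R b%:~R) (lower_triangle R) = fcell Lower a b.
Proof.
apply/seteqP; split=> x.
  move=> xF; have bnd := face_le _ xF.
  have := bnd (-1) 0 0; have := bnd 0 (-1) 0; have := bnd 1 1 1.
  rewrite !cX_mk // !cY_mk //.
  have aux (P : plane -> Prop) : P (pt 0 0) -> P (pt 1 0) -> P (pt 0 1) ->
    forall v, v \in lower_triangle R -> P v.
    by move=> P1 P2 P3 v; rewrite !inE => /or3P[] /eqP ->.
  move=> /(_ (aux _ _ _ _)); rewrite !pt0 !pt1 => H1.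
  move=> /(_ (aux _ _ _ _)); rewrite !pt0 !pt1 => H2.
  move=> /(_ (aux _ _ _ _)); rewrite !pt0 !pt1 => H3.
  have {}H1 := H1 ltac:(lra) ltac:(lra) ltac:(lra).
  have {}H2 := H2 ltac:(lra) ltac:(lra) ltac:(lra).
  have {}H3 := H3 ltac:(lra) ltac:(lra) ltac:(lra).
  by rewrite /fcell /=; split; lra.
move=> [] /= xa xb xab.
apply: (@face3 _ _ (pt 0 0) (pt 1 0) (pt 0 1) x
  (1 - (cX n x - a%:~R) - (cY n x - b%:~R)) (cX n x - a%:~R) (cY n x - b%:~R));
  rewrite ?inE ?eqxx ?orbT // ?pt0 ?pt1 ?cX_mk ?cY_mk //; lra.
Qed.

Lemma face_upper a b :
  face (mk n a%:~R b%:~R) (upper_triangle R) = fcell Upper a b.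
Proof.
apply/seteqP; split=> x.
  move=> xF; have bnd := face_le _ xF.
  have := bnd (-1) (-1) (-1); have := bnd 0 1 1; have := bnd 1 0 1.
  rewrite !cX_mk // !cY_mk //.
  have aux (P : plane -> Prop) : P (pt 1 0) -> P (pt 0 1) -> P (pt 1 1) ->
    forall v, v \in upper_triangle R -> P v.
    by move=> P1 P2 P3 v; rewrite !inE => /or3P[] /eqP ->.
  move=> /(_ (aux _ _ _ _)); rewrite !pt0 !pt1 => H1.
  move=> /(_ (aux _ _ _ _)); rewrite !pt0 !pt1 => H2.
  move=> /(_ (aux _ _ _ _)); rewrite !pt0 !pt1 => H3.
  have {}H1 := H1 ltac:(lra) ltac:(lra) ltac:(lra).
  have {}H2 := H2 ltac:(lra) ltac:(lra) ltac:(lra).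
  have {}H3 := H3 ltac:(lra) ltac:(lra) ltac:(lra).
  by rewrite /fcell /=; split; lra.
move=> [] /= xa xb xab.
apply: (@face3 _ _ (pt 1 0) (pt 0 1) (pt 1 1) x
  (1 - (cY n x - b%:~R)) (1 - (cX n x - a%:~R))
  (cX n x - a%:~R + (cY n x - b%:~R) - 1));
  rewrite ?inE ?eqxx ?orbT // ?pt0 ?pt1 ?cX_mk ?cY_mk //; lra.
Qed.

Lemma face_diag a b :
  face (mk n a%:~R b%:~R) [:: pt 1 0; pt 0 1] = fcell Diag a b.
Proof.
apply/seteqP; split=> x.
  move=> xF; have bnd := face_le _ xF.
  have := bnd (-1) (-1) (-1); have := bnd 1 1 1; have := bnd 1 0 1.
  have := bnd 0 1 1.
  rewrite !cX_mk // !cY_mk //.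
  have aux (P : plane -> Prop) : P (pt 1 0) -> P (pt 0 1) ->
    forall v, v \in [:: pt 1 0; pt 0 1] -> P v.
    by move=> P1 P2 v; rewrite !inE => /orP[] /eqP ->.
  move=> /(_ (aux _ _ _)); rewrite !pt0 !pt1 => H1.
  move=> /(_ (aux _ _ _)); rewrite !pt0 !pt1 => H2.
  move=> /(_ (aux _ _ _)); rewrite !pt0 !pt1 => H3.
  move=> /(_ (aux _ _ _)); rewrite !pt0 !pt1 => H4.
  have {}H1 := H1 ltac:(lra) ltac:(lra).
  have {}H2 := H2 ltac:(lra) ltac:(lra).
  have {}H3 := H3 ltac:(lra) ltac:(lra).
  have {}H4 := H4 ltac:(lra) ltac:(lra).
  by rewrite /fcell /=; split; lra.
move=> [] /= xa xb xab.
apply: (@face3 _ _ (pt 1 0) (pt 0 1) (pt 0 1) x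
  (cX n x - a%:~R) (cY n x - b%:~R) 0);
  rewrite ?inE ?eqxx ?orbT // ?pt0 ?pt1 ?cX_mk ?cY_mk //; lra.
Qed.

Lemma face_horizontal a b : face (mk n a%:~R b%:~R) [:: pt 0 0; pt 1 0] =
  [set x | a%:~R <= cX n x <= a%:~R + 1 /\ cY n x = b%:~R]%classic.
Proof.
apply/seteqP; split=> x.
  move=> xF; have bnd := face_le _ xF.
  have := bnd (-1) 0 0; have := bnd 0 1 0; have := bnd 0 (-1) 0.
  have := bnd 1 0 1.
  rewrite !cX_mk // !cY_mk //.
  have aux (P : plane -> Prop) : P (pt 0 0) -> P (pt 1 0) ->
    forall v, v \in [:: pt 0 0; pt 1 0] -> P v.
    by move=> P1 P2 v; rewrite !inE => /orP[] /eqP ->.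
  move=> /(_ (aux _ _ _)); rewrite !pt0 !pt1 => H1.
  move=> /(_ (aux _ _ _)); rewrite !pt0 !pt1 => H2.
  move=> /(_ (aux _ _ _)); rewrite !pt0 !pt1 => H3.
  move=> /(_ (aux _ _ _)); rewrite !pt0 !pt1 => H4.
  have {}H1 := H1 ltac:(lra) ltac:(lra).
  have {}H2 := H2 ltac:(lra) ltac:(lra).
  have {}H3 := H3 ltac:(lra) ltac:(lra).
  have {}H4 := H4 ltac:(lra) ltac:(lra).
  by split; lra.
move=> [] /= xa xb.
apply: (@face3 _ _ (pt 0 0) (pt 1 0) (pt 0 0) x
  (1 - (cX n x - a%:~R)) (cX n x - a%:~R) 0);
  rewrite ?inE ?eqxx ?orbT // ?pt0 ?pt1 ?cX_mk ?cY_mk //; lra.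
Qed.

Lemma face_vertical a b : face (mk n a%:~R b%:~R) [:: pt 0 0; pt 0 1] =
  [set x | cX n x = a%:~R /\ b%:~R <= cY n x <= b%:~R + 1]%classic.
Proof.
apply/seteqP; split=> x.
  move=> xF; have bnd := face_le _ xF.
  have := bnd (-1) 0 0; have := bnd 1 0 0; have := bnd 0 (-1) 0.
  have := bnd 0 1 1.
  rewrite !cX_mk // !cY_mk //.
  have aux (P : plane -> Prop) : P (pt 0 0) -> P (pt 0 1) ->
    forall v, v \in [:: pt 0 0; pt 0 1] -> P v.
    by move=> P1 P2 v; rewrite !inE => /orP[] /eqP ->.
  move=> /(_ (aux _ _ _)); rewrite !pt0 !pt1 => H1.
  move=> /(_ (aux _ _ _)); rewrite !pt0 !pt1 => H2.
  move=> /(_ (aux _ _ _)); rewrite !pt0 !pt1 => H3.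
  move=> /(_ (aux _ _ _)); rewrite !pt0 !pt1 => H4.
  have {}H1 := H1 ltac:(lra) ltac:(lra).
  have {}H2 := H2 ltac:(lra) ltac:(lra).
  have {}H3 := H3 ltac:(lra) ltac:(lra).
  have {}H4 := H4 ltac:(lra) ltac:(lra).
  by split; lra.
move=> [] /= xa xb.
apply: (@face3 _ _ (pt 0 0) (pt 0 1) (pt 0 0) x
  (1 - (cY n x - b%:~R)) (cY n x - b%:~R) 0);
  rewrite ?inE ?eqxx ?orbT // ?pt0 ?pt1 ?cX_mk ?cY_mk //; lra.
Qed.

Lemma face_point a b (c d : int) : face (mk n a%:~R b%:~R) [:: pt c%:~R d%:~R] =
  [set mk n (a + c)%:~R (b + d)%:~R]%classic.
Proof.
apply/seteqP; split=> x.
  move=> xF; have bnd := face_le _ xF.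
  have := bnd (-1) 0 (- c%:~R); have := bnd 1 0 c%:~R.
  have := bnd 0 (-1) (- d%:~R); have := bnd 0 1 d%:~R.
  rewrite !cX_mk // !cY_mk //.
  have aux (P : plane -> Prop) : P (pt c%:~R d%:~R) ->
    forall v, v \in [:: pt c%:~R d%:~R] -> P v.
    by move=> P1 v; rewrite !inE => /eqP ->.
  move=> /(_ (aux _ _)); rewrite !pt0 !pt1 => H1.
  move=> /(_ (aux _ _)); rewrite !pt0 !pt1 => H2.
  move=> /(_ (aux _ _)); rewrite !pt0 !pt1 => H3.
  move=> /(_ (aux _ _)); rewrite !pt0 !pt1 => H4.
  have {}H1 := H1 ltac:(lra).
  have {}H2 := H2 ltac:(lra).
  have {}H3 := H3 ltac:(lra).
  have {}H4 := H4 ltac:(lra).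
  by apply: (plane_eq n_gt0); rewrite ?cX_mk ?cY_mk // intrD; lra.
move=> ->.
apply: (@face3 _ _ (pt c%:~R d%:~R) (pt c%:~R d%:~R) (pt c%:~R d%:~R) _ 1 0 0);
  rewrite ?inE ?eqxx ?orbT // ?pt0 ?pt1 ?cX_mk ?cY_mk // ?intrD; lra.
Qed.

End Faces.

Variant floor_ceil_spec (R : realType) (x : R) : int -> int -> Prop :=
| FloorCeilInt m of x = m%:~R : floor_ceil_spec x m m
| FloorCeilFrac m of m%:~R < x < m%:~R + 1 : floor_ceil_spec x m (m + 1).

Lemma floor_ceilP (R : realType) (x : R) :
  floor_ceil_spec x (Num.floor x) (Num.ceil x).
Proof.
have /andP[le_x lt_x] := floor_itv x; rewrite intrD in lt_x.
have [xE|ne] := eqVneq (Num.floor x)%:~R x.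
  have cE : Num.ceil x = Num.floor x by rewrite -[in LHS]xE intrKceil.
  by rewrite cE; constructor.
have cE : Num.ceil x = Num.floor x + 1.
  by apply: ceil_def; rewrite addrK intrD (ltW lt_x) andbT lt_neqAle ne.
by rewrite cE; constructor; rewrite lt_neqAle ne le_x.
Qed.

Lemma floor_intD (R : realType) (x : R) (m : int) :
  Num.floor (x + m%:~R) = Num.floor x + m.
Proof. by rewrite floorDrz ?intr_int // intrKfloor. Qed.

Lemma ceil_intD (R : realType) (x : R) (m : int) :
  Num.ceil (x + m%:~R) = Num.ceil x + m.
Proof. by rewrite ceilDrz ?intr_int // intrKceil. Qed.

Section Cells.
Variables (R : realType) (n : nat).
Hypothesis n_gt0 : (0 < n)%N.
Local Notation plane := 'rV[R]_2.
Local Notation X := (cX n).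
Local Notation Y := (cY n).
Implicit Types (x y u v : plane) (a b : int).

(** [t] lies in the integral hull of [s]: the point [s] itself if it is an integer, otherwise the
    closed unit interval around it. Hence [t] inherits every integral bound on [s]. *)
Definition between (s t : R) := (Num.floor s)%:~R <= t <= (Num.ceil s)%:~R.

Lemma between_refl s : between s s.
Proof. by rewrite /between floor_le ceil_ge. Qed.

Lemma between_ge (s t : R) (m : int) : between s t -> m%:~R <= s -> m%:~R <= t.
Proof.
by move=> /andP[st _] ms; apply: le_trans st; rewrite ler_int floor_ge_int.
Qed.

Lemma between_le (s t : R) (m : int) : between s t -> s <= m%:~R -> t <= m%:~R.
Proof.
by move=> /andP[_ st] ms; apply: le_trans st _; rewrite ler_int ceil_le_int.
Qed.

Lemma betweenN s t : between (- s) (- t) = between s t.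
Proof.
rewrite /between [Num.floor (- s)]floorNceil [Num.ceil (- s)]ceilNfloor !opprK.
by rewrite !mulrNz !lerN2 andbC.
Qed.

(* The smallest face of the complex containing x. *)
Definition cell x : set plane :=
  [set u | [/\ between (X x) (X u), between (Y x) (Y u)
             & between (X x + Y x) (X u + Y u)]]%classic.

Lemma cell_refl x : cell x x.
Proof. by split; apply: between_refl. Qed.

Lemma cellN x u : cell x u -> cell (- x) (- u).
Proof. by case=> h1 h2 h3; split; rewrite !coordE -?opprD betweenN. Qed.

(** All faces are cut out by integral bounds on [X], [Y] and [X + Y], and points of the cell inherit
    those of [x]. *)
Lemma cell_fcell k a b x : fcell n k a b x -> (cell x `<=` fcell n k a b)%classic.
Proof.
move=> [/andP[a1 a2] /andP[b1 b2] h] u [h1 h2 h3].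
have E : a%:~R + b%:~R + 1 = (a + b + 1)%:~R :> R by rewrite !intrD.
split.
- rewrite (between_ge h1 a1) -(intrD _ a 1).
  by rewrite (between_le h1) // intrD.
- rewrite (between_ge h2 b1) -(intrD _ b 1).
  by rewrite (between_le h2) // intrD.
- case: k h => h; rewrite ?E in h *.
  + exact: (between_le h3).
  + exact: (between_ge h3).
  + apply/eqP; rewrite eq_le (between_le h3) ?h // (between_ge h3) ?h //.
Qed.

Lemma cell_grid x : x \in grid R n -> cell x = [set x]%classic.
Proof.
move=> /gridP[a [b [xa yb]]]; apply/seteqP; split=> u; last first.
  by move=> ->; exact: cell_refl.
rewrite /cell /between xa yb !intrKfloor !intrKceil /= => -[h1 h2 _].
by apply: (plane_eq n_gt0); apply/eqP; rewrite ?xa ?yb eq_le andbC.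
Qed.

(** If all of [X x], [Y x] and their sum are integers the cell is a vertex, if just one is then it
    is an edge of the matching direction, and otherwise it is a triangle. *)
Lemma cell_face x : exists k, (k < 3)%N /\ plane_faces n k (cell x).
Proof.
have face_grid k a b T W I : T = lower_triangle R \/ T = upper_triangle R ->
    subseq W T -> size W = k.+1 -> face n (mk n a%:~R b%:~R) W = I ->
    plane_faces n k I.
  move=> T_ W_ s_ <-; exists (mk n a%:~R b%:~R), T, W.
  by split=> //; exact: mk_grid.
have low : lower_triangle R = lower_triangle R \/ lower_triangle R = upper_triangle R
  by left.
have up : upper_triangle R = lower_triangle R \/ upper_triangle R = upper_triangle R
  by right.
have [xg|] := boolP (x \in grid R n).
  have /gridP[a [b [xa yb]]] := xg.
  exists 0%N; split=> //; apply: (@face_grid 0%N a b _ [:: pt 0 0] _ low) => //.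
    by rewrite /= eqxx.
  have := face_point R n_gt0 a b 0 0; rewrite mulr0z !addr0 => ->.
  by rewrite cell_grid // -xa -yb mkE.
have ne1 : pt 0 1 != pt 1 0 :> plane.
  by apply/eqP => /rowP/(_ ord0); rewrite !mxE /= => /eqP; rewrite eq_sym oner_eq0.
rewrite /cell /between.
case: (floor_ceilP (X x)) => a ha; case: (floor_ceilP (Y x)) => b hb ng.
- by case/negP: ng; apply/gridP; exists a, b.
- exists 1%N; split=> //.
  apply: (@face_grid 1%N a b _ [:: pt 0 0; pt 0 1] _ low) => //.
    by rewrite /= eqxx (negPf ne1) eqxx.
  have -> : Num.floor (X x + Y x) = a + b by apply: floor_def; rewrite !intrD; lra.
  have -> : Num.ceil (X x + Y x) = a + b + 1 by apply: ceil_def; rewrite !(intrD, intrB); lra.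
  rewrite face_vertical //; apply/seteqP; split=> u /=; rewrite !intrD => -[? ?].
    by split; lra.
  by move=> ?; split; lra.
- exists 1%N; split=> //.
  apply: (@face_grid 1%N a b _ [:: pt 0 0; pt 1 0] _ low) => //.
    by rewrite /= !eqxx.
  have -> : Num.floor (X x + Y x) = a + b by apply: floor_def; rewrite !intrD; lra.
  have -> : Num.ceil (X x + Y x) = a + b + 1 by apply: ceil_def; rewrite !(intrD, intrB); lra.
  rewrite face_horizontal //; apply/seteqP; split=> u /=; rewrite !intrD => -[? ?].
    by split; lra.
  by move=> ?; split; lra.
- have [lt|gt|eq] := ltgtP (X x + Y x) (a%:~R + b%:~R + 1).
  + exists 2%N; split=> //.
    apply: (@face_grid 2%N a b _ (lower_triangle R) _ low) => //.
    have -> : Num.floor (X x + Y x) = a + b by apply: floor_def; rewrite !intrD; lra.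
    have -> : Num.ceil (X x + Y x) = a + b + 1 by apply: ceil_def; rewrite !(intrD, intrB); lra.
    rewrite face_lower //; apply/seteqP; split=> u /=; rewrite !intrD => -[? ? ?];
      by split; lra.
  + exists 2%N; split=> //.
    apply: (@face_grid 2%N a b _ (upper_triangle R) _ up) => //.
    have -> : Num.floor (X x + Y x) = a + b + 1 by apply: floor_def; rewrite !intrD; lra.
    have -> : Num.ceil (X x + Y x) = a + b + 1 + 1 by apply: ceil_def; rewrite !(intrD, intrB); lra.
    rewrite face_upper //; apply/seteqP; split=> u /=; rewrite !intrD => -[? ? ?];
      by split; lra.
  + exists 1%N; split=> //.
    apply: (@face_grid 1%N a b _ [:: pt 1 0; pt 0 1] _ up) => //.
      by rewrite /= !eqxx.
    have -> : Num.floor (X x + Y x) = a + b + 1 by apply: floor_def; rewrite !intrD; lra.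
    have -> : Num.ceil (X x + Y x) = a + b + 1 by apply: ceil_def; rewrite !(intrD, intrB); lra.
    rewrite face_diag //; apply/seteqP; split=> u /=; rewrite !intrD => -[? ? ?];
      by split; lra.
Qed.

Lemma subseq3 (p1 p2 p3 : plane) W : subseq W [:: p1; p2; p3] ->
  W \in [:: [::]; [:: p1]; [:: p2]; [:: p3]; [:: p1; p2]; [:: p1; p3];
            [:: p2; p3]; [:: p1; p2; p3]].
Proof.
case/subseqP => -[|[] [|[] [|[] [|? ?]]]] // _ -> /=; by rewrite !inE !eqxx ?orbT.
Qed.

Lemma plane_faces0 (I : set plane) : plane_faces n 0 I ->
  exists a b, I = [set mk n a%:~R b%:~R]%classic.
Proof.
move=> [t [T [W [/gridP[a [b [ta tb]]] TE WT sW ->]]]].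
have [c [d WE]] : exists c d : int, W = [:: pt c%:~R d%:~R].
  have pE (c d : int) : [:: pt c%:~R d%:~R] = [:: pt (c%:~R : R) d%:~R] by [].
  by case: TE WT sW => -> /subseq3; rewrite !inE => /orP[|/or4P[|||/or4P[]]]
    /eqP -> //= _; [exists 0, 0|exists 1, 0|exists 0, 1|exists 1, 0|exists 0, 1|exists 1, 1].
exists (a + c), (b + d); rewrite WE -face_point //.
by rewrite -ta -tb mkE.
Qed.

Lemma plane_faces2 (I : set plane) : plane_faces n 2 I <->
  exists k a b, [/\ k = Lower \/ k = Upper & I = fcell n k a b].
Proof.
split.
  move=> [t [T [W [/gridP[a [b [ta tb]]] TE WT sW ->]]]].
  have WE : W = T.
    have sT : size T = 3%N by case: TE => ->.
    by apply/eqP; rewrite -(size_subseq_leqif WT).2 sW sT.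
  case: TE => TE; [exists Lower|exists Upper]; exists a, b; (split; first by [left|right]);
    by rewrite WE TE -?face_lower -?face_upper // -ta -tb mkE.
move=> [k [a [b [kE ->]]]].
case: kE => ->; exists (mk n a%:~R b%:~R).
  exists (lower_triangle R), (lower_triangle R).
  by split; rewrite -?face_lower ?mk_grid ?subseq_refl //; left.
exists (upper_triangle R), (upper_triangle R).
by split; rewrite -?face_upper ?mk_grid ?subseq_refl //; right.
Qed.

(** Being parallel to (-1, 1) makes the coordinate sum constant, and [[:: pt 1 0; pt 0 1]] is the
    only pair of vertices of either triangle with equal sums. *)
Lemma plane_diag_fcell (I : set plane) : plane_diag n I -> exists a b, I = fcell n Diag a b.
Proof.
move=> [[t [T [W [/gridP[a [b [ta tb]]] TE WT sW IE]]]] par].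
exists a, b; rewrite -face_diag // -ta -tb mkE //.
have key (p p' : plane) : p \in W -> p' \in W ->
    p ord0 ord0 + p ord0 ord_max = p' ord0 ord0 + p' ord0 ord_max.
  move=> pW p'W.
  have memI w : w \in W -> I (t + n%:R^-1 *: w).
    move=> wW; rewrite IE; exists w => //.
    have -> : w = 1 *: w + 0 *: w + 0 *: w by rewrite !scale0r !addr0 scale1r.
    apply: conv_hull3 => //; lra.
  have [c] := par _ _ (memI p pW) (memI p' p'W).
  rewrite opprD addrACA subrr add0r -scalerBr => E.
  have n_neq0 : n%:R != 0 :> R by rewrite pnatr_eq0 -lt0n.
  move/rowP: E => E; have := E ord0; have := E ord_max; rewrite !mxE /= => E1 E0.
  have : n%:R^-1 * ((p ord0 ord0 + p ord0 ord_max) - (p' ord0 ord0 + p' ord0 ord_max)) = 0.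
    by lra.
  by move/eqP; rewrite mulf_eq0 invr_eq0 (negPf n_neq0) subr_eq0 => /eqP.
rewrite IE; congr face.
by case: TE WT sW key => -> /subseq3; rewrite !inE => /orP[|/or4P[|||/or4P[]]]
    /eqP -> //= _ key; move: (key _ _ (mem_head _ _) (mem_last _ _));
    rewrite /= !(pt0, pt1) => ?; exfalso; lra.
Qed.

End Cells.

(** * Interpolation from a grid *)

Section Bounds.
Variable R : realType.
Implicit Types (s t w : R).

(** The sums [s + t] fill the interval from [l1 + l2] to [h1 + h2]; the last two conditions say that
    it meets the third interval. The point chosen has the least admissible sum. *)
Lemma ex_sum_in_itv (l1 h1 l2 h2 l3 h3 : R) :
  l1 <= h1 -> l2 <= h2 -> l3 <= h3 -> l1 + l2 <= h3 -> l3 <= h1 + h2 ->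
  exists s t, [/\ l1 <= s <= h1, l2 <= t <= h2 & l3 <= s + t <= h3].
Proof.
move=> ? ? ? ? ?.
have [?|?] := leP l1 (l3 - h2).
  by exists (l3 - h2), h2; split; lra.
have [?|?] := leP l2 (l3 - l1).
  by exists l1, (l3 - l1); split; lra.
by exists l1, l2; split; lra.
Qed.

Lemma between_int (m : int) t : between m%:~R t -> t = m%:~R.
Proof.
by rewrite /between intrKfloor intrKceil => h; apply/eqP; rewrite eq_le andbC.
Qed.

(** Moving [s] away from [w], the first integer met is an end of the unit interval that contains
    both. *)
Lemma between_exit s w : between s w -> s != w ->
  exists r, [/\ 0 < r, s \isn't a Num.int, s + r * (s - w) \is a Num.int &
    between s (s + r * (s - w))].
Proof.
rewrite /between; case: floor_ceilP => m.
  by move=> -> h /negP[]; rewrite eq_le.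
rewrite intrD => /andP[ms sm] /andP[mw wm] ne.
have sN : s \isn't a Num.int.
  apply/negP => /intrP[z sz]; move: ms sm; rewrite sz ltr_int -(intrD _ m 1) ltr_int.
  by rewrite ltzD1 ltNge => /negPf -> .
have [lt|gt] := ltP w s.
  exists ((m%:~R + 1 - s) / (s - w)).
  have d0 : s - w != 0 by lra.
  rewrite divfK //; split=> //; first by rewrite divr_gt0; lra.
    by rewrite addrC subrK -(intrD _ m 1) intr_int.
  lra.
have {gt ne}lt : s < w by rewrite lt_neqAle ne.
exists ((s - m%:~R) / (w - s)).
have d0 : s - w != 0 by lra.
have -> : (s - m%:~R) / (w - s) * (s - w) = m%:~R - s.
  by rewrite -(opprB s w) invrN mulrN mulNr divfK // opprB.
split=> //; first by rewrite divr_gt0; lra.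
  by rewrite addrC subrK intr_int.
lra.
Qed.

(** The least of the exit times of the single pairs: one entry becomes integral while no other has
    left its interval. *)
Lemma between_exit_seq (L : seq (R * R)) :
  (forall p, p \in L -> between p.1 p.2) ->
  (forall p, p \in L -> p.1 = p.2) \/
  exists r, [/\ 0 < r, forall p, p \in L -> between p.1 (p.1 + r * (p.1 - p.2)) &
    exists2 p, p \in L & p.1 \isn't a Num.int /\ p.1 + r * (p.1 - p.2) \is a Num.int].
Proof.
have sub s w r r' : 0 <= r -> r <= r' ->
    between s (s + r' * (s - w)) -> between s (s + r * (s - w)).
  move=> r0 rr'; have := between_refl s; rewrite /between => /andP[? ?] /andP[? ?].
  by have [?|?] := leP 0 (s - w); apply/andP; split; nra.
elim: L => [|[s w] L IH] bL; first by left.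
have bsw : between s w by apply: (bL (s, w)); rewrite mem_head.
have [|EL|[r [r0 rL rE]]] := IH _.
- by move=> p pL; apply: bL; rewrite inE pL orbT.
- have [->|ne] := eqVneq s w.
    by left=> p; rewrite inE => /orP[/eqP ->|/EL].
  have [r [r0 sN sI sb]] := between_exit bsw ne.
  right; exists r; split=> // [p|].
    rewrite inE => /orP[/eqP -> //|/[dup] pL /EL <-].
    by rewrite subrr mulr0 addr0 between_refl.
  by exists (s, w); rewrite ?mem_head.
- right; have [E|ne] := eqVneq s w.
    exists r; split=> // [p|].
      rewrite inE => /orP[/eqP -> /=|/rL //].
      by rewrite E subrr mulr0 addr0 between_refl.
    by case: rE => p pL pE; exists p; rewrite // inE pL orbT.
  have [r' [r'0 sN sI sb]] := between_exit bsw ne.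
  have [le|lt] := leP r' r.
    exists r'; split=> // [p|]; last by exists (s, w); rewrite ?mem_head.
    rewrite inE => /orP[/eqP -> //|/rL]; apply: sub => //; exact: ltW.
  exists r; split=> // [p|].
    rewrite inE => /orP[/eqP -> /=|/rL //]; apply: sub sb; exact: ltW.
  by case: rE => p pL pE; exists p; rewrite // inE pL orbT.
Qed.

Lemma count_lt (T : eqType) (a b : pred T) (s : seq T) :
  {in s, forall x, a x -> b x} -> (exists2 x, x \in s & b x && ~~ a x) ->
  (count a s < count b s)%N.
Proof.
elim: s => [|x s IH] ab [y]; first by [].
have le : (count a s <= count b s)%N.
  elim: (s) {IH} (fun y ys => ab y (mem_behead (s := x :: s) ys)) => //= z s' IH' ab'.
  apply: leq_add; last by apply: IH' => w ws; apply: ab'; rewrite inE ws orbT.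
  by case: (a z) (ab' z (mem_head _ _)) => // ->.
have := ab x (mem_head _ _).
rewrite inE => abx /orP[/eqP -> /andP[bx /negPf ax]|ys yab] /=.
  by rewrite ax bx add0n add1n ltnS.
have lt : (count a s < count b s)%N.
  by apply: IH; [move=> w ws; apply: ab; rewrite inE ws orbT|exists y].
by case: (a x) abx => [->//|_]; lia.
Qed.

End Bounds.

Section Interpolation.
Variables (R : realType) (n : nat).
Hypothesis n_gt0 : (0 < n)%N.
Local Notation plane := 'rV[R]_2.
Local Notation X := (cX n).
Local Notation Y := (cY n).
Local Notation cell := (cell n).
Implicit Types (x y u v : plane) (a b : int) (g : plane -> R).

(* The bounds on v, u + v ask for a point of a box on which a third linear form is
   bounded as well; since u runs over the integral hull of x, each of the conditions
   of feasibility says that a real number is at most some integer, and holds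
   because it holds at x. *)
Lemma cell_sum x y u : cell x u -> exists2 v, cell y v & cell (x + y) (u + v).
Proof.
case=> u1 u2 u3.
pose lo (s t w : R) := Num.max (Num.floor s)%:~R ((Num.floor t)%:~R - w).
pose hi (s t w : R) := Num.min (Num.ceil s)%:~R ((Num.ceil t)%:~R - w).
have zX : X (x + y) = X x + X y by rewrite coordE.
have zY : Y (x + y) = Y x + Y y by rewrite coordE.
have [s [t [sb tb stb]]] : exists s t,
  [/\ lo (X y) (X (x + y)) (X u) <= s <= hi (X y) (X (x + y)) (X u),
      lo (Y y) (Y (x + y)) (Y u) <= t <= hi (Y y) (Y (x + y)) (Y u) &
      lo (X y + Y y) (X (x + y) + Y (x + y)) (X u + Y u) <= s + t <=
      hi (X y + Y y) (X (x + y) + Y (x + y)) (X u + Y u)].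
  have F (r : R) := floor_le r; have C (r : R) := ceil_ge r.
  have le1 (s : R) (m : int) := @between_le R s _ m.
  have ge1 (s : R) (m : int) := @between_ge R s _ m.
  have key (s t w w' : R) : t = w' + s -> between w' w -> lo s t w <= hi s t w.
    move=> tE bw; rewrite /lo /hi ge_max !le_min.
    have Fs := F s; have Cs := C s; have Ft := F t; have Ct := C t.
    have := le1 _ _ (Num.ceil t - Num.floor s) bw.
    have := ge1 _ _ (Num.floor t - Num.ceil s) bw.
    rewrite !intrB => H1 H2.
    by apply/andP; split; apply/andP; split; lra.
  apply: ex_sum_in_itv.
  - exact: key u1.
  - exact: key u2.
  - by apply: key u3; rewrite zX zY addrACA.
  - rewrite /lo /hi zX zY.
    set fy1 := Num.floor (X y); set fy2 := Num.floor (Y y).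
    set cy3 := Num.ceil (X y + Y y); set cz3 := Num.ceil _.
    set fz1 := Num.floor (X x + X y); set fz2 := Num.floor (Y x + Y y).
    have h1 : fy1%:~R <= X y := F _. have h2 : fy2%:~R <= Y y := F _.
    have h3 : X y + Y y <= cy3%:~R := C _. have h4 : fz1%:~R <= X x + X y := F _.
    have h5 : fz2%:~R <= Y x + Y y := F _.
    have h6 : X x + X y + (Y x + Y y) <= cz3%:~R := C _.
    have := le1 _ _ (cz3 - fy1 - fy2) u3.
    have := ge1 _ _ (fz1 + fy2 - cy3) u1.
    have := ge1 _ _ (fy1 + fz2 - cy3) u2.
    have := le1 _ _ (cz3 - fz1 - fy2) u2.
    have := le1 _ _ (cz3 - fy1 - fz2) u1.
    have := ge1 _ _ (fz1 + fz2 - cy3) u3.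
    rewrite !(intrB, intrD) => H1 H2 H3 H4 H5 H6.
    by rewrite /Order.max /Order.min; do 3 case: ifP => _; lra.
  - rewrite /lo /hi zX zY.
    set cy1 := Num.ceil (X y); set cy2 := Num.ceil (Y y).
    set fy3 := Num.floor (X y + Y y); set fz3 := Num.floor (_ + _ + _).
    set cz1 := Num.ceil (X x + X y); set cz2 := Num.ceil (Y x + Y y).
    have h1 : X y <= cy1%:~R := C _. have h2 : Y y <= cy2%:~R := C _.
    have h3 : fy3%:~R <= X y + Y y := F _. have h4 : X x + X y <= cz1%:~R := C _.
    have h5 : Y x + Y y <= cz2%:~R := C _.
    have h6 : fz3%:~R <= X x + X y + (Y x + Y y) := F _.
    have := ge1 _ _ (fz3 - cy1 - cy2) u3.
    have := le1 _ _ (cz1 + cy2 - fy3) u1.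
    have := le1 _ _ (cy1 + cz2 - fy3) u2.
    have := ge1 _ _ (fz3 - cz1 - cy2) u2.
    have := ge1 _ _ (fz3 - cy1 - cz2) u1.
    have := le1 _ _ (cz1 + cz2 - fy3) u3.
    rewrite !(intrB, intrD) => H1 H2 H3 H4 H5 H6.
    by rewrite /Order.max /Order.min; do 3 case: ifP => _; lra.
exists (mk n s t).
  move: sb tb stb; rewrite /lo /hi !ge_max !le_min => sb tb stb.
  by split; rewrite /between ?cX_mk ?cY_mk //; lra.
move: sb tb stb; rewrite /lo /hi !ge_max !le_min => sb tb stb.
by split; rewrite /between !(cXD n u, cYD n u) ?cX_mk ?cY_mk //; lra.
Qed.

End Interpolation.

Section Interpolation.
Variables (R : realType) (n : nat).
Hypothesis n_gt0 : (0 < n)%N.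
Local Notation plane := 'rV[R]_2.
Local Notation X := (cX n).
Local Notation Y := (cY n).
Local Notation cell := (cell n).
Local Notation fcell := (@fcell R n).
Implicit Types (x y u v : plane) (a b : int) (g : plane -> R) (phi : int -> int -> R).

Definition aff (A : set plane) g := forall u v (t : R), A u -> A v -> 0 <= t <= 1 ->
  g (t *: u + (1 - t) *: v) = t * g u + (1 - t) * g v.

Lemma aff_sub (A B : set plane) g : (A `<=` B)%classic -> aff B g -> aff A g.
Proof. by move=> AB Bg u v t /AB Bu /AB Bv; exact: Bg. Qed.

Lemma ex_triangle x : exists k a b, k <> Diag /\ fcell k a b x.
Proof.
have /andP[h1 h2] := floor_itv (X x); have /andP[h3 h4] := floor_itv (Y x).
rewrite !intrD in h2 h4.
set a := Num.floor (X x) in h1 h2; set b := Num.floor (Y x) in h3 h4.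
have [le|lt] := leP (X x + Y x) (a%:~R + b%:~R + 1).
  by exists Lower, a, b; split=> //; split; lra.
by exists Upper, a, b; split=> //; split; lra.
Qed.

Definition triangle_aff g := forall k a b, k <> Diag -> aff (fcell k a b) g.

Lemma cell_aff g x : triangle_aff g -> aff (cell x) g.
Proof.
move=> ga; have [k [a [b [kD xk]]]] := ex_triangle x.
by apply: aff_sub (cell_fcell xk) (ga k a b kD).
Qed.

Definition nonintegral x y : nat :=
  count [pred s : R | s \isn't a Num.int]
    [:: X x; Y x; X x + Y x; X y; Y y; X y + Y y;
        X (x + y); Y (x + y); X (x + y) + Y (x + y)].

Definition push (r : R) x u : plane := x + r *: (x - u).

Lemma pushD r x y u v : push r (x + y) (u + v) = push r x u + push r y v.
Proof. by rewrite /push addrACA -scalerDr opprD [x - u + _]addrACA. Qed.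

Lemma pushK r x u : 0 < r ->
  x = (1 + r)^-1 *: push r x u + (1 - (1 + r)^-1) *: u.
Proof.
move=> r0; set t := _^-1; have tr : t * (1 + r) = 1 by rewrite mulVf //; lra.
have -> : push r x u = (1 + r) *: x - r *: u.
  by rewrite /push scalerBr scalerDl scale1r addrA.
rewrite scalerBr !scalerA tr scale1r -addrA -scaleNr -scalerDl.
have -> : - (t * r) + (1 - t) = 0 by rewrite mulrDr mulr1 in tr; lra.
by rewrite scale0r addr0.
Qed.

(** All nine forms move with the same [r], up to the first exit. A form that is already integral
    agrees at both points and does not move, so the count drops. *)
Lemma cell_push x y u v : cell x u -> cell y v -> cell (x + y) (u + v) ->
  (x = u /\ y = v) \/ exists r, [/\ 0 < r, cell x (push r x u),
    cell y (push r y v), cell (x + y) (push r (x + y) (u + v)) &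
    (nonintegral (push r x u) (push r y v) < nonintegral x y)%N].
Proof.
move=> ux vy uv.
pose forms u v := [:: X u; Y u; X u + Y u; X v; Y v; X v + Y v;
  X (u + v); Y (u + v); X (u + v) + Y (u + v)].
pose pairs := [:: (X x, X u); (Y x, Y u); (X x + Y x, X u + Y u);
  (X y, X v); (Y y, Y v); (X y + Y y, X v + Y v);
  (X (x + y), X (u + v)); (Y (x + y), Y (u + v));
  (X (x + y) + Y (x + y), X (u + v) + Y (u + v))].
have bet p : p \in pairs -> between p.1 p.2.
  case: ux vy uv => ? ? ? [? ? ?] [? ? ?].
  suff /allP : all (fun p => between p.1 p.2) pairs by apply.
  by rewrite /=; do 9 (apply/andP; split=> //).
have [E|[r [r0 rb rE]]] := between_exit_seq bet; [left|right].
  by split; apply: (plane_eq n_gt0); [exact: (E (X x, X u) (mem_head _ _))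
    |apply: (E (Y x, Y u))|apply: (E (X y, X v))|apply: (E (Y y, Y v))];
    rewrite !inE eqxx ?orbT.
have formsE : forms (push r x u) (push r y v) = [seq p.1 + r * (p.1 - p.2) | p <- pairs].
  by rewrite /forms /= /push !coordE; do 9 (apply: (congr2 cons); first by ring).
exists r; rewrite pushD.
have nb i : (i < 9)%N -> between (nth 0 (forms x y) i)
    (nth 0 (forms (push r x u) (push r y v)) i).
  move=> lti; have := rb _ (mem_nth (0, 0) (lti : (i < size pairs)%N)).
  rewrite formsE (nth_map (0, 0)) //.
  by move: i lti; do 9 (case=> //).
split=> //; try by split; [exact: (nb 0)|exact: (nb 1)|exact: (nb 2)].
- by split; [exact: (nb 3)|exact: (nb 4)|exact: (nb 5)].
- by split; [exact: (nb 6)|exact: (nb 7)|exact: (nb 8)].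
- rewrite /nonintegral -/(forms _ _) -/(forms x y).
  have -> : forms x y = [seq p.1 | p <- pairs] by [].
  rewrite formsE !count_map; apply: count_lt => [p pP|].
    apply: contra => /intrP[z zE]; have := rb p pP.
    by rewrite /= zE => /between_int ->; rewrite intr_int.
  by case: rE => p pP [h1 h2]; exists p => //=; rewrite h1 h2.
Qed.

(** The defect [g x + g y - g (x + y)] is affine on the segment from [(u, v)] through [(x, y)] to
    the pushed pair, because each of the three arguments stays in one cell. *)
Lemma push_defect g x y u v r : triangle_aff g -> 0 < r ->
  cell x u -> cell y v -> cell (x + y) (u + v) ->
  cell x (push r x u) -> cell y (push r y v) ->
  cell (x + y) (push r (x + y) (u + v)) ->
  (1 + r) * (g x + g y - g (x + y)) =
  g (push r x u) + g (push r y v) - g (push r x u + push r y v) +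
  r * (g u + g v - g (u + v)).
Proof.
move=> ga r0 ux vy uv xr yr xyr.
have r1 : 0 < 1 + r by lra.
have t0 : 0 <= (1 + r)^-1 <= 1 by rewrite invr_ge0 (ltW r1) invf_le1 //; lra.
have tr : (1 + r) * (1 + r)^-1 = 1 by rewrite divff // gt_eqF.
rewrite {1}(pushK x u r0) {1}(pushK y v r0) {1}(pushK (x + y) (u + v) r0).
rewrite (cell_aff ga xr ux t0) (cell_aff ga yr vy t0) (cell_aff ga xyr uv t0).
rewrite -pushD; set t := (1 + r)^-1 in t0 tr *.
have tE : r * t = 1 - t by rewrite mulrDl mul1r in tr; lra.
rewrite !(mulrDr, mulrDl, mulrBr, mulrBl, mul1r, mulrA) !tE; ring: tE.
Qed.

(* A lattice point u of the cell of x is matched with some v; pushing (x, y) away from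
   (u, v) makes one more of the nine forms integral. *)
Lemma triangle_aff_subadditive g : triangle_aff g ->
  (forall u y, u \in grid R n -> g (u + y) <= g u + g y) ->
  forall x y, g (x + y) <= g x + g y.
Proof.
move=> ga lat x y.
have [N] := ubnP (nonintegral x y); elim: N x y => // N IH x y leN.
have [xg|xg] := boolP (x \in grid R n); first exact: lat.
(* Rounding the two coordinates in opposite directions keeps their sum within the bounds of
   [X x + Y x]; rounding both the same way may leave the cell. *)
pose u : plane := mk n (Num.ceil (X x))%:~R (Num.floor (Y x))%:~R.
have ux : cell x u.
  have := floor_le (X x); have := floor_le (Y x).
  have := ceil_ge (X x); have := ceil_ge (Y x) => ? ? ? ?.
  split; rewrite ?cX_mk ?cY_mk // /between.
  - by rewrite lexx andbT; lra.
  - by rewrite lexx /=; lra.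
  - rewrite -intrD !ler_int; apply/andP; split.
      by rewrite [leRHS]addrC -floor_intD le_floor //; lra.
    by rewrite -ceil_intD le_ceil //; lra.
have [v vy uv] := cell_sum n_gt0 y ux.
have ug : u \in grid R n by exact: mk_grid.
have [[xu _]|[r [r0 xr yr xyr lt]]] := cell_push ux vy uv.
  by rewrite xu ug in xg.
have := IH _ _ (leq_trans lt leN); have := lat u v ug.
have := push_defect ga r0 ux vy uv xr yr xyr.
set A := g (push _ _ _); set B := g (push _ _ _); set C := g (_ + push _ _ _).
by nra.
Qed.

Definition bary k a b phi x : R :=
  let s := X x - a%:~R in let t := Y x - b%:~R in
  if k is Lower then (1 - s - t) * phi a b + s * phi (a + 1) b + t * phi a (b + 1)
  else (s + t - 1) * phi (a + 1) (b + 1) + (1 - t) * phi (a + 1) b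
       + (1 - s) * phi a (b + 1).

Definition interp phi x : R :=
  let a := Num.floor (X x) in let b := Num.floor (Y x) in
  bary (if X x + Y x <= a%:~R + b%:~R + 1 then Lower else Upper) a b phi x.

(** [interp] selects the triangle by floors, so it counts the right and upper sides of a square to
    the next squares; the formulas agree on the common faces. *)
Lemma interp_bary k a b phi x : k <> Diag -> fcell k a b x ->
  interp phi x = bary k a b phi x.
Proof.
move=> kD [/andP[a1 a2] /andP[b1 b2] h]; rewrite /interp.
have fX : (X x < a%:~R + 1 /\ Num.floor (X x) = a) \/
    (X x = a%:~R + 1 /\ Num.floor (X x) = a + 1).
  have [lt|ge] := ltP (X x) (a%:~R + 1).
    by left; split=> //; apply: floor_def; rewrite intrD a1.
  have E : X x = a%:~R + 1 by apply/eqP; rewrite eq_le a2.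
  by right; split=> //; rewrite E -(intrD _ a 1) intrKfloor.
have fY : (Y x < b%:~R + 1 /\ Num.floor (Y x) = b) \/
    (Y x = b%:~R + 1 /\ Num.floor (Y x) = b + 1).
  have [lt|ge] := ltP (Y x) (b%:~R + 1).
    by left; split=> //; apply: floor_def; rewrite intrD b1.
  have E : Y x = b%:~R + 1 by apply/eqP; rewrite eq_le b2.
  by right; split=> //; rewrite E -(intrD _ b 1) intrKfloor.
case: k kD h => // _ h.
  case: fX => [[lX ->]|[eX ->]]; case: fY => [[lY ->]|[eY ->]].
  - by rewrite h.
  - have X0 : X x = a%:~R by lra.
    by rewrite /bary !intrD ifT; [rewrite X0 eY; ring|lra].
  - have Y0 : Y x = b%:~R by lra.
    by rewrite /bary !intrD ifT; [rewrite Y0 eX; ring|lra].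
  - lra.
case: fX => [[lX ->]|[eX ->]]; case: fY => [[lY ->]|[eY ->]].
- case: ifP => // le; rewrite /bary.
  have -> : Y x = a%:~R + b%:~R + 1 - X x by lra.
  ring.
- by rewrite /bary !intrD ifT; [rewrite eY; ring|lra].
- by rewrite /bary !intrD ifT; [rewrite eX; ring|lra].
- by rewrite /bary !intrD ifT; [rewrite eX eY; ring|lra].
Qed.

Lemma interp_triangle_aff phi : triangle_aff (interp phi).
Proof.
move=> k a b kD u v t uk vk /andP[t0 t1].
have wk : fcell k a b (t *: u + (1 - t) *: v).
  case: uk vk => /andP[? ?] /andP[? ?] uk [/andP[? ?] /andP[? ?] vk].
  have t1' : 0 <= 1 - t by lra.
  by split; rewrite !coordE; [apply/andP; split; nra|apply/andP; split; nra|];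
    case: k kD uk vk => // _ ? ?; nra.
rewrite (interp_bary phi kD uk) (interp_bary phi kD vk) (interp_bary phi kD wk).
rewrite /bary !coordE.
by case: k kD {uk vk wk} => // _; ring.
Qed.

Lemma interp_int phi a b : interp phi (mk n a%:~R b%:~R) = phi a b.
Proof.
rewrite (@interp_bary Lower a b) //.
  by rewrite /bary ?cX_mk ?cY_mk //; ring.
by split; rewrite ?cX_mk ?cY_mk //; lra.
Qed.

Lemma interp_shift phi (c d : int) x : interp phi (mk n c%:~R d%:~R + x) =
  interp (fun a b => phi (c + a) (d + b)) x.
Proof.
have [k [a [b [kD xk]]]] := ex_triangle x.
have xk' : fcell k (c + a) (d + b) (mk n c%:~R d%:~R + x).
  have [XE YE] := (cXD n (mk n c%:~R d%:~R) x, cYD n (mk n c%:~R d%:~R) x).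
  rewrite cX_mk // in XE; rewrite cY_mk // in YE.
  case: xk => h1 h2 h3; split; rewrite ?XE ?YE !intrD; [lra|lra|].
  by case: k h3 {kD} => h3; lra.
rewrite (interp_bary _ kD xk) (interp_bary phi kD xk') /bary !coordE.
by rewrite cX_mk // cY_mk // !intrD -!addrA; case: k kD {xk xk'} => // _; ring.
Qed.

Lemma ge0_bary k a b phi x : k <> Diag -> fcell k a b x ->
  (forall a b, 0 <= phi a b) -> 0 <= bary k a b phi x.
Proof.
move=> kD [/andP[? ?] /andP[? ?] h] p0; rewrite /bary.
by case: k kD h => // _ h; rewrite !addr_ge0 // mulr_ge0 //; lra.
Qed.

Lemma interp_ge0 phi x : (forall a b, 0 <= phi a b) -> 0 <= interp phi x.
Proof.
move=> p0; have [k [a [b [kD xk]]]] := ex_triangle x.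
by rewrite (interp_bary phi kD xk) ge0_bary.
Qed.

Lemma interp_le phi psi x : (forall a b, phi a b <= psi a b) ->
  interp phi x <= interp psi x.
Proof.
move=> le; have [k [a [b [kD xk]]]] := ex_triangle x.
rewrite -subr_ge0 (interp_bary phi kD xk) (interp_bary psi kD xk).
have -> : bary k a b psi x - bary k a b phi x =
  bary k a b (fun a b => psi a b - phi a b) x.
  by rewrite /bary; case: k {kD xk} => /=; ring.
by apply: ge0_bary => // ? ?; rewrite subr_ge0.
Qed.

(** Only a vertex [u] as first argument has to be considered; then [u + y] has the same barycentric
    coordinates as [y], and the claim is an average of the hypothesis. *)
Lemma interp_subadditive phi :
  (forall a b c d, phi (a + c) (b + d) <= phi a b + phi c d) ->
  forall x y, interp phi (x + y) <= interp phi x + interp phi y.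
Proof.
move=> sub; apply: triangle_aff_subadditive; first exact: interp_triangle_aff.
move=> u y /gridP[a [b [ua ub]]]; rewrite -(mkE n_gt0 u) ua ub interp_shift interp_int.
have -> : phi a b + interp phi y = interp (fun c d => phi a b + phi c d) y.
  have [k [c [d [kD yk]]]] := ex_triangle y.
  rewrite !(interp_bary _ kD yk) /bary.
  by case: k kD {yk} => // _ /=; ring.
exact: interp_le.
Qed.

Lemma piecewise_linear_interp g : piecewise_linear n g ->
  g = interp (fun a b => g (mk n a%:~R b%:~R)).
Proof.
move=> pl; apply/funext => x; have [k [a [b [kD xk]]]] := ex_triangle x.
rewrite (interp_bary _ kD xk).
have [|l [c gE]] := pl (fcell k a b).
  by apply/plane_faces2 => //; exists k, a, b; split=> //; case: k kD {xk} => //; auto.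
have mkE' s t : mk n s t = s *: (mk n 1 0) + t *: (mk n 0 1).
  by apply: (plane_eq n_gt0); rewrite !coordE ?cX_mk ?cY_mk //; ring.
have gk s t : fcell k a b (mk n s t) -> g (mk n s t) =
    s * l (mk n 1 0) + t * l (mk n 0 1) + c.
  by move=> /gE ->; rewrite mkE' linearD !linearZ.
have xk' := xk; rewrite -(mkE n_gt0 x) in xk'.
rewrite -{1}(mkE n_gt0 x) gk // /bary.
case: k kD {xk gE xk' pl} gk => // _ gk;
  rewrite !gk; try (by split; rewrite ?cX_mk ?cY_mk // ?intrD; lra);
  rewrite !intrD; ring.
Qed.

Lemma piecewise_linear_triangle_aff g : piecewise_linear n g -> triangle_aff g.
Proof. by move=> /piecewise_linear_interp ->; exact: interp_triangle_aff. Qed.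

End Interpolation.

(** * Piecewise linearity over finer complexes *)

Section Refinement.
Variables (R : realType).
Local Notation plane := 'rV[R]_2.
Implicit Types (g : plane -> R).

Lemma between_mulr (m : nat) (s t : R) : (0 < m)%N ->
  between (m%:R * s) (m%:R * t) -> between s t.
Proof.
move=> m0; have m0' : 0 < m%:R :> R by rewrite ltr0n.
have E (z : int) : (m%:Z * z)%:~R = m%:R * z%:~R :> R by rewrite intrM.
move=> bst; apply/andP; split.
  have := between_ge (m := m%:Z * Num.floor s) bst.
  by rewrite E !ler_pM2l //; apply; rewrite floor_le.
by have := between_le (m := m%:Z * Num.ceil s) bst; rewrite E !ler_pM2l //; apply; rewrite ceil_ge.
Qed.

Lemma cell_refine (m n : nat) (x : plane) : (0 < m)%N ->
  (cell (m * n) x `<=` cell n x)%classic.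
Proof.
move=> m0 u [h1 h2 h3]; rewrite !(cX_mulr, cY_mulr) in h1 h2 h3.
rewrite -!mulrDr in h3.
split; [exact: (between_mulr m0 h1)|exact: (between_mulr m0 h2)|].
by rewrite /cX /cY -!mulrDr; exact: (between_mulr m0 h3).
Qed.

(** The witness is the barycenter, where none of [X], [Y] and [X + Y] is an integer. *)
Lemma fcell_cell n k a b : (0 < n)%N -> k <> Diag ->
  exists2 x : plane, fcell n k a b x & (fcell n k a b `<=` cell n x)%classic.
Proof.
move=> n_gt0 kD.
have [e eE ek] : exists2 e : R, 1 / 3 <= e <= 2 / 3 &
    if k is Lower then e = 1 / 3 else e = 2 / 3.
  by case: k kD => // _; [exists (1 / 3)|exists (2 / 3)] => //; lra.
have f1 (c : int) : Num.floor (c%:~R + e) = c by apply: floor_def; rewrite intrD; lra.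
have c1 (c : int) : Num.ceil (c%:~R + e) = c + 1.
  by apply: ceil_def; rewrite addrK intrD; lra.
exists (mk n (a%:~R + e) (b%:~R + e)).
  by case: k kD ek => // _ ek; split; rewrite ?cX_mk ?cY_mk //; lra.
case: k kD ek => // _ ek x [? ? h];
  split; rewrite /between ?cX_mk ?cY_mk // ?f1 ?c1 ?intrD //.
  have -> : Num.floor (a%:~R + e + (b%:~R + e)) = a + b.
    by apply: floor_def; rewrite !intrD; lra.
  have -> : Num.ceil (a%:~R + e + (b%:~R + e)) = a + b + 1.
    by apply: ceil_def; rewrite addrK !intrD; lra.
  by rewrite !intrD; lra.
have -> : Num.floor (a%:~R + e + (b%:~R + e)) = a + b + 1.
  by apply: floor_def; rewrite !intrD; lra.
have -> : Num.ceil (a%:~R + e + (b%:~R + e)) = a + b + 1 + 1.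
  by apply: ceil_def; rewrite addrK !intrD; lra.
by rewrite !intrD; lra.
Qed.

Lemma piecewise_linear_refine (m n : nat) g : (0 < m)%N -> (0 < n)%N ->
  piecewise_linear n g -> piecewise_linear (m * n) g.
Proof.
move=> m0 n0 pl T; have mn0 : (0 < m * n)%N by rewrite muln_gt0 m0.
move=> /(plane_faces2 mn0)[k [a [b [kE ->]]]].
have kD : k <> Diag by case: kE => ->.
have [x _ sub] := @fcell_cell (m * n) k a b mn0 kD.
have [k' [a' [b' [kD' xk']]]] := ex_triangle n x.
have [|l [c gE]] := pl (fcell n k' a' b').
  apply/(plane_faces2 n0); exists k', a', b'; split=> //.
  by case: k' kD' {xk'} => //; auto.
exists l, c => u /sub /(cell_refine m0) /(cell_fcell xk'); exact: gE.
Qed.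

End Refinement.

(** * Restriction to a grid and extension from it *)

Section GridFunctions.
Variables (R : realType) (n : nat) (f : 'rV[R]_2).
Hypothesis (n_gt0 : (0 < n)%N) (fn : f \in grid R n).
Local Notation plane := 'rV[R]_2.
Local Notation gt := (grid_group R n).
Implicit Types (x y z : plane) (a b : int) (g : plane -> R).

Definition gpt a b : gt := GridGroup (mk_grid R n_gt0 a b).

Lemma gptD a b c d : gpt (a + c) (b + d) = gpt a b + gpt c d.
Proof.
apply: val_inj; rewrite raddfD /=; apply: (plane_eq n_gt0);
  by rewrite !coordE ?cX_mk ?cY_mk // intrD.
Qed.

Lemma gptP (x : gt) : exists a b, x = gpt a b.
Proof.
have /gridP[a [b [xa yb]]] := valP x; exists a, b; apply: val_inj.
by rewrite /= -xa -yb mkE.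
Qed.

Lemma Z2P z : z \in Z2 R ->
  exists a b, z = mk n (n%:Z * a)%:~R (n%:Z * b)%:~R.
Proof.
move=> /gridP[a [b [xa yb]]]; exists a, b; apply: (plane_eq n_gt0);
  by rewrite ?cX_mk ?cY_mk // intrM -?xa -?yb -[n in LHS]muln1 ?cX_mulr ?cY_mulr.
Qed.

Lemma gomory_johnson_restrict g : gomory_johnson (Z2 R) f g ->
  gomory_johnson (Z2_in_grid R n) (GridGroup fn) (fun x : gt => g (val x)).
Proof.
case=> ge0 g0 sub per sym; split=> [x||x y|x z zZ|x].
- exact: ge0.
- exact: g0.
- exact: sub.
- exact: per.
- exact: sym.
Qed.

Lemma interp_valid (phi : gt -> R) :
  gomory_johnson (Z2_in_grid R n) (GridGroup fn) phi ->
  valid_function (Z2 R) f (interp n (fun a b => phi (gpt a b))).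
Proof.
case=> ge0 phi0 sub per sym.
have interpE (x : gt) : interp n (fun a b => phi (gpt a b)) (val x) = phi x.
  by have [a [b ->]] := gptP x; rewrite interp_int.
apply: subadditive_valid.
- by move=> x; apply: interp_ge0.
- by rewrite -[0]/(val (0 : gt)) interpE.
- by apply: interp_subadditive => // a b c d; rewrite gptD.
- move=> x _ /Z2P[a [b ->]]; rewrite addrC interp_shift //.
  congr (interp _ _ _); apply/funext => c; apply/funext => d.
  rewrite gptD addrC per //; apply/gridP; exists a, b.
  have n_neq0 : n%:R != 0 :> R by rewrite pnatr_eq0 -lt0n.
  by split; apply: (mulfI n_neq0); rewrite -?cX_mulr -?cY_mulr muln1
    ?cX_mk ?cY_mk // intrM.
- rewrite -[f]/(val (GridGroup fn)) interpE.
  by have := sym (GridGroup fn); rewrite subrr phi0 addr0 => ->.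
Qed.

Lemma extreme_restrict g : minimal_function (Z2 R) f g -> piecewise_linear n g ->
  extreme_function (Z2 R) f g ->
  extreme_function (Z2_in_grid R n) (GridGroup fn) (fun x : gt => g (val x)).
Proof.
move=> gmin pl [_ ext].
have rmin : minimal_function (Z2_in_grid R n) (GridGroup fn) (fun x : gt => g (val x)).
  by apply: gomory_johnson_minimal; apply: gomory_johnson_restrict; apply: minimal_gomory_johnson.
split; first by case: rmin.
move=> p1 p2 v1 v2 gE.
(* Valid functions on the grid need not be subadditive, as interpolation requires; but the two
   halves of a minimal function are minimal. *)
have m1 := minimal_average rmin v1 v2 gE.
have m2 : minimal_function (Z2_in_grid R n) (GridGroup fn) p2.
  by apply: (minimal_average rmin v2 v1); rewrite gE; apply/funext => x; rewrite addrC.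
have gE' := piecewise_linear_interp n_gt0 pl.
have [|g1 g2] := ext _ _ (interp_valid (minimal_gomory_johnson m1))
   (interp_valid (minimal_gomory_johnson m2)).
  apply/funext => x; rewrite {1}gE'.
  have -> : (fun a b => g (mk n a%:~R b%:~R)) =
      (fun a b => 2^-1 * p1 (gpt a b) + 2^-1 * p2 (gpt a b)).
    by apply/funext => a; apply/funext => b; exact: (congr1 (@^~ (gpt a b)) gE).
  have [k [a [b [kD xk]]]] := ex_triangle n x.
  rewrite !(interp_bary _ kD xk) /bary.
  by case: k kD {xk} => // _; ring.
split; apply/funext => x; have [a [b ->]] := gptP x; rewrite [LHS]/=.
  by rewrite {1}g1 interp_int.
by rewrite {1}g2 interp_int.
Qed.

End GridFunctions.

(** * The torus *)

Local Open Scope classical_set_scope.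

Section Torus.
Variables (R : realType).
Local Notation plane := 'rV[R]_2.
Implicit Types (x y z u v : plane) (I J K : set plane).

Lemma mod1_Z2 x : x - mod1 x \in Z2 R.
Proof.
apply/gridP; exists (Num.floor (x ord0 ord0)), (Num.floor (x ord0 ord_max)).
by rewrite /cX /cY !mxE mul1r opprB addrC subrK mul1r opprB addrC subrK.
Qed.

Lemma mod1_addZ2 x z : z \in Z2 R -> mod1 (x + z) = mod1 x.
Proof.
rewrite -topredE => /mxOverP zZ; apply/rowP => j; rewrite !mxE.
have := zZ ord0 j; rewrite mxE mul1r => /intrP[m ->].
by rewrite floor_intD intrD opprD addrACA subrr addr0.
Qed.

Lemma mod1_eqP x y : mod1 x = mod1 y <-> x - y \in Z2 R.
Proof.
split=> [E|xy]; last by rewrite -(subrK y x) addrC mod1_addZ2.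
have -> : x - y = (x - mod1 x) - (y - mod1 y) by rewrite E opprB addrA subrK.
by rewrite rpredB ?mod1_Z2.
Qed.

Lemma oplus_mod1 x y : oplus (mod1 x) (mod1 y) = mod1 (x + y).
Proof.
apply/mod1_eqP; rewrite opprD addrACA rpredD //;
  by rewrite -opprB rpredN mod1_Z2.
Qed.

Variable (q : nat).
Hypothesis q_gt0 : (0 < q)%N.

Lemma Z2_coord z : z \in Z2 R ->
  exists a b : int, cX q z = q%:R * a%:~R /\ cY q z = q%:R * b%:~R.
Proof.
by move=> /gridP[a [b [xa yb]]]; exists a, b; rewrite -xa -yb -cX_mulr -cY_mulr muln1.
Qed.

(** In units of 1/q a nonzero integral vector has a coordinate of absolute value at least [q]. *)
Lemma Z2_small z : (2 < q)%N -> z \in Z2 R ->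
  `|cX q z| < 3%:R -> `|cY q z| < 3%:R -> z = 0.
Proof.
move=> q3 /Z2_coord[a [b [xa yb]]]; rewrite xa yb => hx hy.
have key (c : int) : `|q%:R * c%:~R : R| < 3%:R -> c = 0.
  rewrite normrM normr_nat -intr_norm => h.
  apply/eqP; rewrite -normr_eq0 eq_le normr_ge0 andbT leNgt; apply/negP => c1.
  have : 1 <= `|c|%:~R :> R by rewrite -[1]/(1%:~R) ler_int.
  have : (3%:R : R) <= q%:R by rewrite ler_nat.
  move=> q3' c1'; nra.
by apply: (plane_eq q_gt0); rewrite ?xa ?yb (key a hx, key b hy) mulr0 ?cX0 ?cY0.
Qed.

(** Redundant names for the faces of the torus: base point, type of triangle, and the vertices to
    keep. They serve only to make the complex finite, so that maximal triples exist. *)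
Definition code : finType := ('I_q * 'I_q * bool * (bool * bool * bool))%type.

Definition decode (c : code) : set plane :=
  let: (i, j, up, (m1, m2, m3)) := c in
  (@mod1 R) @` face q (mk q i%:R j%:R)
    (mask [:: m1; m2; m3] (if up then upper_triangle R else lower_triangle R)).

Lemma torus_complex_decode I : torus_complex q I -> exists c, I = decode c.
Proof.
suff key k : torus_faces q k I -> exists c, I = decode c by case=> [[]|]; apply: key.
move=> [_ [t [T [W [/gridP[a [b [ta tb]]] TE /subseqP[m sm ->] _ ->]]]] <-].
have [m1 [m2 [m3 mE]]] : exists m1 m2 m3, m = [:: m1; m2; m3].
  have : size m = 3%N by case: TE sm => ->.
  by case: m {sm} => [|m1 [|m2 [|m3 []]]] // _; exists m1, m2, m3.
have [up upE] : exists up : bool, T = if up then upper_triangle R else lower_triangle R.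
  by case: TE => ->; [exists false|exists true].
have lt (c : int) : (`|(c %% q)%Z| < q)%N.
  have := ltz_pmod c (d := q); have := modz_ge0 c (d := q); lia.
exists (Ordinal (lt a), Ordinal (lt b), up, (m1, m2, m3)) => /=.
rewrite mE upE {W}; set W := mask _ _.
have cE (c : int) : c%:~R = q%:R * (c %/ q)%Z%:~R + `|(c %% q)%Z|%N%:R :> R.
  rewrite {1}(divz_eq c q) intrD intrM mulrC; congr (_ + _).
  by rewrite natr_absz ger0_norm // modz_ge0 //; lia.
pose z : plane := mk q (q%:R * (a %/ q)%Z%:~R) (q%:R * (b %/ q)%Z%:~R).
have zZ : z \in Z2 R.
  have q0 : q%:R != 0 :> R by rewrite pnatr_eq0 -lt0n.
  apply/gridP; exists (a %/ q)%Z, (b %/ q)%Z; split; apply: (mulfI q0).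
    by rewrite -cX_mulr muln1 cX_mk.
  by rewrite -cY_mulr muln1 cY_mk.
have tE : t = mk q `|(a %% q)%Z|%N%:R `|(b %% q)%Z|%N%:R + z.
  by apply: (plane_eq q_gt0); rewrite !coordE ?cX_mk ?cY_mk // (ta, tb) cE addrC.
rewrite tE; set t0 := mk q _ _.
apply/seteqP; split=> _ [_ [x Wx <-] <-].
  exists (t0 + q%:R^-1 *: x); first by exists x.
  by rewrite -(mod1_addZ2 (t0 + _) zZ) addrAC.
exists (t0 + z + q%:R^-1 *: x); first by exists x.
by rewrite addrAC (mod1_addZ2 _ zZ).
Qed.

(** A strictly increasing measure on faces, so that a triple of largest total rank is maximal. *)
Definition rank I : nat := #|[set c | `[< decode c `<=` I >]]%SET|.

Lemma rank_le I J : I `<=` J -> (rank I <= rank J)%N.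
Proof.
move=> IJ; apply/subset_leq_card/fintype.subsetP => c; rewrite !finset.inE => /asboolP cI.
by apply/asboolP; apply: classical_sets.subset_trans cI IJ.
Qed.

Lemma rank_eq I J : torus_complex q J -> I `<=` J -> (rank J <= rank I)%N -> J = I.
Proof.
move=> /torus_complex_decode[c JE] IJ le; apply/seteqP; split=> //.
have : [set c | `[< decode c `<=` I >]]%SET == [set c | `[< decode c `<=` J >]]%SET.
  rewrite eqEcard [X in _ && X]le andbT; apply/fintype.subsetP => d; rewrite !finset.inE.
  by move=> /asboolP dI; apply/asboolP; apply: classical_sets.subset_trans dI IJ.
move=> /eqP/setP/(_ c); rewrite !finset.inE -JE.
by move=> E; apply/asboolP; rewrite E; apply/asboolP.
Qed.

Lemma ex_max_additive_triple (pi : plane -> R) I J K :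
  additive_triple q pi I J K -> exists I' J' K',
  [/\ max_additive_triple q pi I' J' K', I `<=` I', J `<=` J' & K `<=` K'].
Proof.
move=> add.
pose above m := `[< exists I' J' K', [/\ additive_triple q pi I' J' K',
  I `<=` I', J `<=` J', K `<=` K' & m = (rank I' + rank J' + rank K')%N] >].
have ex : exists m, above m.
  by exists (rank I + rank J + rank K)%N; apply/asboolP; exists I, J, K; split.
have bnd m : above m -> (m <= #|{: code}| + #|{: code}| + #|{: code}|)%N.
  by move=> /asboolP[I' [J' [K' [_ _ _ _ ->]]]]; rewrite !leq_add // max_card.
case: (ex_maxnP ex bnd) => m /asboolP[I' [J' [K' [add' II JJ KK mE]]]] maxm.
exists I', J', K'; split=> //; split=> // I2 J2 K2 add2 I2' J2' K2'.
have := maxm (rank I2 + rank J2 + rank K2)%N; rewrite mE.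
have -> : above (rank I2 + rank J2 + rank K2)%N.
  apply/asboolP; exists I2, J2, K2; split=> //.
  - exact: classical_sets.subset_trans II I2'.
  - exact: classical_sets.subset_trans JJ J2'.
  - exact: classical_sets.subset_trans KK K2'.
move=> /(_ isT) le; have := rank_le I2'; have := rank_le J2'; have := rank_le K2'.
by case: add2 => ? ? ? _ _; split; apply: rank_eq => //; lia.
Qed.

End Torus.

(** * Additivity on convex domains *)

Section Jensen.
Variable R : realType.

Lemma eq0_small (e C : R) : (forall t, 0 < t <= 1 -> `|e| <= t * C) -> e = 0.
Proof.
move=> h; apply/eqP; rewrite -normr_eq0 eq_le normr_ge0 andbT leNgt; apply/negP => e0.
have C0 : 0 < C by have := h 1 ltac:(lra); lra.
pose t := Num.min 1 (`|e| / (2 * C)).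
have t0 : 0 < t by rewrite lt_min ltr01 divr_gt0 // mulr_gt0.
have t1 : t <= 1 by rewrite ge_min lexx.
have := h t ltac:(lra); have : t * C <= `|e| / (2 * C) * C.
  by rewrite ler_wpM2r ?ge_min ?lexx ?orbT // ltW.
have -> : `|e| / (2 * C) * C = `|e| / 2 by field; rewrite gt_eqF.
lra.
Qed.

(** On the multiples of a small step [h] the midpoint identity makes [c] an arithmetic progression;
    between them the Lipschitz bound leaves an error proportional to [h]. *)
Lemma midpoint_affine (c : R -> R) (r L : R) : 0 < r ->
  (forall s t, `|c s - c t| <= L * `|s - t|) ->
  (forall t s, 0 <= t <= 1 -> 0 <= s <= r -> c (t + s) + c (t - s) = 2 * c t) ->
  forall t, 0 <= t <= 1 -> c t = (1 - t) * c 0 + t * c 1.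
Proof.
move=> r0 lip mid t /andP[t0 t1].
apply/eqP; rewrite -subr_eq0; apply/eqP.
apply: (@eq0_small _ (L + `|c 1 - c 0|)) => e /andP[e0 e1].
have L0 : 0 <= L by have := lip 1 0; rewrite subr0 normr1 mulr1; apply: le_trans.
(* Large enough that the step [1 / n] is below both the tolerance [e] and the radius [r]. *)
have nE := truncnS_gt (e^-1 + r^-1); set n := (Num.trunc _).+1 in nE.
have e'0 : 0 < e^-1 by rewrite invr_gt0.
have r'0 : 0 < r^-1 by rewrite invr_gt0.
have n0 : 0 < n%:R :> R by rewrite ltr0n.
pose h : R := n%:R^-1; have h0 : 0 < h by rewrite invr_gt0.
have nh : n%:R * h = 1 by rewrite divff // gt_eqF.
have hr : h <= r by rewrite -[r]invrK lef_pV2 ?posrE //; lra.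
have he : h <= e by rewrite -[e]invrK lef_pV2 ?posrE //; lra.
pose d := c h - c 0.
(* The recurrence has order two, so the induction carries two consecutive values. *)
have cj j : (j <= n)%N -> c (j%:R * h) = c 0 + j%:R * d /\
    c (j%:R * h + h) = c 0 + j%:R * d + d.
  elim: j => [_|j IH lt]; first by rewrite !mul0r !addr0 add0r /d; split; ring.
  have [IH1 IH2] := IH (ltnW lt).
  have jE : j.+1%:R * h = j%:R * h + h by rewrite -natr1 mulrDl mul1r.
  have -> : j.+1%:R * d = j%:R * d + d by rewrite -natr1 mulrDl mul1r.
  have ltn : j.+1%:R <= n%:R :> R by rewrite ler_nat.
  have M := mid (j%:R * h + h) h; rewrite addrK IH2 IH1 in M.
  rewrite jE IH2; split; first by ring.
  suff : c (j%:R * h + h + h) + (c 0 + j%:R * d) = 2 * (c 0 + j%:R * d + d) by lra.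
  apply: M; last by rewrite (ltW h0).
  by rewrite -jE mulr_ge0 ?(ltW h0) //= -[leRHS]nh ler_pM2r.
pose j := Num.trunc (t / h).
have j1 : j%:R <= t / h by rewrite truncn_le divr_ge0 // ltW.
have j2 : t / h < j.+1%:R by exact: truncnS_gt.
have th : t / h * h = t by rewrite divfK // gt_eqF.
have jn : (j <= n)%N.
  rewrite -(ler_nat R); apply: le_trans j1 _.
  by rewrite ler_pdivrMr // nh.
have jt : `|t - j%:R * h| <= h.
  have : j%:R * h <= t by rewrite -th ler_pM2r.
  have : t < j%:R * h + h by rewrite -{1}th -[X in _ + X]mul1r -mulrDl natr1 ltr_pM2r.
  by rewrite ler_norml => ? ?; apply/andP; split; lra.
have [cjE _] := cj j jn; have [c1 _] := cj n (leqnn n); rewrite nh in c1.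
have dE : d = h * (c 1 - c 0).
  by rewrite c1 addrC addKr mulrA [h * _]mulrC nh mul1r.
have -> : c t - ((1 - t) * c 0 + t * c 1) =
  (c t - c (j%:R * h)) - (t - j%:R * h) * (c 1 - c 0).
  by rewrite cjE dE; ring.
apply: le_trans (ler_normB _ _) _; rewrite normrM.
have := lip t (j%:R * h); have N0 := normr_ge0 (c 1 - c 0).
have := ler_wpM2l L0 (le_trans jt he); have := ler_wpM2r N0 (le_trans jt he).
lra.
Qed.

End Jensen.

Section ConvexAdditivity.
Variables (R : realType) (q : nat).
Hypothesis q_gt0 : (0 < q)%N.
Local Notation plane := 'rV[R]_2.
Local Notation X := (cX q).
Local Notation Y := (cY q).
Local Notation fcell := (@fcell R q).
Implicit Types (x y u v w d : plane) (P Q S : set plane) (g h k : plane -> R).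

Definition lipschitz g := exists2 L, 0 <= L &
  forall x y, `|g x - g y| <= L * (`|X (x - y)| + `|Y (x - y)|).

Definition convex_set P := forall u v (t : R), P u -> P v -> 0 <= t <= 1 ->
  P ((1 - t) *: u + t *: v).

(* Pushing the segment towards the interior point c makes room for small steps along d
   in both arguments, and then g satisfies Jensen's equation on the segment. *)
Lemma additive_affine P Q S g h k (cu cv d u v u' v' : plane) (r : R) :
  convex_set P -> convex_set Q -> convex_set S ->
  (forall u v, P u -> Q v -> S (u + v) -> g u + h v = k (u + v)) ->
  lipschitz g -> 0 < r ->
  (forall s t, `|s| <= r -> `|t| <= r ->
     [/\ P (cu + s *: d), Q (cv + t *: d) & S (cu + cv + (s + t) *: d)]) ->
  P u -> Q v -> S (u + v) -> P u' -> Q v' -> S (u' + v') -> u' = u + d ->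
  forall t, 0 <= t <= 1 -> g (u + t *: d) = (1 - t) * g u + t * g u'.
Proof.
move=> Pc Qc Sc add [L L0 gL] r0 int Pu Qv Suv Pu' Qv' Suv' uE t t01.
have comb (w w' : plane) s : (1 - s) *: w + s *: w' = w + s *: (w' - w).
  by rewrite scalerBl scale1r scalerBr -addrA [- _ + _]addrC.
have lin s : u + s *: d = (1 - s) *: u + s *: u'.
  by rewrite comb uE [u + d - u]addrAC subrr add0r.
pose V s := (1 - s) *: v + s *: v'.
have Pl s : 0 <= s <= 1 -> P (u + s *: d) by move=> ?; rewrite lin; apply: Pc.
have Vl s : 0 <= s <= 1 -> Q (V s) by move=> ?; apply: Qc.
have Sl s : 0 <= s <= 1 -> S (u + s *: d + V s).
  by move=> ?; rewrite lin /V addrACA -!scalerDr; apply: Sc.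
pose N w := `|X w| + `|Y w|.
have gN x y : `|g x - g y| <= L * N (x - y) := gL x y.
pose U th s := (1 - th) *: (u + s *: d) + th *: cu.
have key th : 0 < th <= 1 -> g (U th t) = (1 - t) * g (U th 0) + t * g (U th 1).
  move=> /andP[th0 th1].
  pose W s := (1 - th) *: V s + th *: cv.
  have th01 : 0 <= th <= 1 by rewrite ltW.
  have room s a b : 0 <= s <= 1 -> `|a| <= th * r -> `|b| <= th * r ->
     [/\ P (U th s + a *: d), Q (W s + b *: d) & S (U th s + W s + (a + b) *: d)].
    move=> s01 ha hb.
    have dv c : `|c| <= th * r -> `|th^-1 * c| <= r.
      by move=> hc; rewrite normrM gtr0_norm ?invr_gt0 // ler_pdivrMl.
    have [P1 Q1 S1] := int (th^-1 * a) (th^-1 * b) (dv a ha) (dv b hb).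
    have sh (w c : plane) (e : R) : w + th *: c + e *: d =
       w + th *: (c + (th^-1 * e) *: d).
      by rewrite scalerDr scalerA mulrA divff ?mul1r ?addrA // gt_eqF.
    split.
    - by rewrite sh; apply: Pc => //; apply: Pl.
    - by rewrite sh; apply: Qc => //; apply: Vl.
    - rewrite /U /W addrACA -!scalerDr sh mulrDr.
      by apply: Sc => //; apply: Sl.
  have Ush s e : U th (s + e) = U th s + ((1 - th) * e) *: d.
    by rewrite /U [(s + e) *: d]scalerDl addrA [(1 - th) *: (_ + e *: d)]scalerDr scalerA addrAC.
  have r'0 : 0 < th * r by rewrite mulr_gt0.
  apply: (@midpoint_affine _ (fun s => g (U th s)) (th * r) (L * N d)) => //.
  - move=> s s'; apply: le_trans (gN _ _) _.
    have -> : U th s - U th s' = ((1 - th) * (s - s')) *: d.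
      by rewrite {1}(_ : s = s' + (s - s')) ?Ush 1?addrAC ?subrr ?add0r // addrC subrK.
    rewrite /N !coordE !normrM -mulrDr -!mulrA ler_wpM2l // [leRHS]mulrC.
    have a1 : `|1 - th| <= 1 by rewrite ler_norml; lra.
    by rewrite ler_piMl // !(mulr_ge0, addr_ge0).
  - move=> s e s01 /andP[e0 er].
    have e'r : `|(1 - th) * e| <= th * r.
      rewrite normrM ger0_norm ?(ger0_norm e0); last lra.
      by apply: le_trans er; rewrite ler_piMl //; lra.
    have z0 : `|0 : R| <= th * r by rewrite normr0 ltW.
    have e''r : `|- ((1 - th) * e)| <= th * r by rewrite normrN.
    rewrite Ush Ush mulrN; set c := _ * e in e'r e''r *.
    have [P0 Q0 S0] := room s 0 0 s01 z0 z0.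
    have [P1 _ S1] := room s c 0 s01 e'r z0.
    have [_ Q1 S1'] := room s 0 c s01 z0 e'r.
    have [P2 _ _] := room s (- c) 0 s01 e''r z0.
    rewrite !(addr0, add0r, scale0r) in P0 Q0 S0 S1 S1'.
    (* In [E1 - E2 + E3 - E0] the values of [h] and [k] cancel, which leaves Jensen's equation for
       [g] at [U th s]. *)
    have E0 := add _ _ P0 Q0 S0.
    have E1 : g (U th s + c *: d) + h (W s) = k (U th s + W s + c *: d).
      have sE : U th s + W s + c *: d = U th s + c *: d + W s by rewrite addrAC.
      by rewrite sE; apply: add => //; rewrite -sE.
    have E2 : g (U th s) + h (W s + c *: d) = k (U th s + W s + c *: d).
      have sE : U th s + W s + c *: d = U th s + (W s + c *: d) by rewrite -addrA.
      rewrite sE; apply: add P0 Q1 _; rewrite -sE. exact: S1'.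
    have sE : U th s - c *: d + (W s + c *: d) = U th s + W s.
      by rewrite addrACA addNr addr0.
    have E3 : g (U th s - c *: d) + h (W s + c *: d) = k (U th s + W s).
      by rewrite -sE; apply: add => //; rewrite ?sE // -scaleNr.
    rewrite scaleNr; lra.
apply/eqP; rewrite -subr_eq0; apply/eqP.
(* Now [th] tends to 0: the three points of the pushed segment differ from the original ones by [th]
   times a constant. *)
pose C := L * (N (cu - (u + t *: d)) + N (cu - u) + N (cu - u')).
apply: (@eq0_small _ _ C) => th th01.
have Ulip s : `|g (u + s *: d) - g (U th s)| <= th * (L * N (cu - (u + s *: d))).
  rewrite mulrCA; apply: le_trans (gN _ _) _.
  rewrite /U comb opprD addrA subrr add0r /N !(cXN q (_ *: _), cYN q (_ *: _)) !normrN.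
  by rewrite !(cXZ, cYZ) !normrM -mulrDr gtr0_norm //; case/andP: th01.
have := Ulip 0; have := Ulip 1; have := Ulip t.
rewrite scale0r addr0 scale1r -uE => ht h1 h0; rewrite (key _ th01) in ht.
have /andP[t0 t1] := t01.
have -> : g (u + t *: d) - ((1 - t) * g u + t * g u') =
   (g (u + t *: d) - ((1 - t) * g (U th 0) + t * g (U th 1))) -
   ((1 - t) * (g u - g (U th 0)) + t * (g u' - g (U th 1))) by ring.
apply: le_trans (ler_normB _ _) _.
have tri := ler_normD ((1 - t) * (g u - g (U th 0))) (t * (g u' - g (U th 1))).
have t1' : 0 <= 1 - t by lra.
rewrite !normrM (ger0_norm t0) (ger0_norm t1') in tri.
have N0 w : 0 <= N w by rewrite addr_ge0.
have th0 : 0 <= th by lra.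
have H0 : 0 <= th * (L * N (cu - u)) by rewrite !mulr_ge0.
have H1 : 0 <= th * (L * N (cu - u')) by rewrite !mulr_ge0.
have -> : th * C = th * (L * N (cu - (u + t *: d))) + th * (L * N (cu - u)) +
    th * (L * N (cu - u')) by rewrite /C; ring.
set A := `|g u - _| in tri h0; set B := `|g u' - _| in tri h1.
have A0 : 0 <= A by rewrite normr_ge0.
have B0 : 0 <= B by rewrite normr_ge0.
have HA : (1 - t) * A <= A by rewrite ler_piMl //; lra.
have HB : t * B <= B by rewrite ler_piMl.
lra.
Qed.

End ConvexAdditivity.

(** * Additive triples of faces of the plane *)

Section AdditiveSystem.
Variables (R : realType) (q : nat).
Hypothesis q_gt0 : (0 < q)%N.
Local Notation plane := 'rV[R]_2.
Local Notation X := (cX q).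
Local Notation Y := (cY q).
Local Notation fcell := (@fcell R q).
Local Notation lipschitz := (@lipschitz R q).
Implicit Types (x y u v w d : plane) (P Q S : set plane) (g h : plane -> R) (a b : int).

(* A valid additive triple of faces of the plane; the three functions are kept apart because
   exchanging the roles of P, Q and S changes them by signs. *)
Definition additive_system P Q S g h (k : plane -> R) :=
  [/\ forall u v, P u -> Q v -> S (u + v) -> g u + h v = k (u + v),
      forall w, S w -> exists u v, [/\ P u, Q v & w = u + v],
      forall u, P u -> exists2 v, Q v & S (u + v)
    & forall v, Q v -> exists2 u, P u & S (u + v)].

Definition negset P : set plane := [set x | P (- x)].
Definition negfun g : plane -> R := fun x => - g (- x).

Lemma additive_system_swap P Q S g h k :
  additive_system P Q S g h k -> additive_system Q P S h g k.
Proof.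
move=> [add V1 V2 V3]; split.
- by move=> u v Qu Pv Suv; rewrite addrC [u + v]addrC; apply: add; rewrite // addrC.
- by move=> w /V1[u [v [Pu Qv ->]]]; exists v, u; rewrite addrC.
- by move=> u /V3[v Pv Suv]; exists v => //; rewrite addrC.
- by move=> v /V2[u Pu Suv]; exists u => //; rewrite addrC.
Qed.

(** The relation is read as [k (u + v) - h v = g u]. Together with the swap this carries statements
    about the first member over to all three. *)
Lemma additive_system_rotate P Q S g h k :
  additive_system P Q S g h k -> additive_system S (negset Q) P k (negfun h) g.
Proof.
move=> [add V1 V2 V3]; split.
- move=> u v Su; rewrite /negset /negfun /= => Qv Puv.
  have := add _ _ Puv Qv; rewrite addrK => /(_ Su) <-; ring.
- move=> w /V2[v Qv Sv]; exists (w + v), (- v).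
  by rewrite /negset /= opprK addrK.
- move=> u /V1[w [v [Pw Qv ->]]]; exists (- v); first by rewrite /negset /= opprK.
  by rewrite addrK.
- move=> v /V3[u Pu Su]; exists (u - v) => //.
  by rewrite subrK.
Qed.

Definition negkind (k : kind) := match k with Lower => Upper | Upper => Lower | Diag => Diag end.

Lemma negset_fcell (k : kind) a b : negset (fcell k a b) = fcell (negkind k) (- a - 1) (- b - 1).
Proof.
by apply/seteqP; split=> x; rewrite /negset /fcell /= !coordE !(intrD, mulrNz) => -[h1 h2 h3];
  split; [lra|lra|case: k h3 => /= h3; lra|lra|lra|case: k h3 => /= h3; lra].
Qed.

Lemma fcell_convex (k : kind) a b : convex_set (fcell k a b).
Proof.
move=> u v t [/andP[? ?] /andP[? ?] uk] [/andP[? ?] /andP[? ?] vk] /andP[t0 t1].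
have t1' : 0 <= 1 - t by lra.
split; rewrite !coordE; [apply/andP; split; nra|apply/andP; split; nra|].
by case: k uk vk => ? ?; nra.
Qed.

Definition center (k : kind) a b : plane :=
  let e : R := match k with Lower => 1 / 3 | Upper => 2 / 3 | Diag => 1 / 2 end in
  mk q (a%:~R + e) (b%:~R + e).

Lemma center_bounds (k : kind) a b : [/\ a%:~R + 1 / 3 <= X (center k a b) <= a%:~R + 2 / 3,
  b%:~R + 1 / 3 <= Y (center k a b) <= b%:~R + 2 / 3 &
  X (center k a b) + Y (center k a b) = a%:~R + b%:~R +
    match k with Lower => 2 / 3 | Upper => 4 / 3 | Diag => 1 end].
Proof. by rewrite /center cX_mk // cY_mk //; case: k; split; lra. Qed.

Lemma center_fcell (k : kind) a b : fcell k a b (center k a b).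
Proof.
have [h1 h2 h3] := center_bounds k a b; split; [lra|lra|].
by clear h1 h2; case: k h3 => h3; lra.
Qed.

(** Each inequality that bounds the face has slack at least 1/3 at the center, hence 1/36 after the
    pull, whereas [d] changes [X], [Y] and [X + Y] by at most 1/50. *)
Lemma fcell_pull (k : kind) a b u d : fcell k a b u ->
  - (1 / 100%:R) <= X d <= 1 / 100%:R -> - (1 / 100%:R) <= Y d <= 1 / 100%:R ->
  (k = Diag -> X d + Y d = 0) ->
  fcell k a b (u + (1 / 12) *: (center k a b - u) + d).
Proof.
move=> [u1 u2 u3] d1 d2 d3; have [c1 c2 c3] := center_bounds k a b.
have {}d3 : if k is Diag then X d + Y d = 0 else True by case: (k) d3 => // ->.
rewrite /fcell /= !coordE; move: c1 c2 c3 u1 u2 u3 d1 d2 d3.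
set x := X u; set y := Y u; set z := X (center k a b); set w := Y (center k a b).
set dx := X d; set dy := Y d => c1 c2 c3 u1 u2 u3 d1 d2 d3.
split; [clear c2 c3 u2 u3 d2 d3; lra|clear c1 c3 u1 u3 d1 d3; lra|].
by clearbody z w; case: k c3 u3 d3 => c3 u3 d3; clear u1 u2; lra.
Qed.

Lemma fcell_center_dist (k : kind) a b u : fcell k a b u ->
  [/\ - 1 <= X (center k a b) - X u <= 1, - 1 <= Y (center k a b) - Y u <= 1,
      - 1 <= X (center k a b) + Y (center k a b) - (X u + Y u) <= 1 &
      k = Diag -> X (center k a b) + Y (center k a b) = X u + Y u].
Proof.
move=> [u1 u2 u3]; have [c1 c2 c3] := center_bounds k a b.
split; [clear c2 c3 u2 u3; lra|clear c1 c3 u1 u3; lra| |].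
  by move: c1 c2 c3; set z := X _; set w := Y _; clearbody z w;
    case: (k) u3 => u3 c1 c2 c3; lra.
by move=> kD; rewrite c3; case: (k) kD u3 => // _ ->.
Qed.

(* The barycenter of a third triangle S is a sum; shifting the summands slightly towards the
   barycenters of P and Q gives a point that is interior in the direction d. *)
Lemma additive_system_interior k1 k2 k3 a1 b1 a2 b2 a3 b3 g h k d :
  additive_system (fcell k1 a1 b1) (fcell k2 a2 b2) (fcell k3 a3 b3) g h k ->
  (k1 = Diag \/ k2 = Diag -> X d + Y d = 0) ->
  k3 <> Diag \/ [/\ k1 = Diag, k2 = Diag & X d + Y d = 0] ->
  exists cu cv (r : R), 0 < r /\ forall s t, `|s| <= r -> `|t| <= r ->
     [/\ fcell k1 a1 b1 (cu + s *: d), fcell k2 a2 b2 (cv + t *: d)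
       & fcell k3 a3 b3 (cu + cv + (s + t) *: d)].
Proof.
move=> [_ V1 _ _] diag_d k3D.
have [u [v [Pu Qv uvE]]] := V1 _ (center_fcell k3 a3 b3).
have C3 := center_bounds k3 a3 b3; rewrite uvE in C3.
pose c1 := center k1 a1 b1; pose c2 := center k2 a2 b2.
pose M := 1 + `|X d| + `|Y d|.
have M1 : 1 <= M by rewrite /M -addrA lerDl addr_ge0.
have r0 : 0 < (100%:R * M)^-1 by rewrite invr_gt0 mulr_gt0 //; lra.
(* The two pulls move each of [X], [Y], [X + Y] of the sum by at most 1/6 and the two steps along
   [d] by at most 1/25, which stays below the slack 1/3 at the center of the third face. *)
exists (u + (1 / 12) *: (c1 - u)), (v + (1 / 12) *: (c2 - v)), (100%:R * M)^-1.
split=> // s t hs ht.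
have small (c z : R) : `|c| <= (100%:R * M)^-1 -> `|z| <= M ->
    - (1 / 100%:R) <= c * z <= 1 / 100%:R.
  move=> hc hz; rewrite -ler_norml normrM; apply: le_trans (ler_pM _ _ hc hz) _ => //.
  by rewrite invfM -mulrA mulVf ?mulr1 ?div1r // gt_eqF //; lra.
have XM : `|X d| <= M by rewrite /M; have := normr_ge0 (Y d); lra.
have YM : `|Y d| <= M by rewrite /M; have := normr_ge0 (X d); lra.
have [sX sY] := (small _ _ hs XM, small _ _ hs YM).
have [tX tY] := (small _ _ ht XM, small _ _ ht YM).
have lev0 (z : R) : X d + Y d = 0 -> z * X d + z * Y d = 0.
  by move=> dz; rewrite -mulrDr dz mulr0.
split.
- by apply: fcell_pull; rewrite ?(cXZ q s, cYZ q s) // => k1D; apply/lev0/diag_d; left.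
- by apply: fcell_pull; rewrite ?(cXZ q t, cYZ q t) // => k2D; apply/lev0/diag_d; right.
have [p1 p2 p3 p4] := fcell_center_dist Pu; have [q1 q2 q3 q4] := fcell_center_dist Qv.
have levST : k3 = Diag -> s * X d + s * Y d = 0 /\ t * X d + t * Y d = 0.
  by case: k3D => [//|[_ _ d0] _]; split; apply: lev0.
have {}k3D : k3 = Diag -> k1 = Diag /\ k2 = Diag by case: k3D => [//|[]].
have pD : k3 = Diag -> X c1 + Y c1 = X u + Y u by move=> /k3D[/p4].
have qD : k3 = Diag -> X c2 + Y c2 = X v + Y v by move=> /k3D[_ /q4].
clear p4 q4 k3D diag_d hs ht XM YM lev0 small M1 r0.
move: C3 p1 p2 p3 q1 q2 q3 sX sY tX tY levST pD qD.
rewrite /fcell /= !coordE !mulrDl -/c1 -/c2.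
set sx := s * X d; set sy := s * Y d; set tx := t * X d; set ty := t * Y d.
set x1 := X u; set y1 := Y u; set x2 := X v; set y2 := Y v.
set z1 := X c1; set w1 := Y c1; set z2 := X c2; set w2 := Y c2.
move=> [C1 C2 C3] p1 p2 p3 q1 q2 q3 sX sY tX tY levST pD qD.
split; [clear C2 C3 p2 p3 q2 q3 sY tY levST pD qD; lra
       |clear C1 C3 p1 p3 q1 q3 sX tX levST pD qD; lra|].
clear C1 C2 p1 p2 q1 q2; case: k3 C3 {V1 uvE} levST pD qD => C3 levST pD qD.
- by clear levST pD qD; lra.
- by clear levST pD qD; lra.
- have [l1 l2] := levST erefl; have e1 := pD erefl; have e2 := qD erefl.
  by clear levST pD qD; lra.
Qed.

(** A summand that is a diagonal edge leaves room for steps only along that edge, whence the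
    condition that [u] and [u'] have the same level. *)
Lemma additive_system_affine k1 k2 k3 a1 b1 a2 b2 a3 b3 g h k u u' :
  additive_system (fcell k1 a1 b1) (fcell k2 a2 b2) (fcell k3 a3 b3) g h k ->
  lipschitz g -> fcell k1 a1 b1 u -> fcell k1 a1 b1 u' ->
  (k1 = Diag \/ k2 = Diag -> X u + Y u = X u' + Y u') ->
  k3 <> Diag \/ [/\ k1 = Diag, k2 = Diag & X u + Y u = X u' + Y u'] ->
  forall t, 0 <= t <= 1 -> g (u + t *: (u' - u)) = (1 - t) * g u + t * g u'.
Proof.
move=> sys gL Pu Pu' lev k3D t t01; have [add _ V2 _] := sys.
have lev0 : X u + Y u = X u' + Y u' -> X (u' - u) + Y (u' - u) = 0.
  by rewrite !coordE => E; lra.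
have [||cu [cv [r [r0 int]]]] := additive_system_interior (d := u' - u) sys.
- by move=> /lev /lev0.
- by case: k3D => [?|[? ? /lev0 ?]]; [left|right].
have [v Qv Suv] := V2 u Pu; have [v' Qv' Suv'] := V2 u' Pu'.
apply: (additive_affine _ _ _ add gL r0 int Pu Qv Suv Pu' Qv' Suv') => //;
  try exact: fcell_convex.
by rewrite addrC subrK.
Qed.

(** [g] vanishes at the vertices and is affine on segments. A diagonal edge is one such segment; a
    triangle is swept by segments from a corner to the opposite edge. *)
Lemma additive_system_zero k1 k2 k3 a1 b1 a2 b2 a3 b3 g h k :
  additive_system (fcell k1 a1 b1) (fcell k2 a2 b2) (fcell k3 a3 b3) g h k ->
  [/\ k1 <> Diag, k2 <> Diag & k3 <> Diag] \/ k1 = Diag /\ (k2 = Diag \/ k3 <> Diag) ->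
  lipschitz g -> (forall x, x \in grid R q -> g x = 0) ->
  forall u, fcell k1 a1 b1 u -> g u = 0.
Proof.
move=> sys types gL g0 u Pu.
have gmk (a b : int) : g (mk q a%:~R b%:~R) = 0 by apply: g0; exact: mk_grid.
case: types => [[k1D k2D k3D]|[k1D k23]].
  have aff := additive_system_affine sys gL.
  have aff0 w w' t : fcell k1 a1 b1 w -> fcell k1 a1 b1 w' -> 0 <= t <= 1 ->
      g w = 0 -> g w' = 0 -> g (w + t *: (w' - w)) = 0.
    move=> Pw Pw' t01 gw gw'; rewrite aff //; last by left.
      by rewrite gw gw' !mulr0 addr0.
    by case.
  (* (c, c') is the corner at which the two axis-parallel edges meet; they point in direction e. *)
  have [e [c [c' [cell_ge EE]]]] : exists e (c c' : int), [/\
      forall w, fcell k1 a1 b1 w <-> [/\ 0 <= e%:~R * (X w - c%:~R),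
         0 <= e%:~R * (Y w - c'%:~R) & e%:~R * (X w - c%:~R) + e%:~R * (Y w - c'%:~R) <= 1]
      & e%:~R * e%:~R = 1 :> R].
    case: k1 k1D {sys Pu aff aff0} => // _.
      exists 1, a1, b1; split; rewrite ?mul1r // => w.
      by split=> -[*]; split; lra.
    exists (-1), (a1 + 1), (b1 + 1); split; rewrite ?mulrNz ?mulrNN ?mul1r // => w.
    by rewrite !intrD; split=> -[*]; split; lra.
  set E : R := e%:~R in cell_ge EE.
  have EV (z : R) : E * (E * z) = z by rewrite mulrA EE mul1r.
  have /cell_ge[s0 t0 st1] := Pu.
  set s := E * _ in s0 st1; set t := E * _ in t0 st1.
  pose pt' (s t : R) : plane := mk q (c%:~R + E * s) (c'%:~R + E * t).
  have uE : u = pt' s t.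
    by apply: (plane_eq q_gt0); rewrite ?cX_mk ?cY_mk // EV addrC subrK.
  have Ppt (x y : R) : 0 <= x -> 0 <= y -> x + y <= 1 -> fcell k1 a1 b1 (pt' x y).
    by move=> *; apply/cell_ge; rewrite cX_mk // cY_mk // !(addrAC _ _ (- _)) !subrr !add0r !EV.
  have gpt (m m' : int) : g (pt' m%:~R m'%:~R) = 0.
    by rewrite /pt' /E -!intrM -!intrD gmk.
  have line (x y x' y' z : R) : pt' x y + z *: (pt' x' y' - pt' x y) =
      pt' (x + z * (x' - x)) (y + z * (y' - y)).
    by apply: (plane_eq q_gt0); rewrite !coordE ?cX_mk ?cY_mk //; ring.
  have hyp z : 0 <= z <= 1 -> g (pt' (1 - z) z) = 0.
    move=> z01.
    have -> : pt' (1 - z) z = pt' 1 0 + z *: (pt' 0 1 - pt' 1 0).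
      by rewrite line; congr (pt' _ _); ring.
    by apply: aff0 => //; [apply: Ppt; lra|apply: Ppt; lra|exact: (gpt 1 0)|exact: (gpt 0 1)].
  have [st0|st0] := eqVneq (s + t) 0.
    have [s00 t00] : s = 0 /\ t = 0 by split; lra.
    by rewrite uE s00 t00; exact: (gpt 0 0).
  have stp : 0 < s + t by rewrite lt_neqAle eq_sym st0 addr_ge0.
  (* Parameter of the projection of [u] from the corner onto the opposite edge. *)
  pose z := t / (s + t).
  have z01 : 0 <= z <= 1 by rewrite divr_ge0 ?ler_pdivrMr // ?mul1r; lra.
  have zst : z * (s + t) = t by rewrite divfK.
  have -> : u = pt' 0 0 + (s + t) *: (pt' (1 - z) z - pt' 0 0).
    rewrite uE line; congr (pt' _ _); last by rewrite subr0 mulrC zst add0r.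
    by rewrite subr0 mulrBr mulr1 [_ * z]mulrC zst; ring.
  apply: aff0; rewrite ?hyp //; try (apply: Ppt; lra); first by rewrite (ltW stp).
  exact: (gpt 0 0).
have [P1 P2 P3] := Pu; rewrite k1D in P3.
pose p : plane := mk q a1%:~R (b1 + 1)%:~R; pose p' : plane := mk q (a1 + 1)%:~R b1%:~R.
have Pp : fcell k1 a1 b1 p by rewrite k1D; split; rewrite ?cX_mk ?cY_mk // ?intrD; lra.
have Pp' : fcell k1 a1 b1 p' by rewrite k1D; split; rewrite ?cX_mk ?cY_mk // ?intrD; lra.
have lev : X p + Y p = X p' + Y p' by rewrite ?cX_mk ?cY_mk // ?intrD; lra.
have -> : u = p + (X u - a1%:~R) *: (p' - p).
  by apply: (plane_eq q_gt0); rewrite !coordE ?cX_mk ?cY_mk // ?intrD; lra.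
rewrite (additive_system_affine sys gL Pp Pp') //; first by rewrite !gmk; ring.
- by case: k23 => [k2D|?]; [right|left].
- by lra.
Qed.

(* On a line of given level, the points v of Q and those with w - v or w' - v in the unit segment P
   form three intervals; they pairwise intersect, so that some v is common to w and w'. *)
Lemma additive_system_level k2 k3 a1 b1 a2 b2 a3 b3 g h k w w' :
  additive_system (fcell Diag a1 b1) (fcell k2 a2 b2) (fcell k3 a3 b3) g h k ->
  (forall u, fcell Diag a1 b1 u -> g u = 0) ->
  fcell k3 a3 b3 w -> fcell k3 a3 b3 w' -> X w + Y w = X w' + Y w' -> k w = k w'.
Proof.
move=> sys gP; wlog le : w w' / X w <= X w'.
  move=> H Sw Sw' lev; have [le|lt] := leP (X w) (X w'); first exact: H.
  by apply/esym; apply: H => //; exact: ltW.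
move=> Sw Sw' lev; have [add V1 _ _] := sys.
have common v : fcell k2 a2 b2 v -> fcell Diag a1 b1 (w - v) ->
    fcell Diag a1 b1 (w' - v) -> k w = k w'.
  move=> Qv Pw Pw'; have := add _ _ Pw Qv; have := add _ _ Pw' Qv.
  by rewrite !subrK gP // gP // => <- // <-.
have [u [v [Pu Qv wE]]] := V1 _ Sw; have [u' [v' [Pu' Qv' w'E]]] := V1 _ Sw'.
have box : X w' <= X w + 1.
  by case: Sw Sw' => /andP[? ?] _ _ [/andP[? ?] _ _]; lra.
have vE : v = w - u by rewrite wE addrC addKr.
have v'E : v' = w' - u' by rewrite w'E addrC addKr.
have [u1 u2 u3] := Pu; have [u1' u2' u3'] := Pu'.
have levv : X v + Y v = X v' + Y v' by rewrite vE v'E !coordE; lra.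
have Xv : X v = X w - X u by rewrite vE !coordE.
have Xv' : X v' = X w' - X u' by rewrite v'E !coordE.
have in_P z z' : X z + Y z = X v + Y v -> X z' + Y z' = X w + Y w ->
    a1%:~R <= X z' - X z <= a1%:~R + 1 -> fcell Diag a1 b1 (z' - z).
  move=> ez ez' hz; have Yv : Y v = Y w - Y u by rewrite vE !coordE.
  by split; rewrite !coordE; lra.
have [h1|h1] := leP (X w' - a1%:~R - 1) (X v).
  by apply: (common v) => //; apply: in_P => //; lra.
have [h2|h2] := leP (X v') (X w - a1%:~R).
  by apply: (common v') => //; apply: in_P => //; lra.
have d0 : 0 < X v' - X v by lra.
(* Neither [v] nor [v'] is common. This is the point between them for which [w'] minus it is the end
   of the edge with the larger [X]. *)
pose t := (X w' - a1%:~R - 1 - X v) / (X v' - X v).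
have t01 : 0 <= t <= 1 by rewrite divr_ge0 ?ler_pdivrMr // ?mul1r; lra.
have tE : t * (X v' - X v) = X w' - a1%:~R - 1 - X v by rewrite divfK // gt_eqF.
have tE' : t * (Y v' - Y v) = - (t * (X v' - X v)).
  have -> : Y v' - Y v = - (X v' - X v) by lra.
  exact: mulrN.
pose z := (1 - t) *: v + t *: v'.
have Xz : X z = X w' - a1%:~R - 1 by rewrite /z !coordE; lra.
have Yz : Y z = Y v - t * (X v' - X v) by rewrite /z !coordE; lra.
by apply: (common z); [exact: fcell_convex|apply: in_P; lra|apply: in_P; lra].
Qed.

End AdditiveSystem.

(** * From additive pairs of points to triples of faces of the torus *)

Section CellTriples.
Variables (R : realType) (q : nat) (pi : 'rV[R]_2 -> R).
Hypothesis q_gt2 : (2 < q)%N.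
Let q_gt0 : (0 < q)%N. Proof. exact: leq_trans q_gt2. Qed.
Local Notation plane := 'rV[R]_2.
Local Notation X := (cX q).
Local Notation Y := (cY q).
Local Notation fcell := (@fcell R q).
Implicit Types (x y z u v w : plane) (I J K P Q S : set plane) (a b : int).
Hypothesis pi_per : forall x z, z \in Z2 R -> pi (x + z) = pi x.
Hypothesis pi_sub : forall x y, pi (x + y) <= pi x + pi y.
Hypothesis pi_aff : triangle_aff q pi.

Lemma periodic_mod1 x : pi (mod1 x) = pi x.
Proof.
by rewrite -(pi_per x (z := - (x - mod1 x))) ?rpredN ?mod1_Z2 // opprB addrC subrK.
Qed.

Lemma between_lt (s t : R) : between s t -> s - 1 < t < s + 1.
Proof.
rewrite /between; case: floor_ceilP => m; first by move=> ->; lra.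
by rewrite intrD; lra.
Qed.

(** The defect of [pi] is nonnegative and is affine on a segment that starts at [(u, v)] and has
    [(x, y)] in its interior; a zero there makes it vanish throughout. *)
Lemma cell_additive x y u v : pi x + pi y = pi (x + y) ->
  cell q x u -> cell q y v -> cell q (x + y) (u + v) -> pi u + pi v = pi (u + v).
Proof.
move=> E ux vy uv.
have [[<- <-] //|[r [r0 xr yr xyr _]]] := cell_push q_gt0 ux vy uv.
have := push_defect pi_aff r0 ux vy uv xr yr xyr.
rewrite E subrr mulr0; have := pi_sub (push r x u) (push r y v); have := pi_sub u v.
move=> h1 h2 h3; apply/eqP; rewrite eq_le pi_sub andbT; nra.
Qed.

(** The three conditions of validity are instances of [cell_sum], the first one for the sum of
    [x + y] and [- y]. *)
Lemma cells_additive x y : pi x + pi y = pi (x + y) ->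
  additive_triple q pi (@mod1 R @` cell q x) (@mod1 R @` cell q y)
    (@mod1 R @` cell q (x + y)).
Proof.
move=> E.
have cplx w : torus_complex q (@mod1 R @` cell q w).
  have [k [k3 wk]] := cell_face q_gt0 w.
  have : torus_faces q k (@mod1 R @` cell q w) by exists (cell q w).
  by move: k k3 {wk} => [|[|[|]]] // _ h; [left; left|left; right|right].
split=> //; first split.
- move=> _ [w wxy <-]; have wx := cell_sum q_gt0 (- y) wxy.
  have [v' v'y] := wx; rewrite addrK => wv'.
  exists (mod1 (w + v')); first by exists (w + v').
  exists (mod1 (- v')); last by rewrite oplus_mod1 addrK.
  by exists (- v') => //; rewrite -[y]opprK; apply: cellN.
- move=> _ [u ux <-]; have [v vy uv] := cell_sum q_gt0 y ux.
  by exists (mod1 v); [exists v|rewrite oplus_mod1; exists (u + v)].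
- move=> _ [v vy <-]; have [u ux uv] := cell_sum q_gt0 x vy.
  exists (mod1 u); first by exists u.
  by rewrite oplus_mod1; exists (u + v) => //; rewrite [x + y]addrC [u + v]addrC.
- move=> _ _ [[/= u ux <-] [v vy <-]]; rewrite oplus_mod1 => -[w wxy wE].
  rewrite !periodic_mod1.
  (* The two points agree modulo Z^2; since [u], [v], [w] are each less than 1 away from [x], [y],
     [x + y] in both coordinates, they coincide. *)
  have uvw : u + v = w.
    apply/eqP; rewrite -subr_eq0; apply/eqP; apply: (Z2_small q_gt0 q_gt2).
    - by apply/mod1_eqP.
    - case: ux vy wxy => /between_lt h1 _ _ [/between_lt h2 _ _] [/between_lt h3 _ _].
      by rewrite cXD in h3; rewrite !coordE ltr_norml; lra.
    - case: ux vy wxy => _ /between_lt h1 _ [_ /between_lt h2 _] [_ /between_lt h3 _].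
      by rewrite cYD in h3; rewrite !coordE ltr_norml; lra.
  by apply: (@cell_additive x y) => //; rewrite uvw.
Qed.

Lemma shift_point a b z : z \in Z2 R -> exists a' b' : int,
  mk q a%:~R b%:~R + z = mk q a'%:~R b'%:~R.
Proof.
move=> /(Z2P q_gt0)[c [d ->]]; exists (a + q%:Z * c), (b + q%:Z * d).
by apply: (plane_eq q_gt0); rewrite !coordE ?cX_mk ?cY_mk // intrD.
Qed.

(** Among the lifts of [I], which differ by translations in Z^2, the one through [x] itself rather
    than through [mod1 x] is needed. *)
Lemma lift_face I x :
  (torus_faces q 0 `|` torus_diag q `|` torus_faces q 2) I -> I (mod1 x) ->
  exists P, [/\ I = @mod1 R @` P, P x & (P = [set x] /\ x \in grid R q) \/
    exists k a b, P = fcell k a b].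
Proof.
have shift P : (exists k a b, P = fcell k a b) -> (@mod1 R @` P) (mod1 x) ->
    exists P', [/\ @mod1 R @` P = @mod1 R @` P', P' x & exists k a b, P' = fcell k a b].
  move=> [k [a [b ->]]] [x' Px' /mod1_eqP xx'].
  have xE : x = x' - (x' - x) by rewrite opprB addrC subrK.
  have [c [d zE]] := Z2P q_gt0 xx'.
  exists (fcell k (a - q%:Z * c) (b - q%:Z * d)).
  have iff w : fcell k (a - q%:Z * c) (b - q%:Z * d) (w - (x' - x)) <-> fcell k a b w.
    rewrite zE.
    have [XE YE] := (cXD q w (- mk q (q%:Z * c)%:~R (q%:Z * d)%:~R),
      cYD q w (- mk q (q%:Z * c)%:~R (q%:Z * d)%:~R)).
    rewrite cXN cX_mk // in XE; rewrite cYN cY_mk // in YE.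
    rewrite /fcell /= XE YE !intrB.
    by split=> -[h1 h2 h3]; clear - h1 h2 h3; split; try lra; case: k h3 => h3; lra.
  split; last by exists k, (a - q%:Z * c), (b - q%:Z * d).
    apply/seteqP; split=> _ [w Pw <-].
      exists (w - (x' - x)); first by apply/iff.
      by rewrite mod1_addZ2 // rpredN.
    exists (w + (x' - x)); first by apply/iff; rewrite addrK.
    by rewrite mod1_addZ2.
  by rewrite {1}xE; apply/iff.
case=> [[|]|].
- move=> [_ /(plane_faces0 q_gt0)[a [b ->]] <-] [x' -> xx'].
  exists [set x]; split=> //.
    apply/seteqP; split=> _ [w -> <-]; first by exists x.
    by exists (mk q a%:~R b%:~R).
  left; split=> //; move/esym/mod1_eqP: xx' => /(shift_point a b)[a' [b' E]].
  by rewrite (_ : x = mk q a'%:~R b'%:~R) ?mk_grid // -E addrC subrK.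
- move=> [P /(plane_diag_fcell q_gt0)[a [b PE]] <-] Px.
  have [|P' [E P'x kE]] := shift P _ Px; first by exists Diag, a, b.
  by exists P'; split=> //; right.
- move=> [P /(plane_faces2 q_gt0)[k [a [b [_ PE]]]] <-] Px.
  have [|P' [E P'x kE]] := shift P _ Px; first by exists k, a, b.
  by exists P'; split=> //; right.
Qed.

End CellTriples.

(** * Sampling *)

Section Sampling.
Variables (R : realType) (q : nat).
Local Notation plane := 'rV[R]_2.
Local Notation X := (cX q).
Local Notation Y := (cY q).
Local Notation fcell := (@fcell R q).
Implicit Types (x y z u v w : plane) (I J K P Q S : set plane) (a b : int).

(* A map that carries every additivity relation available under the diagonal constraint to another
   one: it preserves faces, the symmetries of the complex, and the levels X + Y. *)
Definition sampling (N : nat) (Phi : plane -> plane) :=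
  [/\ forall x, x \in grid R N -> cell q x (Phi x),
      forall x t, x \in grid R N -> t \in grid R q -> Phi (x + t) = Phi x + t,
      forall x, x \in grid R N -> Phi (- x) = - Phi x
    & forall x y, x \in grid R N -> y \in grid R N ->
        X x + Y x = X y + Y y -> X (Phi x) + Y (Phi x) = X (Phi y) + Y (Phi y)].

Variables (pi pb : plane -> R) (N : nat) (Phi : plane -> plane).
Hypothesis q_gt2 : (2 < q)%N.
Let q_gt0 : (0 < q)%N. Proof. exact: leq_trans q_gt2. Qed.
Hypothesis pi_per : forall x z, z \in Z2 R -> pi (x + z) = pi x.
Hypothesis pi_sub : forall x y, pi (x + y) <= pi x + pi y.
Hypothesis pi_aff : triangle_aff q pi.
Hypothesis pi_diag : diagonally_constrained q pi.
Hypothesis pb_add : forall x y, pi x + pi y = pi (x + y) -> pb x + pb y = pb (x + y).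
Hypothesis pb_lip : lipschitz q pb.
Hypothesis pb0 : forall x, x \in grid R q -> pb x = 0.
Hypothesis sPhi : sampling N Phi.
Hypothesis gridN : {subset grid R q <= grid R N}.

Lemma sampling_grid x : x \in grid R q -> Phi x = x.
Proof.
move=> xq; case: sPhi => /(_ x (gridN xq)) + _ _ _.
by rewrite cell_grid.
Qed.

Lemma sampling_level (a : int) x y : x \in grid R N -> y \in grid R N ->
  X y + Y y = X x + Y x + a%:~R -> X (Phi y) + Y (Phi y) = X (Phi x) + Y (Phi x) + a%:~R.
Proof.
move=> xN yN E; case: sPhi => _ tr _ lev.
have tq : mk q a%:~R 0 \in grid R q by have := mk_grid R q_gt0 a 0.
rewrite (lev y (x + mk q a%:~R 0)) ?rpredD // ?gridN //; last first.
  by rewrite !coordE cX_mk // cY_mk // E; ring.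
by rewrite tr // !coordE cX_mk // cY_mk //; ring.
Qed.

(** [pb] vanishes on the edge. With a point [u] of the edge such that [u + Phi y] lies in the third
    face, [pb (Phi y)] equals [pb (u + Phi y)], and this point has the level of [Phi (x + y)]. *)
Lemma sampling_system_diag k2 k3 a1 b1 a2 b2 a3 b3 x y :
  additive_system (fcell Diag a1 b1) (fcell k2 a2 b2) (fcell k3 a3 b3) pb pb pb ->
  k3 <> Diag ->
  fcell Diag a1 b1 x -> fcell k2 a2 b2 y -> fcell k3 a3 b3 (x + y) ->
  x \in grid R N -> y \in grid R N ->
  pb (Phi x) + pb (Phi y) = pb (Phi (x + y)).
Proof.
move=> sys k3D Px Qy Sxy xN yN; have xyN : x + y \in grid R N by rewrite rpredD.
have [cPhi _ _ _] := sPhi; have [add _ _ V3] := sys.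
have zero := additive_system_zero q_gt0 sys (or_intror (conj erefl (or_intror k3D)))
  pb_lip pb0.
have P'x := cell_fcell Px (cPhi x xN); have Q'y := cell_fcell Qy (cPhi y yN).
have S'xy := cell_fcell Sxy (cPhi _ xyN).
have [u Pu Su] := V3 _ Q'y.
rewrite (zero _ P'x) -(zero u Pu) (add _ _ Pu Q'y Su).
apply: (additive_system_level sys zero Su S'xy).
rewrite (@sampling_level (a1 + b1 + 1) y) //.
  by case: Pu => _ _; rewrite !coordE !intrD; lra.
by case: Px => _ _; rewrite !coordE !intrD; lra.
Qed.

(** This excludes two diagonal edges together with one triangle: the barycenter of the triangle
    would be a sum or a difference of points of integral level. *)
Lemma center_level k a b : k <> Diag -> forall m : int,
  X (center R q k a b) + Y (center R q k a b) <> m%:~R.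
Proof.
move=> kD m; have [_ _ ->] := center_bounds R q_gt0 k a b => E.
have int_neq (c : int) (e : R) : 0 < e < 1 -> c%:~R <> e.
  move=> /andP[e0 e1] cE; move: e0 e1; rewrite -cE -[0]/(0%:~R) -[1]/(1%:~R) !ltr_int.
  lia.
case: k kD E => // _ E.
  by apply: (@int_neq (m - a - b) (2 / 3)); [lra|rewrite !intrB; lra].
by apply: (@int_neq (m - a - b - 1) (1 / 3)); [lra|rewrite !intrB; lra].
Qed.

Lemma sampling_system k1 k2 k3 a1 b1 a2 b2 a3 b3 x y :
  additive_system (fcell k1 a1 b1) (fcell k2 a2 b2) (fcell k3 a3 b3) pb pb pb ->
  fcell k1 a1 b1 x -> fcell k2 a2 b2 y -> fcell k3 a3 b3 (x + y) ->
  x \in grid R N -> y \in grid R N ->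
  pb (Phi x) + pb (Phi y) = pb (Phi (x + y)).
Proof.
move=> sys Px Qy Sxy xN yN; have xyN : x + y \in grid R N by rewrite rpredD.
have [cPhi _ neg _] := sPhi.
have P'x := cell_fcell Px (cPhi x xN); have Q'y := cell_fcell Qy (cPhi y yN).
have S'xy := cell_fcell Sxy (cPhi _ xyN).
have sys12 := additive_system_swap sys.
have sys3 := additive_system_rotate sys; rewrite negset_fcell in sys3.
have dec k : k = Diag \/ k <> Diag by case: k; [right|right|left].
have negD : k2 <> Diag -> negkind k2 <> Diag by case: (k2).
have [add V1 V2 V3] := sys.
have C1 := center_fcell R q_gt0 k1 a1 b1; have C2 := center_fcell R q_gt0 k2 a2 b2.
have C3 := center_fcell R q_gt0 k3 a3 b3.
have [D1|D1] := dec k1; have [D2|D2] := dec k2; have [D3|D3] := dec k3.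
- rewrite (additive_system_zero q_gt0 sys _ pb_lip pb0 P'x); last by right; auto.
  rewrite (additive_system_zero q_gt0 sys12 _ pb_lip pb0 Q'y); last by right; auto.
  rewrite (additive_system_zero q_gt0 sys3 _ pb_lip pb0 S'xy) ?addr0 //.
  by right; rewrite D2; auto.
- have [u [v [Pu Qv E]]] := V1 _ C3; subst k1 k2.
  case: (@center_level k3 a3 b3 D3 (a1 + b1 + 1 + (a2 + b2 + 1))).
  by case: Pu Qv => _ _ h [_ _ h']; rewrite E !coordE !intrD; lra.
- have [u Pu Su] := V3 _ C2; subst k1 k3.
  case: (@center_level k2 a2 b2 D2 (a3 + b3 + 1 - (a1 + b1 + 1))).
  by case: Pu Su => _ _ h [_ _]; rewrite !coordE !(intrB, intrD); lra.
- by subst k1; exact: (sampling_system_diag sys).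
- have [v Qv Sv] := V2 _ C1; subst k2 k3.
  case: (@center_level k1 a1 b1 D1 (a3 + b3 + 1 - (a2 + b2 + 1))).
  by case: Qv Sv => _ _ h [_ _]; rewrite !coordE !(intrB, intrD); lra.
- subst k2; rewrite addrC [x + y]addrC.
  by apply: (sampling_system_diag sys12) => //; rewrite addrC.
(* The edge is the sum. Rotation changes [pb] to [negfun pb] in one place, so [sampling_system_diag]
   does not apply; the rotated system still shows that [pb] on the first face depends on the level
   only. *)
- have zero : forall w, fcell k3 a3 b3 w -> pb w = 0.
    apply: (additive_system_zero q_gt0 sys3) => //; right; auto.
  have [u Pu Su] := V3 _ Q'y.
  rewrite (zero _ S'xy) -(zero _ Su) -(add _ _ Pu Q'y Su); congr (_ + _).
  rewrite D3 in sys3 zero Sxy Su.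
  apply: (additive_system_level sys3 zero P'x Pu).
  rewrite (@sampling_level (a3 + b3 + 1) (- y)) ?rpredN //.
    by case: Su => _ _; rewrite neg // !coordE !intrD; lra.
  by case: Sxy => _ _; rewrite !coordE !intrD; lra.
- rewrite (additive_system_zero q_gt0 sys _ pb_lip pb0 P'x); last by left.
  rewrite (additive_system_zero q_gt0 sys12 _ pb_lip pb0 Q'y); last by left.
  rewrite (additive_system_zero q_gt0 sys3 _ pb_lip pb0 S'xy) ?addr0 //.
  by left; split=> //; exact: negD.
Qed.

Lemma near_int (m p : int) (z : R) : m%:~R + 1 / 3 <= z <= m%:~R + 2 / 3 ->
  p%:~R <= z <= p%:~R + 2 -> p%:~R <= (m%:~R : R) /\ (m%:~R : R) <= p%:~R + 1.
Proof.
move=> h1 h2; have h3 : (p < m + 1)%R by rewrite -(ltr_int R) intrD; lra.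
have h4 : (m < p + 2)%R by rewrite -(ltr_int R) intrD; lra.
by rewrite -(intrD _ p 1) !ler_int; clear - h3 h4; lia.
Qed.

Lemma sampling_additive x y : x \in grid R N -> y \in grid R N ->
  pi x + pi y = pi (x + y) -> pb (Phi x) + pb (Phi y) = pb (Phi (x + y)).
Proof.
move=> xN yN E; have xyN : x + y \in grid R N by rewrite rpredD.
have [cPhi tr neg _] := sPhi.
have [I [J [K [mx II JJ KK]]]] :=
  ex_max_additive_triple q_gt0 (cells_additive q_gt2 pi_per pi_sub pi_aff E).
have [DI DJ DK] := pi_diag mx; have [[_ _ _ [V1 V2 V3] add] _] := mx.
have mem w (A : set plane) : @mod1 R @` cell q w `<=` A -> A (mod1 w).
  by apply; exists w => //; exact: cell_refl.
have memPhi w (A : set plane) : w \in grid R N ->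
    @mod1 R @` cell q w `<=` A -> A (mod1 (Phi w)).
  by move=> wN; apply; exists (Phi w) => //; exact: cPhi.
have [P [IE Px tP]] := lift_face q_gt2 DI (mem _ _ II).
have [Q [JE Qy tQ]] := lift_face q_gt2 DJ (mem _ _ JJ).
have [S [KE Sxy tS]] := lift_face q_gt2 DK (mem _ _ KK).
have pim := periodic_mod1 pi_per.
have addm u v : I (mod1 u) -> J (mod1 v) -> K (mod1 (u + v)) -> pb u + pb v = pb (u + v).
  move=> Iu Jv Kuv; apply: pb_add; have := add (mod1 u) (mod1 v).
  by rewrite oplus_mod1 !pim; apply; split=> //=; rewrite oplus_mod1.
case: tP => [[PE xq]|[k1 [a1 [b1 PE]]]].
  have [u] := V3 _ (memPhi y J yN JJ); rewrite IE PE => -[_ -> <-].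
  rewrite oplus_mod1 => Kxy; rewrite addrC [x + y]addrC tr // (sampling_grid xq).
  rewrite addrC [Phi y + x]addrC.
  by apply: addm => //; [rewrite IE PE; exists x|exact: memPhi].
case: tQ => [[QE yq]|[k2 [a2 [b2 QE]]]].
  have [v] := V2 _ (memPhi x I xN II); rewrite JE QE => -[_ -> <-].
  rewrite oplus_mod1 => Kxy; rewrite tr // (sampling_grid yq).
  by apply: addm => //; [exact: memPhi|rewrite JE QE; exists y].
case: tS => [[SE xyq]|[k3 [a3 [b3 SE]]]].
  have [v0] := V2 _ (memPhi x I xN II); rewrite JE => -[v Qv <-].
  rewrite oplus_mod1 => Kv; have := Kv; rewrite KE SE => -[w -> /mod1_eqP Z].
  (* As [x + y] is a vertex, [Phi y] is the reflection [x + y - Phi x]; it differs from [v] by a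
     vector of Z^2. *)
  have yE : Phi y = v + (x + y - (Phi x + v)).
    have -> : Phi y = Phi (- x + (x + y)) by rewrite addKr.
    rewrite tr ?rpredN // neg //.
    by rewrite opprD [RHS]addrCA [v + (_ - v)]addrCA subrr addr0 addrC.
  rewrite (sampling_grid xyq) (_ : x + y = Phi x + Phi y); last first.
    by rewrite yE addrA addrC subrK.
  apply: addm; first exact: memPhi.
    by rewrite yE (mod1_addZ2 _ Z) JE; exists v.
  by rewrite yE addrA (mod1_addZ2 _ Z).
rewrite PE in Px IE; rewrite QE in Qy JE; rewrite SE in Sxy KE.
apply: (sampling_system _ Px Qy Sxy xN yN).
have box k a b w : fcell k a b w -> [/\ a%:~R <= X w <= a%:~R + 1 & b%:~R <= Y w <= b%:~R + 1].
  by case.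
have [x1 x2] := box _ _ _ _ Px; have [y1 y2] := box _ _ _ _ Qy.
have [xy1 xy2] := box _ _ _ _ Sxy.
(* For an arbitrary [w] of the third face, comparison with [x], [y] and [x + y] bounds the offset
   [u + v - w] only by 3, which is not strict; for the barycenter the bound is 8/3. This locates the
   third face relative to the other two, and then 2 is a bound for every [w]. *)
pose c := center R q k3 a3 b3.
have [c1 c2 _] := center_bounds R q_gt0 k3 a3 b3.
have small_eq u v w : u + v - w \in Z2 R -> `|X (u + v - w)| < 3%:R ->
    `|Y (u + v - w)| < 3%:R -> u + v = w.
  by move=> Z h1 h2; apply/eqP; rewrite -subr_eq0; apply/eqP/(Z2_small q_gt0 q_gt2).
have [u0 [v0 [Pu0 Qv0 cE]]] : exists u v, [/\ fcell k1 a1 b1 u, fcell k2 a2 b2 v & c = u + v].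
  have : K (mod1 c) by rewrite KE; exists c => //; exact: center_fcell.
  move=> /V1[u1']; rewrite IE => -[u Pu <-] [v1']; rewrite JE => -[v Qv <-].
  rewrite oplus_mod1 => /mod1_eqP Z; exists u, v; split=> //.
  have [u1 u2] := box _ _ _ _ Pu; have [v1 v2] := box _ _ _ _ Qv.
  rewrite -/c in c1 c2; rewrite !coordE in xy1 xy2.
  apply/esym/small_eq => //; rewrite !coordE ltr_norml;
    clear - x1 x2 y1 y2 xy1 xy2 c1 c2 u1 u2 v1 v2; lra.
have [u01 u02] := box _ _ _ _ Pu0; have [v01 v02] := box _ _ _ _ Qv0.
have E1 := @near_int a3 (a1 + a2) _ c1; have E2 := @near_int b3 (b1 + b2) _ c2.
rewrite -/c cE !coordE !intrD in E1 E2.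
have {}E1 := E1 ltac:(lra).
have {}E2 := E2 ltac:(lra).
have lift u v w : fcell k1 a1 b1 u -> fcell k2 a2 b2 v -> fcell k3 a3 b3 w ->
    u + v - w \in Z2 R -> u + v = w.
  move=> /box[u1 u2] /box[v1 v2] /box[w1 w2] Z; apply: small_eq => //;
    rewrite !coordE ltr_norml; clear - E1 E2 u1 u2 v1 v2 w1 w2; lra.
split.
- move=> u v Pu Qv Suv; apply: addm; rewrite ?IE ?JE ?KE; [by exists u|by exists v|].
  by exists (u + v).
- move=> w Sw; have : K (mod1 w) by rewrite KE; exists w.
  move=> /V1[u1']; rewrite IE => -[u Pu <-] [v1']; rewrite JE => -[v Qv <-].
  rewrite oplus_mod1 => /mod1_eqP Z; exists u, v; split=> //.
  by rewrite (lift _ _ _ Pu Qv Sw Z).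
- move=> u Pu; have : I (mod1 u) by rewrite IE; exists u.
  move=> /V2[v1']; rewrite JE => -[v Qv <-]; rewrite oplus_mod1 KE => -[w Sw /esym/mod1_eqP Z].
  by exists v => //; rewrite (lift _ _ _ Pu Qv Sw Z).
- move=> v Qv; have : J (mod1 v) by rewrite JE; exists v.
  move=> /V3[u1']; rewrite IE => -[u Pu <-]; rewrite oplus_mod1 KE => -[w Sw /esym/mod1_eqP Z].
  by exists u => //; rewrite (lift _ _ _ Pu Qv Sw Z).
Qed.

End Sampling.

(** * Construction of the sampling maps *)

Section ExSampling.
Variables (R : realType) (q : nat).
Hypothesis q_gt0 : (0 < q)%N.
Local Notation plane := 'rV[R]_2.
Local Notation X := (cX q).
Local Notation Y := (cY q).
Implicit Types (x y z u v w p : plane) (A B m n : int) (i j : nat).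

Section Table.
Variables a b : R.
Let l := a + b.

(* The sampling map moves the levels X + Y = 0, 1/4, 1/2, 3/4 modulo 1 to 0, 1 - l, 1/2, l, which
   commutes with negation.  Points on edges of the complex stay on their edge, whereas the points
   (1/4, 1/2) and (1/2, 1/4) inside the lower triangle go to (a, b). *)
Definition sample_level i : R :=
  match i with 0%N => 0 | 1%N => 1 - l | 2%N => 1 / 2 | _ => l end.

Definition sample_offset i j : R :=
  if i == 0%N then 0 else if (j == 0)%N || (i + j == 4)%N then sample_level i
  else match (i + j)%N with 2%N => 1 / 4 | 3%N => a | 5%N => 1 - a | _ => 3 / 4 end.

Definition sample_Z m : R := (m %/ 4)%Z%:~R + sample_level `|(m %% 4)%Z|.

Definition sample_X m n : R :=
  (m %/ 4)%Z%:~R + sample_offset `|(m %% 4)%Z| `|(n %% 4)%Z|.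

(** On the grid the floors just read off the integral coordinates. The second coordinate is the
    prescribed level minus the first, so the level of the image depends on [m + n] only. *)
Definition sample x : plane :=
  let m := Num.floor (cX (4 * q) x) in let n := Num.floor (cY (4 * q) x) in
  mk q (sample_X m n) (sample_Z (m + n) - sample_X m n).

Lemma divmod4 A i : (i < 4)%N ->
  ((4 * A + i%:Z) %/ 4)%Z = A /\ `|((4 * A + i%:Z) %% 4)%Z|%N = i.
Proof. by move=> i4; split; lia. Qed.

Lemma sample_ZE A i : (i < 4)%N -> sample_Z (4 * A + i%:Z) = A%:~R + sample_level i.
Proof. by move=> /(divmod4 A)[E1 E2]; rewrite /sample_Z E1 E2. Qed.

Lemma sample_XE A B i j : (i < 4)%N -> (j < 4)%N ->
  sample_X (4 * A + i%:Z) (4 * B + j%:Z) = A%:~R + sample_offset i j.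
Proof.
by move=> /(divmod4 A)[E1 E2] /(divmod4 B)[_ E4]; rewrite /sample_X E1 E2 E4.
Qed.

Definition sample_int A B i j : plane :=
  mk q (A%:~R + sample_offset i j)
    (sample_Z (4 * (A + B) + (i + j)%:Z) - (A%:~R + sample_offset i j)).

Lemma sampleE A B i j : (i < 4)%N -> (j < 4)%N ->
  sample (mk (4 * q) (4 * A + i%:Z)%:~R (4 * B + j%:Z)%:~R) = sample_int A B i j.
Proof.
move=> i4 j4; have q4 : (0 < 4 * q)%N by rewrite muln_gt0.
rewrite /sample cX_mk // cY_mk // !intrKfloor sample_XE // /sample_int.
by congr (mk _ _ (sample_Z _ - _)); lia.
Qed.

Lemma grid4P x : x \in grid R (4 * q) -> exists A B i j,
  [/\ (i < 4)%N, (j < 4)%N & x = mk (4 * q) (4 * A + i%:Z)%:~R (4 * B + j%:Z)%:~R].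
Proof.
move=> /gridP[m [n [xm yn]]].
exists (m %/ 4)%Z, (n %/ 4)%Z, `|(m %% 4)%Z|%N, `|(n %% 4)%Z|%N; split; try lia.
rewrite -(mkE (_ : 0 < 4 * q)%N x) ?muln_gt0 // xm yn.
by congr (mk _ _%:~R _%:~R); lia.
Qed.

Lemma sample_int_shift A B C D i j : sample_int (A + C) (B + D) i j =
  sample_int A B i j + mk q C%:~R D%:~R.
Proof.
have [k [r [r4 kE]]] : exists k r, (r < 4)%N /\
    4 * (A + B) + (i + j)%:Z = 4 * k + r%:Z.
  exists ((4 * (A + B) + (i + j)%:Z) %/ 4)%Z, `|((4 * (A + B) + (i + j)%:Z) %% 4)%Z|%N.
  by split; lia.
rewrite /sample_int kE.
have -> : 4 * (A + C + (B + D)) + (i + j)%:Z = 4 * (k + (C + D)) + r%:Z by lia.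
rewrite !sample_ZE // !intrD.
by apply: (plane_eq q_gt0); rewrite !coordE ?cX_mk ?cY_mk //; ring.
Qed.

Lemma sample_shift x t : x \in grid R (4 * q) -> t \in grid R q ->
  sample (x + t) = sample x + t.
Proof.
move=> /grid4P[A [B [i [j [i4 j4 ->]]]]] /gridP[C [D [tC tD]]].
have -> : mk (4 * q) (4 * A + i%:Z)%:~R (4 * B + j%:Z)%:~R + t =
    mk (4 * q) (4 * (A + C) + i%:Z)%:~R (4 * (B + D) + j%:Z)%:~R.
  apply: (@plane_eq _ (4 * q)); rewrite ?muln_gt0 // !(cXD (4 * q), cYD (4 * q));
    by rewrite ?cX_mk ?cY_mk ?muln_gt0 // ?cX_mulr ?cY_mulr ?tC ?tD !(intrD, intrM); ring.
by rewrite !sampleE // sample_int_shift -tC -tD mkE.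
Qed.

Lemma sample_offset_opp i j : (i < 4)%N -> (j < 4)%N ->
  sample_offset (if i == 0%N then 0%N else 4 - i)%N (if j == 0%N then 0%N else 4 - j)%N =
  - sample_offset i j + (if i == 0%N then 0 else 1).
Proof.
by move: i j => [|[|[|[|//]]]] [|[|[|[|//]]]] _ _; rewrite /sample_offset /=; rewrite /l; lra.
Qed.

Lemma sample_opp x : x \in grid R (4 * q) -> sample (- x) = - sample x.
Proof.
move=> /grid4P[A [B [i [j [i4 j4 ->]]]]].
pose A' := if i == 0%N then - A else - A - 1.
pose i' := if i == 0%N then 0%N else (4 - i)%N.
pose B' := if j == 0%N then - B else - B - 1.
pose j' := if j == 0%N then 0%N else (4 - j)%N.
have AE : 4 * A' + i'%:Z = - (4 * A + i%:Z) by rewrite /A' /i'; case: eqP => ?; lia.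
have BE : 4 * B' + j'%:Z = - (4 * B + j%:Z) by rewrite /B' /j'; case: eqP => ?; lia.
have -> : - mk (4 * q) (4 * A + i%:Z)%:~R (4 * B + j%:Z)%:~R =
    mk (4 * q) (4 * A' + i'%:Z)%:~R (4 * B' + j'%:Z)%:~R :> plane.
  apply: (@plane_eq _ (4 * q)); rewrite ?muln_gt0 // !(cXN (4 * q), cYN (4 * q));
    by rewrite ?cX_mk ?cY_mk ?muln_gt0 // ?AE ?BE mulrNz.
have i'4 : (i' < 4)%N by rewrite /i'; case: eqP => ?; lia.
have j'4 : (j' < 4)%N by rewrite /j'; case: eqP => ?; lia.
rewrite !sampleE //.
have X' : sample_offset i' j' = - sample_offset i j + (if i == 0%N then 0 else 1).
  exact: sample_offset_opp.
have Z' : sample_Z (4 * (A' + B') + (i' + j')%:Z) = - sample_Z (4 * (A + B) + (i + j)%:Z).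
  have [k [r [r4 kE]]] : exists k r, (r < 4)%N /\
      4 * (A + B) + (i + j)%:Z = 4 * k + r%:Z.
    exists ((4 * (A + B) + (i + j)%:Z) %/ 4)%Z, `|((4 * (A + B) + (i + j)%:Z) %% 4)%Z|%N.
    by split; lia.
  rewrite kE sample_ZE //; have [r0|r0] := eqVneq r 0%N.
    have -> : 4 * (A' + B') + (i' + j')%:Z = 4 * (- k) + 0%:Z by lia.
    by rewrite sample_ZE // r0 mulrNz /=; ring.
  have -> : 4 * (A' + B') + (i' + j')%:Z = 4 * (- k - 1) + (4 - r)%N%:Z by lia.
  rewrite sample_ZE; last lia.
  rewrite intrB mulrNz; move: r r4 r0 {kE} => [|[|[|[|//]]]] //= _ _; lra.
rewrite /sample_int Z' X'.
have A'E : A'%:~R = - A%:~R - (if i == 0%N then 0 else 1) :> R.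
  by rewrite /A'; case: eqP => _; rewrite ?intrB mulrNz ?subr0.
by apply: (plane_eq q_gt0); rewrite !coordE ?cX_mk ?cY_mk // A'E; ring.
Qed.

Lemma sample_Z_double A i : (i < 8)%N -> sample_Z (4 * A + i%:Z) =
  A%:~R + (if (i < 4)%N then sample_level i else 1 + sample_level (i - 4)).
Proof.
move=> i8; case: ltnP => i4; first exact: sample_ZE.
rewrite (_ : 4 * A + i%:Z = 4 * (A + 1) + (i - 4)%N%:Z); last lia.
by rewrite sample_ZE ?intrD ?addrA //; lia.
Qed.

Hypothesis (a0 : 0 <= a) (b0 : 0 <= b) (ab1 : a + b <= 1).

Lemma between_bounds m (s t : R) : (s = m%:~R /\ t = m%:~R) \/
  (m%:~R < s < m%:~R + 1 /\ m%:~R <= t <= m%:~R + 1) -> between s t.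
Proof.
case=> [[-> ->]|[h1 h2]]; first exact: between_refl.
have fE : Num.floor s = m by apply: floor_def; rewrite intrD; lra.
have cE : Num.ceil s = m + 1 by apply: ceil_def; rewrite addrK intrD; lra.
by rewrite /between fE cE intrD.
Qed.

Lemma sample_offset_bounds i j : (i < 4)%N -> (j < 4)%N ->
  0 <= sample_offset i j <= 1 /\ (i = 0%N -> sample_offset i j = 0).
Proof.
have [? ? ?] := And3 a0 b0 ab1.
by move: i j => [|[|[|[|//]]]] [|[|[|[|//]]]] _ _; rewrite /sample_offset /=; split=> //;
  rewrite /l; lra.
Qed.

Lemma sample_Y_bounds i j : (i < 4)%N -> (j < 4)%N ->
  let y := (if (i + j < 4)%N then sample_level (i + j) else 1 + sample_level (i + j - 4)) -
    sample_offset i j in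
  0 <= y <= 1 /\ (j = 0%N -> y = 0).
Proof.
have [? ? ?] := And3 a0 b0 ab1.
by move: i j => [|[|[|[|//]]]] [|[|[|[|//]]]] _ _; rewrite /sample_offset /=; split=> //;
  rewrite /l; lra.
Qed.

Lemma sample_level_bounds i : (i < 4)%N ->
  0 <= sample_level i <= 1 /\ (i = 0%N -> sample_level i = 0).
Proof.
have [? ? ?] := And3 a0 b0 ab1.
by move: i => [|[|[|[|//]]]] _ /=; split=> //; rewrite /l; lra.
Qed.

Lemma between_quarter A i (e s t : R) : (i < 4)%N -> 0 <= e <= 1 ->
  (i = 0%N -> e = 0) -> s = A%:~R + i%:R / 4 -> t = A%:~R + e -> between s t.
Proof.
move=> i4 e01 ei sE tE; apply: (between_bounds (m := A)).
have [i0|i0] := eqVneq i 0%N.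
  by left; rewrite sE tE i0 (ei i0) mul0r addr0.
right; rewrite sE tE.
have : 1 <= i%:R :> R by rewrite ler1n lt0n.
have : i%:R < 4 :> R by rewrite ltr_nat.
lra.
Qed.

(** Each of [X], [Y] and [X + Y] keeps its value if it is integral and otherwise stays in its unit
    interval, as the table shows. *)
Lemma sample_cell x : x \in grid R (4 * q) -> cell q x (sample x).
Proof.
move=> /grid4P[A [B [i [j [i4 j4 xE]]]]].
have q4 : (0 < 4 * q)%N by rewrite muln_gt0.
have Xx : X x = A%:~R + i%:R / 4.
  have : cX (4 * q) x = (4 * A + i%:Z)%:~R by rewrite xE cX_mk.
  by rewrite cX_mulr intrD intrM; lra.
have Yx : Y x = B%:~R + j%:R / 4.
  have : cY (4 * q) x = (4 * B + j%:Z)%:~R by rewrite xE cY_mk.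
  by rewrite cY_mulr intrD intrM; lra.
have [X01 X0] := sample_offset_bounds i4 j4.
have [Y01 Y0] := sample_Y_bounds i4 j4.
have XYE : X (sample x) + Y (sample x) = sample_Z (4 * (A + B) + (i + j)%:Z).
  by rewrite xE sampleE // cX_mk // cY_mk // addrC subrK.
have ZE := @sample_Z_double (A + B) (i + j) ltac:(lia).
split.
- apply: (between_quarter i4 X01 X0 Xx).
  by rewrite xE sampleE // cX_mk.
- apply: (between_quarter j4 Y01 Y0 Yx).
  by rewrite xE sampleE // cY_mk // ZE intrD; ring.
- rewrite XYE ZE Xx Yx; case: ltnP => ij.
    have [Z01 Z0] := sample_level_bounds ij.
    by apply: (between_quarter ij Z01 Z0 _ erefl); rewrite intrD natrD; ring.
  have ij4 : (i + j - 4 < 4)%N by lia.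
  have [Z01 Z0] := sample_level_bounds ij4.
  apply: (@between_quarter (A + B + 1) _ _ _ _ ij4 Z01 Z0).
    by rewrite !intrD natrB // natrD; field.
  by rewrite !intrD; ring.
Qed.

Lemma sample_sampling : sampling q (4 * q) sample.
Proof.
split; [exact: sample_cell|exact: sample_shift|exact: sample_opp|].
move=> x y xN yN; have q4 : (0 < 4 * q)%N by rewrite muln_gt0.
move: xN yN => /gridP[m [n [xm yn]]] /gridP[m' [n' [xm' yn']]] lev.
rewrite /sample xm yn xm' yn' !intrKfloor !cX_mk // !cY_mk // ![_ + (_ - _)]addrC !subrK.
congr sample_Z; apply: (@intr_inj R); rewrite !intrD -xm -yn -xm' -yn'.
by rewrite !cX_mulr !cY_mulr; lra.
Qed.

End Table.

Lemma ex_sampling p : exists Phi : plane -> plane, sampling q (4 * q) Phi /\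
  exists2 x, x \in grid R (4 * q) & Phi x = p.
Proof.
have q4 : (0 < 4 * q)%N by rewrite muln_gt0.
have [k [A [B [kD [/andP[h1 h2] /andP[h3 h4] h5]]]]] := ex_triangle q p.
case: k kD h5 => // _ h5.
  exists (sample (X p - A%:~R) (Y p - B%:~R)); split; first by apply: sample_sampling; lra.
  exists (mk (4 * q) (4 * A + 1%:Z)%:~R (4 * B + 2%:Z)%:~R); first exact: mk_grid.
  rewrite sampleE // /sample_int sample_ZE // /sample_offset /=.
  by apply: (plane_eq q_gt0); rewrite ?cX_mk ?cY_mk // ?intrD; ring.
(* In the upper triangle the table sends (3/4, 1/2) to [(1 - a, 1 - b)], so the parameters are the
   reflected offsets of [p]. *)
exists (sample (A%:~R + 1 - X p) (B%:~R + 1 - Y p)); split.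
  by apply: sample_sampling; lra.
exists (mk (4 * q) (4 * A + 3%:Z)%:~R (4 * B + 2%:Z)%:~R); first exact: mk_grid.
rewrite sampleE // /sample_int sample_Z_double // /sample_offset /=.
by apply: (plane_eq q_gt0); rewrite ?cX_mk ?cY_mk // ?intrD; ring.
Qed.

End ExSampling.

Lemma ex_scaling (R : realType) (T : finType) (A B : T -> R) :
  (forall i, 0 <= A i) -> (forall i, A i = 0 -> B i = 0) ->
  exists2 e, 0 < e & forall i, e * `|B i| <= A i.
Proof.
move=> A0 AB.
suff [e e0 eE] : exists2 e, 0 < e & forall i, i \in enum T -> e * `|B i| <= A i.
  by exists e => // i; apply: eE; rewrite mem_enum.
elim: (enum T) => [|i s [e e0 IH]]; first by exists 1.
have [d d0 dE] : exists2 d, 0 < d & d * `|B i| <= A i.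
  have [Ai|Ai] := eqVneq (A i) 0.
    by exists 1; rewrite // (AB i Ai) Ai normr0 mulr0.
  have B1 : 0 < 1 + `|B i| by rewrite ltr_pwDl.
  have Ap : 0 < A i by rewrite lt_neqAle eq_sym Ai A0.
  exists (A i / (1 + `|B i|)); first exact: divr_gt0.
  by rewrite -mulrA ler_piMr // ler_pdivrMl // mulr1 lerDr.
exists (Num.min e d); first by rewrite lt_min e0.
have N0 j : 0 <= `|B j| by [].
move=> j; rewrite inE => /orP[/eqP ->|js].
  by apply: le_trans dE; rewrite ler_wpM2r // ge_min lexx orbT.
by apply: le_trans (IH j js); rewrite ler_wpM2r // ge_min lexx.
Qed.

(** * Lipschitz bounds *)

Section Valid.
Variables (R : realType) (q : nat) (f : 'rV[R]_2).
Hypothesis q_gt0 : (0 < q)%N.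
Local Notation plane := 'rV[R]_2.
Local Notation X := (cX q).
Local Notation Y := (cY q).
Implicit Types (x y z u v w : plane) (g : plane -> R).

Lemma gomory_johnson_le1 (G : zmodType) (S : zmodClosed G) (f0 : G) (g : G -> R) r :
  gomory_johnson S f0 g -> g r <= 1.
Proof. by case=> ge0 _ _ _ sym; rewrite -(sym r) lerDl. Qed.

(** On the four axis-parallel edges at 0 the function grows linearly from 0 to at most 1, and beyond
    them the bound 1 suffices; subadditivity combines the two axes. *)
Lemma gomory_johnson_bound g : gomory_johnson (Z2 R) f g -> triangle_aff q g ->
  forall x, g x <= `|X x| + `|Y x|.
Proof.
move=> gj aff x; have [ge0 g0 sub _ _] := gj; have le1 y := gomory_johnson_le1 y gj.
have seg k a b d (s : R) : k <> Diag -> fcell q k a b (0 : plane) -> fcell q k a b d ->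
    0 <= s -> g (s *: d) <= s.
  move=> kD k0 kd s0; have [s1|s1] := leP s 1; last by apply: le_trans (le1 _) (ltW s1).
  have := aff k a b kD d 0 s kd k0; rewrite s0 s1 scaler0 addr0 => -> //.
  by rewrite g0 mulr0 addr0 ler_piMr.
have fc k a b d : [/\ a%:~R <= X d <= a%:~R + 1, b%:~R <= Y d <= b%:~R + 1 &
    match k with
    | Lower => X d + Y d <= a%:~R + b%:~R + 1
    | Upper => a%:~R + b%:~R + 1 <= X d + Y d
    | Diag => X d + Y d = a%:~R + b%:~R + 1
    end] -> fcell q k a b d by [].
have axis d : (d = mk q 1 0 \/ d = mk q 0 1) -> forall s, g (s *: d) <= `|s|.
  move=> dE s; have [s0|s0] := leP 0 s.
    rewrite ger0_norm //; apply: (@seg Lower 0 0) => //.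
      by apply: fc; rewrite cX0 cY0 ?mulr0z; split; lra.
    by apply: fc; rewrite ?mulr0z; case: dE => ->; rewrite cX_mk // cY_mk //; split; lra.
  rewrite ltr0_norm // -[s in leLHS]opprK scaleNr -scalerN.
  case: dE => ->.
    apply: (@seg Lower (-1) 0) => //; last lra.
      by apply: fc; rewrite cX0 cY0 mulrNz ?mulr0z; split; lra.
    by apply: fc; rewrite cXN cYN cX_mk // cY_mk // mulrNz ?mulr0z; split; lra.
  apply: (@seg Lower 0 (-1)) => //; last lra.
    by apply: fc; rewrite cX0 cY0 mulrNz ?mulr0z; split; lra.
  by apply: fc; rewrite cXN cYN cX_mk // cY_mk // mulrNz ?mulr0z; split; lra.
have -> : x = X x *: mk q 1 0 + Y x *: mk q 0 1.
  by apply: (plane_eq q_gt0); rewrite !coordE ?cX_mk ?cY_mk //; ring.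
apply: le_trans (sub _ _) _; rewrite !coordE !cX_mk // !cY_mk //.
by apply: lerD; rewrite ?(mulr1, mulr0, addr0, add0r); apply: axis; auto.
Qed.

(** Subadditivity gives [g u - g v <= g (u - v)]. *)
Lemma subadditive_lipschitz g (C : R) : 0 <= C ->
  (forall x y, g (x + y) <= g x + g y) ->
  (forall x, g x <= C * (`|X x| + `|Y x|)) -> lipschitz q g.
Proof.
move=> C0 sub bnd; exists C => // x y.
have half u v : g u - g v <= C * (`|X (u - v)| + `|Y (u - v)|).
  by have := sub (u - v) v; have := bnd (u - v); rewrite subrK; lra.
rewrite ler_norml half andbT.
have := half y x; rewrite -(opprB x y) (cXN q (x - y)) (cYN q (x - y)) !normrN.
by rewrite lerNl opprB.
Qed.

End Valid.

(** * Perturbations of an extreme restriction *)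

Section Perturbation.
Variables (R : realType) (q : nat) (f : 'rV[R]_2) (pi : 'rV[R]_2 -> R).
Hypothesis q_gt0 : (0 < q)%N.
Local Notation plane := 'rV[R]_2.
Local Notation N := (4 * q)%N.
Local Notation gt := (grid_group R N).
Implicit Types (x y z : gt).
Hypothesis fq : f \in grid R q.
Hypothesis pi_gj : gomory_johnson (Z2 R) f pi.
Hypothesis pi_aff : triangle_aff q pi.
Local Notation fN := (grid_mulr 4 fq).
Let N_gt0 : (0 < N)%N. Proof. by rewrite muln_gt0. Qed.
Hypothesis ext :
  extreme_function (Z2_in_grid R N) (GridGroup fN) (fun x : gt => pi (val x)).

Lemma Z2_grid n (z : plane) : z \in Z2 R -> z \in grid R n.
Proof. by move=> zZ; have := @grid_mulr R n 1 z zZ; rewrite muln1. Qed.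

Lemma grid_torsion (x : gt) : x *+ N \in Z2_in_grid R N.
Proof.
have [a [b ->]] := gptP N_gt0 x; apply/gridP; exists a, b.
have valM (y : gt) n : val (y *+ n) = val y *+ n by rewrite raddfMn.
rewrite valM -scaler_nat cXZ cYZ.
have EX (v : plane) : N%:R * cX 1 v = cX N v by rewrite /cX mul1r.
have EY (v : plane) : N%:R * cY 1 v = cY N v by rewrite /cY mul1r.
rewrite EX EY.
by rewrite /= cX_mk // cY_mk.
Qed.

Lemma perturbation_eq0 (psi : gt -> R) :
  (forall x z : gt, z \in Z2_in_grid R N -> psi (x + z) = psi x) ->
  psi (GridGroup fN) = 0 ->
  (forall x y : gt, pi (val x) + pi (val y) = pi (val (x + y)) ->
     psi x + psi y = psi (x + y)) ->
  forall x : gt, psi x = 0.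
Proof.
move=> psi_per psif psi_add.
have [_ pi0 pi_sub pi_per pi_sym] := pi_gj.
pose T : finType := ('I_N * 'I_N * ('I_N * 'I_N))%type.
pose pt' (i : 'I_N * 'I_N) : gt := gpt R N_gt0 i.1%:Z i.2%:Z.
have reduce (x : gt) : exists i z, z \in Z2_in_grid R N /\ x = pt' i + z.
  have [a [b ->]] := gptP N_gt0 x.
  have lt (c : int) : (`|(c %% N)%Z| < N)%N by lia.
  exists (Ordinal (lt a), Ordinal (lt b)), (gpt R N_gt0 (N%:Z * (a %/ N)%Z) (N%:Z * (b %/ N)%Z)).
  split; last by rewrite -gptD; congr gpt; rewrite /=; lia.
  apply/gridP; exists (a %/ N)%Z, (b %/ N)%Z.
  have N0 : N%:R != 0 :> R by rewrite pnatr_eq0 -lt0n.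
  by split; apply: (mulfI N0); rewrite -?cX_mulr -?cY_mulr muln1 ?cX_mk ?cY_mk // intrM.
pose A (x y : gt) := pi (val x) + pi (val y) - pi (val (x + y)).
pose B (x y : gt) := psi x + psi y - psi (x + y).
(* Both defects are periodic, so a factor that works for the finitely many pairs of representatives
   works for all pairs. *)
have [||e e0 eE] := @ex_scaling R T (fun t => A (pt' t.1) (pt' t.2))
    (fun t => B (pt' t.1) (pt' t.2)).
- by move=> t; rewrite /A subr_ge0 raddfD.
- by move=> t /eqP; rewrite subr_eq0 => /eqP/psi_add E; rewrite /B E subrr.
have bound x y : e * `|B x y| <= A x y.
  have [i [z [zZ ->]]] := reduce x; have [j [z' [zZ' ->]]] := reduce y.
  have per w t : t \in Z2_in_grid R N -> pi (val (w + t)) = pi (val w).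
    by move=> tZ; rewrite raddfD /= pi_per.
  have zZ2 : z + z' \in Z2_in_grid R N by rewrite rpredD.
  have : e * `|B (pt' i) (pt' j)| <= A (pt' i) (pt' j) := eE (i, j).
  rewrite /A /B addrACA.
  by rewrite !(psi_per _ _ zZ, psi_per _ _ zZ', psi_per _ _ zZ2)
    (per _ _ zZ) (per _ _ zZ') (per _ _ zZ2).
have gvalid (s : R) : s = e \/ s = - e -> valid_function (Z2_in_grid R N) (GridGroup fN)
    (fun x => pi (val x) + s * psi x).
  move=> sE; set g := fun x : gt => _.
  have g0 : g 0 = 0.
    have := psi_add 0 0; rewrite addr0 pi0 addr0 => /(_ erefl) p0.
    by rewrite /g pi0 (_ : psi 0 = 0) ?mulr0 ?addr0 //; lra.
  have gsub x y : g (x + y) <= g x + g y.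
    have := bound x y; rewrite /A /g.
    have : s * (psi x + psi y - psi (x + y)) >= - (e * `|B x y|).
      rewrite -/(B x y) lerNl; apply: le_trans (ler_norm _) _.
      by rewrite normrN normrM; case: sE => ->; rewrite ?normrN (gtr0_norm e0) lexx.
    lra.
  have gper x z : z \in Z2_in_grid R N -> g (x + z) = g x.
    by move=> zZ; rewrite /g psi_per // raddfD /= pi_per.
  apply: subadditive_valid => //.
    (* Nonnegativity follows from subadditivity, since grid points are torsion modulo Z^2: [N] times
       [g x] is at least [g (x *+ N) = g 0 = 0]. *)
    move=> x; have le n : g (x *+ n) <= n%:R * g x.
      elim: n => [|n IH]; first by rewrite mulr0n g0 mul0r.
      by rewrite mulrS -natr1 mulrDl mul1r addrC; apply: le_trans (gsub _ _) _; rewrite lerD2r.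
    have := le N; rewrite -[x *+ N]add0r gper ?grid_torsion // g0.
    by rewrite pmulr_rge0 // ltr0n.
  by rewrite /g psif mulr0 addr0; have := pi_sym f; rewrite subrr pi0 addr0 => ->.
have [_ /(_ _ _ (gvalid e (or_introl erefl)) (gvalid (- e) (or_intror erefl)))[|E _]] := ext.
  by apply/funext => x; lra.
move=> x; have := congr1 (@^~ x) E => /= /eqP.
rewrite -subr_eq0 opprD addrA subrr add0r oppr_eq0 mulf_eq0 gt_eqF //= => /eqP //.
Qed.

End Perturbation.

(** * The deviation of a summand from [pi] *)

Section Extreme.
Variables (R : realType) (q : nat) (f : 'rV[R]_2) (pi : 'rV[R]_2 -> R).
Hypothesis q_gt0 : (0 < q)%N.
Local Notation plane := 'rV[R]_2.
Local Notation N := (4 * q)%N.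
Local Notation gt := (grid_group R N).
Implicit Types (x y z : plane).
Hypothesis fq : f \in grid R q.
Hypothesis pi_min : minimal_function (Z2 R) f pi.
Hypothesis pi_pwl : piecewise_linear q pi.
Hypothesis ext : extreme_function (Z2_in_grid R N) (GridGroup (grid_mulr 4 fq))
  (fun x : gt => pi (val x)).

Section Average.
Variables p1 p2 : plane -> R.
Hypothesis v1 : valid_function (Z2 R) f p1.
Hypothesis v2 : valid_function (Z2 R) f p2.
Hypothesis piE : pi = (fun r => 2^-1 * p1 r + 2^-1 * p2 r).

Lemma average_gj1 : gomory_johnson (Z2 R) f p1.
Proof. exact: minimal_gomory_johnson (minimal_average pi_min v1 v2 piE). Qed.

Lemma average_gj2 : gomory_johnson (Z2 R) f p2.
Proof.
apply: minimal_gomory_johnson; apply: (minimal_average pi_min v2 v1).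
by rewrite piE; apply/funext => r; rewrite addrC.
Qed.

Definition deviation x := p1 x - pi x.

(** Both summands are subadditive, so equality for their average forces equality for each. *)
Lemma deviation_add x y : pi x + pi y = pi (x + y) ->
  deviation x + deviation y = deviation (x + y).
Proof.
have [_ _ sub1 _ _] := average_gj1; have [_ _ sub2 _ _] := average_gj2.
by have := sub1 x y; have := sub2 x y; rewrite /deviation piE; lra.
Qed.

Lemma deviation_periodic x z : z \in Z2 R -> deviation (x + z) = deviation x.
Proof.
move=> zZ; have [_ _ _ per1 _] := average_gj1.
have [_ _ _ per _] := minimal_gomory_johnson pi_min.
by rewrite /deviation per1 // per.
Qed.

(** Since [p2] is nonnegative, [p1] is at most [2 * pi] and inherits a linear bound at 0. *)
Lemma deviation_lipschitz : lipschitz q deviation.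
Proof.
have gj := minimal_gomory_johnson pi_min.
have bnd := gomory_johnson_bound q_gt0 gj (piecewise_linear_triangle_aff q_gt0 pi_pwl).
have [_ _ sub _ _] := gj; have [ge1 _ sub1 _ _] := average_gj1; have [ge2 _ _ _ _] := average_gj2.
have [L L0 LE] : lipschitz q pi.
  by apply: (@subadditive_lipschitz _ _ _ 1) => // x; rewrite mul1r.
have [M M0 ME] : lipschitz q p1.
  apply: (@subadditive_lipschitz _ _ _ 2) => // x.
  by have := bnd x; have := ge2 x; rewrite piE; lra.
exists (M + L); first exact: addr_ge0.
move=> x y; rewrite mulrDl /deviation.
have -> : p1 x - pi x - (p1 y - pi y) = (p1 x - p1 y) - (pi x - pi y) by ring.
by apply: le_trans (ler_normB _ _) _; apply: lerD.
Qed.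

Lemma deviation_grid x : x \in grid R N -> deviation x = 0.
Proof.
move=> xN; have fN := grid_mulr 4 fq.
have [_ ext2] := ext.
have [|||E _] := ext2 (fun x : gt => p1 (val x)) (fun x : gt => p2 (val x)).
- exact/gomory_johnson_valid/gomory_johnson_restrict/average_gj1.
- exact/gomory_johnson_valid/gomory_johnson_restrict/average_gj2.
- by rewrite piE.
- by have /= := congr1 (@^~ (GridGroup xN)) E; rewrite /deviation => ->; rewrite subrr.
Qed.

Lemma deviation_eq0_large : (2 < q)%N -> diagonally_constrained q pi ->
  forall x, deviation x = 0.
Proof.
move=> q3 diag p; have gj := minimal_gomory_johnson pi_min.
have [_ _ sub per _] := gj.
have [Phi [sPhi [x xN <-]]] := ex_sampling q_gt0 p.
have q0N : {subset grid R q <= grid R N} by move=> y; exact: grid_mulr.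
have dev0 y : y \in grid R q -> deviation y = 0 by move=> /q0N /deviation_grid.
have [cPhi tr _ _] := sPhi.
have aff := piecewise_linear_triangle_aff q_gt0 pi_pwl.
apply: (perturbation_eq0 q_gt0 gj ext 
  (psi := fun y : gt => deviation (Phi (val y))) _ _ _ (GridGroup xN)).
- move=> y z zZ; rewrite raddfD /= tr ?deviation_periodic //; first exact: (valP y).
  exact: Z2_grid.
- by rewrite /= (sampling_grid q3 sPhi) ?dev0.
- move=> y z E; rewrite raddfD.
  apply: (sampling_additive q3 per sub aff diag deviation_add deviation_lipschitz dev0 sPhi
    q0N (valP y) (valP z)).
  by rewrite E raddfD.
Qed.

End Average.

Lemma extreme_of_deviation :
  (forall p1 p2, valid_function (Z2 R) f p1 -> valid_function (Z2 R) f p2 ->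
     pi = (fun r => 2^-1 * p1 r + 2^-1 * p2 r) -> forall x, deviation p1 x = 0) ->
  extreme_function (Z2 R) f pi.
Proof.
move=> dev0; split; first by case: pi_min.
move=> p1 p2 v1 v2 piE; have E := dev0 _ _ v1 v2 piE.
have E1 x : p1 x = pi x by apply/eqP; rewrite -subr_eq0; apply/eqP/E.
split; apply/funext => x; first by rewrite E1.
by have := E1 x; rewrite piE; lra.
Qed.

End Extreme.

(** * The case q = 2 *)

Section Tent.
Variable R : realType.
Implicit Types (c d s : R) (m k : int).

(** The distance from [c] to the nearest even integer; in units of 1/2 the even integers are the
    integers of the torus. *)
Definition tent c : R := `|c - 2 * (Num.floor ((c + 1) / 2))%:~R|.

Lemma tent_le1 c : tent c <= 1.
Proof.
have := floor_itv ((c + 1) / 2); rewrite intrD => h.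
by rewrite /tent ler_norml; lra.
Qed.

Lemma tent_periodic c m : tent (c + 2 * m%:~R) = tent c.
Proof.
rewrite /tent (_ : (c + 2 * m%:~R + 1) / 2 = (c + 1) / 2 + m%:~R); last by field.
by rewrite floor_intD intrD; congr `|_|; ring.
Qed.

Lemma tent_norm c : -1 <= c <= 1 -> tent c = `|c|.
Proof.
move=> c1; have [->|ne] := eqVneq c 1.
  rewrite /tent (_ : (1 + 1) / 2 = 1); last by field.
  by rewrite floor1 mulr1 -normrN; congr `|_|; ring.
rewrite /tent (_ : Num.floor _ = 0) ?mulr0z ?mulr0 ?subr0 //.
have c_lt1 : c < 1 by rewrite lt_neqAle ne; case/andP: c1.
by apply: floor_def; rewrite add0r mulr0z mulr1z; lra.
Qed.

Lemma tent_le c k : tent c <= `|c - 2 * k%:~R|.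
Proof.
have [le|lt] := leP 1 `|c - 2 * k%:~R|; first exact: le_trans (tent_le1 c) le.
rewrite -tent_norm; last by move: lt; rewrite ltr_norml; lra.
by rewrite -(tent_periodic (c - _) k) subrK.
Qed.

Lemma tentD c d : tent (c + d) <= tent c + tent d.
Proof.
rewrite {2 3}/tent; set m := Num.floor _; set k := Num.floor _.
apply: le_trans (tent_le _ (m + k)) _; rewrite intrD.
have -> : c + d - 2 * (m%:~R + k%:~R) = (c - 2 * m%:~R) + (d - 2 * k%:~R) by ring.
exact: ler_normD.
Qed.

Lemma tent_even m : tent (2 * m)%:~R = 0.
Proof.
by rewrite intrM -[_ * _]add0r tent_periodic tent_norm ?normr0 //; lra.
Qed.

Lemma tent_odd m : tent (2 * m + 1)%:~R = 1.
Proof.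
by rewrite intrD intrM addrC tent_periodic tent_norm ?normr1 //; lra.
Qed.

Lemma tent_segment m s : 0 <= s <= 1 ->
  tent (m%:~R + s) = tent m%:~R + s * (tent (m + 1)%:~R - tent m%:~R).
Proof.
move=> s01; have [k [mE|mE]] : exists k, m = 2 * k \/ m = 2 * k + 1.
- by exists (m %/ 2)%Z; lia.
- rewrite mE tent_even tent_odd intrM addrC tent_periodic tent_norm ?ger0_norm; lra.
- rewrite mE tent_odd (_ : 2 * k + 1 + 1 = 2 * (k + 1)) ?tent_even; last by ring.
  rewrite (_ : (2 * k + 1)%:~R + s = s - 1 + 2 * (k + 1)%:~R); last first.
    by rewrite !intrD intrM; ring.
  rewrite tent_periodic tent_norm ?ler0_norm; lra.
Qed.

End Tent.

Section TwoDimensionalTents.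
Variable R : realType.
Local Notation plane := 'rV[R]_2.
Local Notation X := (cX 2).
Local Notation Y := (cY 2).
Implicit Types (x y z : plane) (j : 'I_3).

Definition linear_form (i : nat) x : R :=
  match i with 0%N => X x | 1%N => Y x | _ => X x + Y x end.

Definition tent_form i x : R := tent (linear_form i x).

Lemma linear_formD i x y : linear_form i (x + y) = linear_form i x + linear_form i y.
Proof. by case: i => [|[|i]]; rewrite /= ?coordE //; ring. Qed.

Lemma tent_form_periodic i x z : z \in Z2 R -> tent_form i (x + z) = tent_form i x.
Proof.
move=> /(Z2_coord 2)[a [b [xa yb]]]; rewrite /tent_form linear_formD.
case: i => [|[|i]] /=; rewrite ?xa ?yb ?tent_periodic //.
have -> : 2%:R * a%:~R + 2%:R * b%:~R = 2 * (a + b)%:~R :> R by rewrite intrD; ring.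
exact: tent_periodic.
Qed.

Lemma tent_form_subadditive i x y : tent_form i (x + y) <= tent_form i x + tent_form i y.
Proof. by rewrite /tent_form linear_formD; exact: tentD. Qed.

Lemma parity_cases (m : int) : exists k, m = 2 * k \/ m = 2 * k + 1.
Proof. by exists (m %/ 2)%Z; lia. Qed.

Variables (f : plane) (pi : plane -> R).
Hypothesis fq : f \in grid R 2.
Hypothesis pi_gj : gomory_johnson (Z2 R) f pi.

Let A := pi (mk 2 1 0).
Let B := pi (mk 2 0 1).
Let C := pi (mk 2 1 1).

(** Solved from the values at vertices: at [mk 2 1 0] the tents of [X] and [X + Y] are 1 and that of
    [Y] is 0, so with weights of sum 1 the weight of [Y] is [1 - A]; likewise for the others. *)
Definition tent_weight (i : nat) : R :=
  match i with 0%N => 1 - B | 1%N => 1 - A | _ => 1 - C end.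

Lemma pi_lattice (m k i j : int) :
  pi (mk 2 (2 * m + i)%:~R (2 * k + j)%:~R) = pi (mk 2 i%:~R j%:~R).
Proof.
have [_ _ _ per _] := pi_gj.
have zZ : mk 2 (2 * m)%:~R (2 * k)%:~R \in Z2 R.
  have n20 : 2%:R != 0 :> R by rewrite pnatr_eq0.
  apply/gridP; exists m, k; split; apply: (mulfI n20).
    by rewrite -cX_mulr muln1 cX_mk // intrM.
  by rewrite -cY_mulr muln1 cY_mk // intrM.
rewrite -[RHS](per _ _ zZ); congr pi.
by apply: (@plane_eq _ 2); rewrite // !coordE ?cX_mk ?cY_mk // intrD; ring.
Qed.

(** Modulo Z^2, [f] is one of the three nonzero half-integral points, where [pi] is 1; symmetry
    pairs the other two, whose values sum to 1. The class of 0 is excluded by [pi 0 = 0]. *)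
Lemma sum_vertices : A + B + C = 2.
Proof.
have [_ pi0 _ per sym] := pi_gj.
have fE : exists i j, [/\ i = 0 \/ i = 1 :> int, j = 0 \/ j = 1 :> int &
    forall x, pi (f - x) = pi (mk 2 i%:~R j%:~R - x)].
  have /gridP[a [b [fa fb]]] := fq.
  have [m mE] := parity_cases a; have [k kE] := parity_cases b.
  have red (i j : int) : a = 2 * m + i -> b = 2 * k + j -> forall x,
     pi (f - x) = pi (mk 2 i%:~R j%:~R - x).
    move=> aE bE x.
    have zZ : mk 2 (2 * m)%:~R (2 * k)%:~R \in Z2 R.
      have n20 : 2%:R != 0 :> R by rewrite pnatr_eq0.
      apply/gridP; exists m, k; split; apply: (mulfI n20).
        by rewrite -cX_mulr muln1 cX_mk // intrM.
      by rewrite -cY_mulr muln1 cY_mk // intrM.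
    rewrite -[RHS](per _ _ zZ); congr pi.
    rewrite -(mkE (ltn0Sn 1) f) fa fb aE bE.
    by apply: (@plane_eq _ 2); rewrite // !coordE ?cX_mk ?cY_mk // !intrD; ring.
  case: mE => mE; case: kE => kE.
  - by exists 0, 0; split; auto; apply: red; rewrite addr0.
  - by exists 0, 1; split; auto; apply: red; rewrite ?addr0.
  - by exists 1, 0; split; auto; apply: red; rewrite ?addr0.
  - by exists 1, 1; split; auto; apply: red.
have val (i j c d : int) x : x = mk 2 c%:~R d%:~R ->
    pi (mk 2 i%:~R j%:~R - x) = pi (mk 2 (i - c)%:~R (j - d)%:~R).
  move=> ->; congr pi.
  by apply: (@plane_eq _ 2); rewrite // !coordE ?cX_mk ?cY_mk // intrB.
have n1 (j : int) : pi (mk 2 (-1)%:~R j%:~R) = pi (mk 2 1 j%:~R).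
  by have := pi_lattice (-1) 0 1 j; rewrite mulr0 add0r.
have n2 (i : int) : pi (mk 2 i%:~R (-1)%:~R) = pi (mk 2 i%:~R 1).
  by have := pi_lattice 0 (-1) i 1; rewrite mulr0 add0r.
have mk00 : mk 2 0 0 = 0 :> plane.
  by apply: (@plane_eq _ 2); rewrite // ?cX_mk ?cY_mk // ?cX0 ?cY0.
have pi00 : pi (mk 2 0 0) = 0 by rewrite mk00.
case: fE => i [j [iE jE E]].
have s00 := sym (mk 2 0 0); have s10 := sym (mk 2 1 0).
have s01 := sym (mk 2 0 1); have s11 := sym (mk 2 1 1).
rewrite E (val i j 0 0 _ erefl) in s00; rewrite E (val i j 1 0 _ erefl) in s10.
rewrite E (val i j 0 1 _ erefl) in s01; rewrite E (val i j 1 1 _ erefl) in s11.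
rewrite /A /B /C; move: s00 s10 s01 s11.
case: iE => ->; case: jE => ->; rewrite ?subr0 ?subrr ?sub0r ?n1 ?n2 ?mulr0z ?mulr1z pi00; lra.
Qed.

Lemma tent_weight_ge0 i : 0 <= tent_weight i.
Proof.
have le1 r := gomory_johnson_le1 r pi_gj.
by case: i => [|[|i]] /=; rewrite subr_ge0; exact: le1.
Qed.

Lemma sum_tent_weight : tent_weight 0 + tent_weight 1 + tent_weight 2 = 1.
Proof. by have := sum_vertices; rewrite /=; lra. Qed.

Hypothesis pi_pwl : piecewise_linear 2 pi.

(** The three tents are affine on every triangle, so it suffices to compare values at the vertices,
    which form four classes modulo Z^2. *)
Lemma pi_tents x : pi x = tent_weight 0 * tent_form 0 x +
  tent_weight 1 * tent_form 1 x + tent_weight 2 * tent_form 2 x.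
Proof.
have [_ pi0 _ _ _] := pi_gj; have S := sum_vertices.
have mk00 : mk 2 0 0 = 0 :> plane.
  by apply: (@plane_eq _ 2); rewrite // ?cX_mk ?cY_mk // ?cX0 ?cY0.
have lat (m k : int) : pi (mk 2 m%:~R k%:~R) = tent_weight 0 * tent m%:~R +
    tent_weight 1 * tent k%:~R + tent_weight 2 * tent (m + k)%:~R.
  have [a aE] := parity_cases m; have [b bE] := parity_cases k.
  rewrite /tent_weight; case: aE => ->; case: bE => ->.
  - have := pi_lattice a b 0 0; rewrite !addr0 mulr0z mk00 pi0 => ->.
    have -> : 2 * a + 2 * b = 2 * (a + b) by ring.
    by rewrite !tent_even; ring.
  - have := pi_lattice a b 0 1; rewrite !addr0 mulr0z mulr1z => ->.
    have -> : 2 * a + (2 * b + 1) = 2 * (a + b) + 1 by ring.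
    by rewrite tent_even !tent_odd -/B; lra.
  - have := pi_lattice a b 1 0; rewrite !addr0 mulr0z mulr1z => ->.
    have -> : 2 * a + 1 + 2 * b = 2 * (a + b) + 1 by ring.
    by rewrite tent_even !tent_odd -/A; lra.
  - have := pi_lattice a b 1 1; rewrite mulr1z => ->.
    rewrite (_ : 2 * a + 1 + (2 * b + 1) = 2 * (a + b + 1)); last by ring.
    by rewrite tent_even !tent_odd -/C; lra.
rewrite (piecewise_linear_interp (ltn0Sn 1) pi_pwl).
have [k [a [b [kD xk]]]] := ex_triangle 2 x.
rewrite (interp_bary _ kD xk) /bary !lat /tent_form /=.
have [/andP[x1 x2] /andP[y1 y2] h] := xk.
have XE : tent (X x) = tent a%:~R + (X x - a%:~R) * (tent (a + 1)%:~R - tent a%:~R).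
  by rewrite -tent_segment; [rewrite addrC subrK|lra].
have YE : tent (Y x) = tent b%:~R + (Y x - b%:~R) * (tent (b + 1)%:~R - tent b%:~R).
  by rewrite -tent_segment; [rewrite addrC subrK|lra].
rewrite XE YE.
have -> : a + 1 + b = a + b + 1 by ring.
have -> : a + (b + 1) = a + b + 1 by ring.
have -> : a + 1 + (b + 1) = a + b + 1 + 1 by ring.
case: k kD h {xk} => // _ h.
  have -> : tent (X x + Y x) = tent (a + b)%:~R + (X x + Y x - (a + b)%:~R) *
      (tent (a + b + 1)%:~R - tent (a + b)%:~R).
    by rewrite -tent_segment; [rewrite [X in _ = tent X]addrC subrK|rewrite !intrD; lra].
  by rewrite intrD; ring.
have -> : tent (X x + Y x) = tent (a + b + 1)%:~R + (X x + Y x - (a + b + 1)%:~R) *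
    (tent (a + b + 1 + 1)%:~R - tent (a + b + 1)%:~R).
  by rewrite -tent_segment; [rewrite [X in _ = tent X]addrC subrK|rewrite !intrD; lra].
rewrite !(intrD _ (a + b)) !(intrD _ a b) /=; ring.
Qed.

End TwoDimensionalTents.

Section TentExtreme.
Variables (R : realType) (f : 'rV[R]_2) (pi : 'rV[R]_2 -> R).
Local Notation plane := 'rV[R]_2.
Local Notation X := (cX 2).
Local Notation Y := (cY 2).
Local Notation gt := (grid_group R (4 * 2)).
Hypothesis fq : f \in grid R 2.
Hypothesis pi_min : minimal_function (Z2 R) f pi.
Hypothesis pi_pwl : piecewise_linear 2 pi.
Hypothesis ext : extreme_function (Z2_in_grid R (4 * 2)) (GridGroup (grid_mulr 4 fq))
  (fun x : gt => pi (val x)).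
Let pi_gj := minimal_gomory_johnson pi_min.
Local Notation w := (tent_weight pi).

Lemma tent_weight_defect (d : nat -> R) (i : nat) : (i < 3)%N -> (forall i, 0 <= d i) ->
  w 0 * d 0 + w 1 * d 1 + w 2 * d 2 = 0 -> 0 < w i -> d i = 0.
Proof.
move=> i3 d0 sum0 wi; have wd j : 0 <= w j * d j.
  by rewrite mulr_ge0 // (tent_weight_ge0 pi_gj).
apply: (mulfI (x := w i)); first by rewrite gt_eqF.
rewrite mulr0; have := wd 0%N; have := wd 1%N; have := wd 2%N.
by case: i i3 {wi} => [|[|[|//]]] _ *; lra.
Qed.

Lemma tent_form_f (i : nat) : (i < 3)%N -> 0 < w i -> tent_form i f = 1.
Proof.
move=> i3 wi; have [_ pi0 _ _ sym] := pi_gj.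
have := @tent_weight_defect (fun i => 1 - tent_form i f) i i3.
move=> /(_ (fun i => _)) H; apply/esym/eqP; rewrite -subr_eq0; apply/eqP/H => //.
  by move=> j; rewrite subr_ge0 tent_le1.
have := pi_tents fq pi_gj pi_pwl f; have := sum_tent_weight fq pi_gj.
by have := sym f; rewrite subrr pi0 addr0 => ->; lra.
Qed.

(** Where [pi] is additive, every tent of positive weight is additive, and at [f] each of them is 1.
    Their difference is therefore a perturbation of the extreme restriction. *)
Lemma tents_eq (i j : nat) : (i < 3)%N -> (j < 3)%N -> 0 < w i -> 0 < w j ->
  forall x : gt, tent_form i (val x) = tent_form j (val x).
Proof.
move=> i3 j3 wi wj x; apply/eqP; rewrite -subr_eq0; apply/eqP.
apply: (perturbation_eq0 (ltn0Sn 1) pi_gj ext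
  (psi := fun y : gt => tent_form i (val y) - tent_form j (val y))).
- by move=> y z zZ; rewrite raddfD /= !tent_form_periodic.
- by rewrite /= !tent_form_f // subrr.
- move=> y z E.
  have key k : (k < 3)%N -> 0 < w k -> tent_form k (val y) + tent_form k (val z) -
      tent_form k (val y + val z) = 0.
    move=> k3 wk; apply: (@tent_weight_defect (fun k => tent_form k (val y) +
      tent_form k (val z) - tent_form k (val y + val z)) k k3) => //.
      by move=> l; rewrite subr_ge0 tent_form_subadditive.
    move: E; rewrite [val (y + z)]raddfD !(pi_tents fq pi_gj pi_pwl) => E.
    by cbv beta; lra.
  have := key i i3 wi; have := key j j3 wj; rewrite raddfD /=; lra.
Qed.

(** Any two of the tents differ at (1/2, 0) or at (0, 1/2), so no two weights are positive. *)
Lemma pi_single_tent : exists2 i, (i < 3)%N & forall x, pi x = tent_form i x.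
Proof.
have t0 : tent 0 = 0 :> R by have := tent_even R 0; rewrite mulr0 mulr0z.
have t1 : tent 1 = 1 :> R by have := tent_odd R 0; rewrite mulr0 add0r mulr1z.
have g10 : mk 2 1 0 \in grid R (4 * 2) by apply: grid_mulr; exact: (mk_grid R (ltn0Sn 1) 1 0).
have g01 : mk 2 0 1 \in grid R (4 * 2) by apply: grid_mulr; exact: (mk_grid R (ltn0Sn 1) 0 1).
have ne i j (x : gt) : (i < 3)%N -> (j < 3)%N ->
    tent_form i (val x) <> tent_form j (val x) -> w i = 0 \/ w j = 0.
  move=> i3 j3 nex; have := tent_weight_ge0 pi_gj i; have := tent_weight_ge0 pi_gj j.
  rewrite !le_eqVlt => /orP[/eqP <-|wj]; first by right.
  move=> /orP[/eqP <-|wi]; first by left.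
  by case: nex; apply: tents_eq.
have one_neq0 : (1 : R) <> 0 by apply/eqP; exact: oner_neq0.
have n01 := ne 0%N 1%N (GridGroup g10) isT isT.
have n02 := ne 0%N 2%N (GridGroup g01) isT isT.
have n12 := ne 1%N 2%N (GridGroup g10) isT isT.
rewrite /tent_form /= !cX_mk // !cY_mk // ?addr0 ?add0r t0 t1 in n01 n02 n12.
have {}n01 := n01 one_neq0; have {}n02 := n02 (nesym one_neq0); have {}n12 := n12 (nesym one_neq0).
have pE := pi_tents fq pi_gj pi_pwl; have S := sum_tent_weight fq pi_gj.
have [[w0 w1]|[[w0 w2]|[w1 w2]]] : (w 0 = 0 /\ w 1 = 0) \/ (w 0 = 0 /\ w 2 = 0) \/
    (w 1 = 0 /\ w 2 = 0) by case: n01 n02 n12 => ? [] ? [] ?; auto.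
- have wE : w 2 = 1 by lra.
  by exists 2%N => // x; rewrite pE w0 w1 wE; ring.
- have wE : w 1 = 1 by lra.
  by exists 1%N => // x; rewrite pE w0 w2 wE; ring.
- have wE : w 0 = 1 by lra.
  by exists 0%N => // x; rewrite pE w1 w2 wE; ring.
Qed.

(** Up to a zero of [pi], where both summands vanish too, [x] is a multiple [s *: e] of a
    half-integral vector [e]. On the segment from 0 to [e], or to [- e], [pi] is linear, so the
    deviation is additive, hence affine, and it is zero at both ends. *)
Lemma deviation_eq0_two p1 p2 : valid_function (Z2 R) f p1 ->
  valid_function (Z2 R) f p2 -> pi = (fun r => 2^-1 * p1 r + 2^-1 * p2 r) ->
  forall x, deviation pi p1 x = 0.
Proof.
move=> v1 v2 piE x; have [i i3 tE] := pi_single_tent.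
have devD := deviation_add pi_min v1 v2 piE.
have devg := deviation_grid pi_min ext v1 v2 piE.
have t0 : tent 0 = 0 :> R by have := tent_even R 0; rewrite mulr0 mulr0z.
pose e : plane := if i == 1%N then mk 2 0 1 else mk 2 1 0.
have eg : e \in grid R 2.
  have eq01 := mk_grid R (ltn0Sn 1) 0 1; have eq10 := mk_grid R (ltn0Sn 1) 1 0.
  by rewrite /e; case: eqP.
have form_e s : linear_form i (s *: e) = s.
  rewrite /e; case: i i3 {tE e eg} => [|[|[|//]]] _ /=; rewrite !coordE ?cX_mk ?cY_mk //; ring.
pose m := Num.floor ((linear_form i x + 1) / 2).
pose s := linear_form i x - 2 * m%:~R.
have s1 : -1 <= s <= 1 by have := tent_le1 (linear_form i x); rewrite /tent ler_norml.
have formN z : linear_form i (- z) = - linear_form i z.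
  by case: i {i3 tE e eg form_e m s s1} => [|[|i]] /=; rewrite !coordE //; ring.
have piw : pi (x - s *: e) = 0.
  rewrite tE /tent_form linear_formD formN form_e.
  have -> : linear_form i x - s = 0 + 2 * m%:~R by rewrite /s; ring.
  by rewrite tent_periodic.
have devw : deviation pi p1 (x - s *: e) = 0.
  have [ge1 _ _ _ _] := average_gj1 pi_min v1 v2 piE.
  have [ge2 _ _ _ _] := average_gj2 pi_min v1 v2 piE.
  have H := piw; rewrite piE in H; rewrite /deviation piw.
  by have := ge1 (x - s *: e); have := ge2 (x - s *: e); lra.
have pise : pi (s *: e) = pi x.
  rewrite !tE /tent_form form_e -[RHS](tent_periodic _ (- m)) mulrNz.
  by congr tent; rewrite /s; ring.
have -> : deviation pi p1 x = deviation pi p1 (s *: e).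
  by have := devD (s *: e) (x - s *: e); rewrite pise piw addr0 addrC subrK devw addr0 => ->.
have ray (e' : plane) : e' \in grid R 2 ->
    (forall c, 0 <= c <= 1 -> pi (c *: e') = c) ->
    forall c, 0 <= c <= 1 -> deviation pi p1 (c *: e') = 0.
  move=> e'g pic c c01.
  pose P := [set z | exists2 b, 0 <= b <= 1 & z = b *: e'].
  have PI b : 0 <= b <= 1 -> P (b *: e') by move=> ?; exists b.
  have Pc : convex_set P.
    move=> _ _ t [b b01 ->] [b' b'01 ->] t01; rewrite !scalerA -scalerDl.
    case/andP: t01 b01 b'01 => ? ? /andP[? ?] /andP[? ?].
    by apply: PI; apply/andP; split; nra.
  have P0 : P 0 by rewrite -(scale0r e'); apply: PI; lra.
  have P1 : P e' by rewrite -(scale1r e'); apply: PI; lra.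
  have z0 : deviation pi p1 0 = 0 by apply: devg; rewrite rpred0.
  have z1 : deviation pi p1 e' = 0 by apply: devg; exact: grid_mulr.
  have devP u v : P u -> P v -> P (u + v) ->
      deviation pi p1 u + deviation pi p1 v = deviation pi p1 (u + v).
    move=> [b b01 ->] [b' b'01 ->] [b'' b''01 E].
    apply: devD; rewrite E !pic //; move: E; rewrite -scalerDl => /eqP.
    rewrite -subr_eq0 -scalerBl scaler_eq0 => /orP[/eqP E|/eqP e0]; first lra.
    have := pic 1 ltac:(lra); have := pic 0 ltac:(lra); rewrite e0 !scaler0; lra.
  have r0 : 0 < 1 / 8 :> R by lra.
  (* Both arguments are taken around the parameter 1/4, so that their sum stays within 1/4 of the
     midpoint of the segment. *)
  have inner a b : `|a| <= 1 / 8 -> `|b| <= 1 / 8 ->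
      [/\ P ((1 / 4) *: e' + a *: e'), P ((1 / 4) *: e' + b *: e')
        & P ((1 / 4) *: e' + (1 / 4) *: e' + (a + b) *: e')].
    rewrite !ler_norml => a1 b1.
    by split; rewrite -!scalerDl; apply: PI; lra.
  have P00 : P (0 + 0) by rewrite addr0.
  have P10 : P (e' + 0) by rewrite addr0.
  have := additive_affine Pc Pc Pc devP (deviation_lipschitz (ltn0Sn 1) pi_min pi_pwl v1 v2 piE)
    r0 inner P0 P0 P00 P1 P0 P10 (esym (add0r e')) c01.
  by rewrite add0r z0 z1 !mulr0 addr0.
have [s0|s0] := leP 0 s.
  by apply: ray => [//|c c01|]; [rewrite tE /tent_form form_e tent_norm ?ger0_norm; lra|lra].
rewrite -[s]opprK scaleNr -scalerN; apply: ray; [by rewrite rpredN| |lra] => c c01.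
by rewrite tE /tent_form scalerN formN form_e tent_norm ?normrN ?ger0_norm; lra.
Qed.

End TentExtreme.

Unset Implicit Arguments.

Theorem theorem1p5 (R : realType) (q : nat) (f : 'rV[R]_2) (pi : 'rV[R]_2 -> R)
    (q_gt0 : (0 < q)%N) (fq : f \in grid R q)
    (pi_min : minimal_function (Z2 R) f pi)
    (pi_pwl : piecewise_linear q pi)
    (pi_diag : diagonally_constrained q pi) :
  extreme_function (Z2 R) f pi <->
  extreme_function (Z2_in_grid R (4 * q)) (GridGroup (grid_mulr 4 fq))
    (fun x : grid_group R (4 * q) => pi (val x)).
Proof.
have N_gt0 : (0 < 4 * q)%N by rewrite muln_gt0.
split=> ext.
  by apply: extreme_restrict => //; exact: piecewise_linear_refine.
apply: (extreme_of_deviation pi_min) => p1 p2 v1 v2 piE.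
have [q_gt2|q_le2] := ltnP 2 q.
  exact: (deviation_eq0_large q_gt0 pi_min pi_pwl ext v1 v2 piE q_gt2 pi_diag).
clear pi_diag N_gt0.
case: q q_gt0 q_le2 fq pi_pwl ext => [//|[|[|//]]] _ _ fq pi_pwl ext.
  have [_ pi0 _ per sym] := minimal_gomory_johnson pi_min.
  have := sym f; rewrite subrr pi0 addr0 -(add0r f) per // pi0 => /esym/eqP.
  by rewrite oner_eq0.
exact: (deviation_eq0_two pi_min pi_pwl ext v1 v2 piE).
Qed.
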